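(* Consider a statistical Markov decision process with finite horizon $N\in\mathbb{N}$, parameter space $\Theta$, prior $\mu_0\in\mathcal{P}(\Theta)$ and risk-aversion parameter $\gamma>0$, with the notation given in the context. Assume: (C1) for all $n=0,\dots,N-1$ and all $x\in E$, the set $D_n(x)$ is compact; (C2) for all $n=1,\dots,N$, all $x,x'\in E$ and all $\vartheta\in\Theta$, the function $a\mapsto q_n^\vartheta(x,a,x')$ is lower semi-continuous on $D_{n-1}(x)$; (C3) for all $n=0,\dots,N-1$, all $x\in E$ and all $\vartheta\in\Theta$, the function $a\mapsto c_n^\vartheta(x,a)$ is lower semi-continuous on $D_n(x)$. Then: (a) min and sup can be interchanged, i.e. $$\min_{\pi\in\Pi}\ \sup_{\mu\in\mathcal{P}(\Theta)} L_N(\mu,\pi)=V_N=\sup_{\mu\in\mathcal{P}(\Theta)}\ \min_{\pi\in\Pi} L_N(\mu,\pi),$$ where the minima over $\Pi$ are attained. (b) There exists an optimal policy $\pi^*\in\Pi$, i.e. $V_N(\pi^* )=V_N$.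
   Context: Statistical Markov decision process. The state space $E$ and the action space $A$ are Borel spaces (Borel subsets of Polish spaces, with their Borel $\sigma$-algebras). For $n\in\mathbb{N}_0$, $D_n\subset E\times A$ is a Borel set containing the graph of a measurable map $E\to A$, and $D_n(x):=\{a\in A:(x,a)\in D_n\}$ is the set of feasible actions in state $x$ at time $n$. The parameter space $\Theta$ is a non-empty set with a $\sigma$-algebra. $\mathcal{P}(M)$ denotes the set of all probability measures on $M$. For each $n$, $\lambda_n$ is a probability measure on $E$. The functions $(\vartheta,x)\mapsto q_0^\vartheta(x)$ on $\Theta\times E$ and $(\vartheta,x,a,x')\mapsto q_n^\vartheta(x,a,x')$ on $\Theta\times D_{n-1}\times E$ ($n\ge1$) are non-negative and measurable, and are such that, for each $\vartheta$, $$Q_0^\vartheta(dx):=q_0^\vartheta(x)\lambda_0(dx),\qquad Q_n^\vartheta(dx'|x,a):=q_n^\vartheta(x,a,x')\lambda_n(dx')$$ are, respectively, a probability measure on $E$ (the law of the initial state) and a stochastic kernel from $D_{n-1}$ to $E$ (the law of the state at time $n$ given state $x$ and action $a$ at time $n-1$). Histories and policies. $H_0:=E$ and $H_n:=\{(h_{n-1},a_{n-1}):h_{n-1}\in H_{n-1},\ a_{n-1}\in D_{n-1}(x_{n-1})\}\times E$; elements are $h_n=(x_0,a_0,x_1,\dots,x_n)$. A randomized decision rule at stage $n$ is a measurable map $\pi_n:H_n\to\mathcal{P}(A)$ with $\pi_n(h_n)(D_n(x_n))=1$ for all $h_n\in H_n$. A policy is a sequence $\pi=(\pi_0,\dots,\pi_{N-1})$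 of randomized decision rules, $\pi_n$ being one at stage $n$; $\Pi$ is the set of all policies. A policy $\pi$ and a parameter $\vartheta$ determine the probability measure $\mathbb{P}_\pi^\vartheta:=Q_0^\vartheta\otimes\pi_0\otimes Q_1^\vartheta\otimes\pi_1\otimes\cdots\otimes\pi_{N-1}\otimes Q_N^\vartheta$ on $H_N$, with expectation $\mathbb{E}_\pi^\vartheta$; $(X_0,A_0,X_1,\dots,A_{N-1},X_N)$ denotes the coordinate process on $H_N$. Costs. $(\vartheta,x,a)\mapsto c_n^\vartheta(x,a)$ on $\Theta\times D_n$ ($n=0,\dots,N-1$) and $(\vartheta,x)\mapsto g_N^\vartheta(x)$ on $\Theta\times E$ are real-valued, measurable and bounded. Define $$C_{N\pi}(\vartheta):=\mathbb{E}_\pi^\vartheta\Big[\sum_{n=0}^{N-1}c_n^\vartheta(X_n,A_n)+g_N^\vartheta(X_N)\Big],\qquad C_{N\pi}(\mu):=\int C_{N\pi}(\vartheta)\,\mu(d\vartheta)\quad(\mu\in\mathcal{P}(\Theta)).$$ Criterion. For the fixed $\mu_0\in\mathcal{P}(\Theta)$ and $\gamma>0$, $$V_N(\pi):=\frac1\gamma\ln\Big(\int e^{\gamma C_{N\pi}(\vartheta)}\mu_0(d\vartheta)\Big),\qquad V_N:=\inf_{\pi\in\Pi}V_N(\pi).$$ The relative entropy is $I(\mu\|\nu):=\int\ln\big(\frac{d\mu}{d\nu}\big)d\mu$ if $\mu\ll\nu$ and $I(\mu\|\nu):=\infty$ otherwise, and $$L_N(\mu,\pi):=C_{N\pi}(\mu)-\frac1\gamma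 I(\mu\|\mu_0)\in[-\infty,\infty),\qquad (\mu,\pi)\in\mathcal{P}(\Theta)\times\Pi.$$ *)

(* Defs.v *)
From HB Require Import structures.
From mathcomp Require Import all_boot all_order all_algebra.
From mathcomp Require Import all_classical all_reals all_analysis.
From mathcomp Require Import measurable_realfun.

Set Implicit Arguments.
Unset Strict Implicit.
Unset Printing Implicit Defensive.

Import Order.TTheory GRing.Theory Num.Theory.
Import numFieldNormedType.Exports.

Local Open Scope measure_display_scope.
Local Open Scope charge_scope.
Local Open Scope classical_set_scope.
Local Open Scope ring_scope.

(* [T] is homeomorphic to a Borel subset of a complete separable metric
   space. *)
Definition borel_space (R : realType) (T : topologicalType) : Prop :=
  exists (P : metricType R) (f : T -> P),
    [/\ forall F : set_system P, ProperFilter F -> cauchy F -> exists x : P, F --> x,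
        exists2 S : set P, countable S & dense S,
        injective f,
        forall U : set T, open U <-> exists2 V : set P, open V & U = f @^-1` V
      & <<s @open P >> (range f)].

Definition borel (T : ptopologicalType) : measurableType (@open T).-sigma :=
  g_sigma_algebraType (@open T).

Section histories.
Variables E A : ptopologicalType.

Fixpoint hist_display (n : nat) : measure_display :=
  match n with
  | 0 => (@open E).-sigma
  | n'.+1 => measure_prod_display
               (measure_prod_display (hist_display n', (@open A).-sigma),
                (@open E).-sigma)
  end.

(* [E * A * E * ... * E] with its product sigma-algebra; the histories of the
   decision process form the subset [admissible n] below. *)
Fixpoint hist (n : nat) : measurableType (hist_display n) :=
  match n return measurableType (hist_display n) with
  | 0 => borel E
  | n'.+1 => (hist n' * borel A * borel E)%type
  end.

Definition last_state (n : nat) : hist n -> E :=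
  match n return hist n -> E with
  | 0 => fun x => x
  | _.+1 => fun h => h.2
  end.

(* [state k h] is the coordinate [x_k] of [h = (x_0, a_0, ..., x_n)] for
   [k <= n]. *)
Fixpoint state (k n : nat) : hist n -> E :=
  match n return hist n -> E with
  | 0 => fun x => x
  | n'.+1 => fun h => if k == n'.+1 then h.2 else state k h.1.1
  end.

(* [action k h] is the coordinate [a_k] of [h] for [k < n]; the value [point]
   is only returned for [k >= n]. *)
Fixpoint action (k n : nat) : hist n -> A :=
  match n return hist n -> A with
  | 0 => fun _ => point
  | n'.+1 => fun h => if k == n' then h.1.2 else action k h.1.1
  end.

Variable D : nat -> set (E * A).

Fixpoint admissible (n : nat) : set (hist n) :=
  match n return set (hist n) with
  | 0 => setT
  | n'.+1 => [set h | admissible h.1.1 /\ D n' (last_state h.1.1, h.1.2)]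
  end.

End histories.

Arguments admissible {E A} D n.

Definition rel_entropy (d : measure_display) (T : measurableType d)
    (R : realType) (mu nu : probability T R) : \bar R :=
  if `[< mu `<< nu >] then
    (\int[mu]_x lne (('d (charge_of_finite_measure mu) '/d nu) x))%E
  else +oo%E.

(* [m] is the minimum of [f], and it is attained. *)
Definition is_min (R : realType) (T : Type) (f : T -> \bar R) (m : \bar R) :
    Prop :=
  (exists x, f x = m) /\ forall x, (m <= f x)%E.

Section model.
Context (R : realType) (E A : ptopologicalType) (d : measure_display).
Context (Theta : measurableType d) (N : nat).

(* Functions given on a subset are represented by total functions, about which
   nothing is assumed outside of that subset; [q n] is only used for
   [1 <= n] and [cost n] for [n < N]. *)
Record smdp := SMDP {
  D : nat -> set (E * A);
  measurable_D : forall n, measurable (D n : set (borel E * borel A));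
  D_selector : forall n, exists2 f : borel E -> borel A,
    measurable_fun setT f & forall x, D n (x, f x);
  lambda : nat -> probability (borel E) R;
  q0 : Theta -> E -> R;
  q0_ge0 : forall t x, 0 <= q0 t x;
  measurable_q0 :
    measurable_fun setT (fun u : Theta * borel E => q0 u.1 u.2);
  integral_q0 : forall t, (\int[lambda 0]_x (q0 t x)%:E = 1)%E;
  q : nat -> Theta -> E -> A -> E -> R;
  q_ge0 : forall n t x a x', D n (x, a) -> 0 <= q n.+1 t x a x';
  measurable_q : forall n, measurable_fun
    [set u : Theta * borel E * borel A * borel E | D n (u.1.1.2, u.1.2)]
    (fun u => q n.+1 u.1.1.1 u.1.1.2 u.1.2 u.2);
  integral_q : forall n t x a, D n (x, a) ->
    (\int[lambda n.+1]_x' (q n.+1 t x a x')%:E = 1)%E;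
  cost : nat -> Theta -> E -> A -> R;
  measurable_cost : forall n, (n < N)%N -> measurable_fun
    [set u : Theta * borel E * borel A | D n (u.1.2, u.2)]
    (fun u => cost n u.1.1 u.1.2 u.2);
  bounded_cost : forall n, (n < N)%N ->
    exists K, forall t x a, D n (x, a) -> `|cost n t x a| <= K;
  final_cost : Theta -> E -> R;
  measurable_final_cost :
    measurable_fun setT (fun u : Theta * borel E => final_cost u.1 u.2);
  bounded_final_cost : exists K, forall t x, `|final_cost t x| <= K
}.

Variable M : smdp.

Definition feasible (n : nat) (x : E) : set A := [set a | D M n (x, a)].

Local Notation H n := (admissible (D M) n).

(* Only the rules of index [n < N] matter. *)
Record policy := Policy {
  rule : forall n, hist E A n -> pprobability (borel A) R;
  measurable_rule : forall n, (n < N)%N -> measurable_fun (H n) (@rule n);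
  rule_feasible : forall n, (n < N)%N -> forall h : hist E A n, H n h ->
    (@rule n h : probability (borel A) R) (feasible n (last_state h)) = 1%E
}.

Arguments rule : clear implicits.

Definition Q0 (t : Theta) (B : set (borel E)) : \bar R :=
  (\int[lambda M 0]_(x in B) (q0 M t x)%:E)%E.

Definition Q (n : nat) (t : Theta) (x : E) (a : A) (B : set (borel E)) :
    \bar R :=
  (\int[lambda M n]_(x' in B) (q M n t x a x')%:E)%E.

(* [m (x) pi_n (x) Q_(n+1)], for [m] a measure on histories. *)
Definition next_law (p : policy) (t : Theta) (n : nat)
    (m : set (hist E A n) -> \bar R) (B : set (hist E A n.+1)) : \bar R :=
  (\int[m]_(h in H n)
     \int[rule p n h : probability (borel A) R]_(a in
         feasible n (last_state h))
       Q n.+1 t (last_state h) a [set x' | B (h, a, x')])%E.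

(* [Q_0 (x) pi_0 (x) Q_1 (x) ... (x) Q_n], as a set function on [hist n]; it is
   a probability measure carried by the admissible histories for [n <= N], by
   [law_probability]. *)
Fixpoint law (p : policy) (t : Theta) (n : nat) : set (hist E A n) -> \bar R :=
  match n return set (hist E A n) -> \bar R with
  | 0 => Q0 t
  | n'.+1 => next_law p t (@law p t n')
  end.

Lemma measurable_last_state n :
  measurable_fun setT (@last_state E A n : hist E A n -> borel E).
Proof. by case: n => [|n]; [exact: measurable_id | exact: measurable_snd]. Qed.

Lemma measurable_admissible n : measurable (H n).
Proof.
elim: n => [|n IH]; first exact: measurableT.
have m1 : measurable_fun setT (fun h : hist E A n.+1 => h.1.1).
  exact: (measurableT_comp measurable_fst measurable_fst).
have m2 : measurable_fun setT (fun h : hist E A n.+1 =>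
    (last_state h.1.1, h.1.2) : borel E * borel A).
  apply/measurable_fun_pairP; split.
    exact: (measurableT_comp (@measurable_last_state n) m1).
  exact: (measurableT_comp measurable_snd measurable_fst).
rewrite (_ : H n.+1 = (setT `&` (fun h : hist E A n.+1 => h.1.1) @^-1` H n) `&`
   (setT `&` (fun h : hist E A n.+1 =>
       (last_state h.1.1, h.1.2) : borel E * borel A) @^-1` D M n)).
  apply: measurableI; [exact: m1 | exact: (m2 _ _ (measurable_D M n))].
by apply/seteqP; split => h /=; tauto.
Qed.

Let density n (t : Theta) : hist E A n.+1 -> R :=
  (fun u : hist E A n.+1 => q M n.+1 t (last_state u.1.1) u.1.2 u.2)
    \_ (H n.+1).

Let density_ge0 n t u : 0 <= density t (n := n) u.
Proof.
by rewrite /density patchE; case: ifPn => // /set_mem[_ Du]; exact: q_ge0.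
Qed.

Let measurable_density n t : measurable_fun setT (@density n t).
Proof.
apply/(measurable_restrictT _ (measurable_admissible n.+1)).
pose G (u : hist E A n.+1) : Theta * borel E * borel A * borel E :=
  (t, last_state u.1.1, u.1.2, u.2).
pose F := [set u : Theta * borel E * borel A * borel E |
  D M n (u.1.1.2, u.1.2)].
have mF : measurable F.
  have m12 : measurable_fun setT
      (fun u : Theta * borel E * borel A * borel E => (u.1.1.2, u.1.2)).
    apply/measurable_fun_pairP; split.
      apply: (measurableT_comp measurable_snd).
      exact: (measurableT_comp measurable_fst measurable_fst).
    exact: (measurableT_comp measurable_snd measurable_fst).
  by have := m12 measurableT _ (measurable_D M n); rewrite setTI.
have mG : measurable_fun setT G.
  have m1 : measurable_fun setT (fun h : hist E A n.+1 => h.1.1).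
    exact: (measurableT_comp measurable_fst measurable_fst).
  apply/measurable_fun_pairP; split; last exact: measurable_snd.
  apply/measurable_fun_pairP; split; last first.
    exact: (measurableT_comp measurable_snd measurable_fst).
  apply/measurable_fun_pairP; split; first exact: measurable_cst.
  exact: (measurableT_comp (@measurable_last_state n) m1).
have sF : [set G u | u in H n.+1] `<=` F by move=> _ [u [_ Du] <-].
exact: (measurable_comp mF sF (@measurable_q M n) (measurable_funTS mG)).
Qed.

Section step.
Variables (p : policy) (t : Theta) (n : nat) (nN : (n < N)%N).
Variable P : probability (hist E A n) R.
Hypothesis PH : P (H n) = 1%E.

Let rule_total (h : hist E A n) : pprobability (borel A) R :=
  if h \in H n then rule p n h else point.

Let measurable_rule_total : measurable_fun setT rule_total.
Proof.
have mH := measurable_admissible n.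
rewrite -(setUv (H n)).
apply/(measurable_funU _ mH (measurableC mH)); split.
  apply: (eq_measurable_fun (rule p n)); last exact: measurable_rule.
  by move=> h hH; rewrite /rule_total hH.
apply: (eq_measurable_fun (cst point)); last exact: measurable_cst.
move=> h /set_mem hH; rewrite /rule_total ifF//.
by apply: contra_notF hH => /set_mem.
Qed.

Let K := kprobability measurable_rule_total.

Let integrand (B : set (hist E A n.+1)) (u : hist E A n.+1) : \bar R :=
  (density t u * \1_B u)%:E.

Let inner (B : set (hist E A n.+1)) (ha : hist E A n * borel A) : \bar R :=
  (\int[lambda M n.+1]_x' integrand B (ha, x'))%E.

Let measurable_integrand B :
  measurable B -> measurable_fun setT (integrand B).
Proof.
move=> mB; apply/measurable_EFinP.
by apply: measurable_funM => //; exact: measurable_density.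
Qed.

Let integrand_ge0 B u : (0 <= integrand B u)%E.
Proof. by rewrite lee_fin mulr_ge0// density_ge0. Qed.

Let inner_ge0 B ha : (0 <= inner B ha)%E.
Proof. by apply: integral_ge0 => x' _; exact: integrand_ge0. Qed.

Let measurable_inner B : measurable B -> measurable_fun setT (inner B).
Proof.
move=> mB.
exact: (@measurable_fun_fubini_tonelli_F _ _ _ _ R (lambda M n.+1)
  _ (measurable_integrand mB) (integrand_ge0 B)).
Qed.

Let middle B (h : hist E A n) : \bar R := (\int[K h]_a inner B (h, a))%E.

Let middle_ge0 B h : (0 <= middle B h)%E.
Proof. by apply: integral_ge0 => a _; exact: inner_ge0. Qed.

Let measurable_middle B : measurable B -> measurable_fun setT (middle B).
Proof.
move=> mB.
exact: (measurable_fun_integral_finite_kernel _ K (inner_ge0 B)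
  (measurable_inner mB)).
Qed.

Let next_lawE B : measurable B -> next_law p t P B = (\int[P]_h middle B h)%E.
Proof.
move=> mB; rewrite /next_law integral_mkcond; apply: eq_integral => h _.
rewrite patchE; case: ifPn => hH; last first.
  rewrite /middle integral0_eq// => a _.
  rewrite /inner integral0_eq// => x' _; rewrite /integrand.
  rewrite /density patchE ifN ?mul0r//.
  by apply: contra hH => /set_mem[/mem_set].
have KE : K h = (rule p n h : probability (borel A) R)
    :> {measure set (borel A) -> \bar R}.
  by rewrite /K /kprobability /rule_total hH.
rewrite /middle KE.
rewrite [LHS]integral_mkcond; apply: eq_integral => a _.
rewrite patchE; case: ifPn => aD; last first.
  rewrite /inner integral0_eq// => x' _.
  rewrite /integrand /density patchE ifN ?mul0r//.
  by apply: contra aD => /set_mem[_ /mem_set].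
rewrite /Q [LHS]integral_mkcond /inner; apply: eq_integral => x' _.
rewrite /integrand /density !patchE [in RHS]ifT; last first.
  by apply/mem_set; split; exact: set_mem.
rewrite indicE /=; case: ifPn => [/set_mem/= Bx|Bx].
  by rewrite mem_set// mulr1.
by rewrite memNset ?mulr0// => Bx'; move/negP: Bx; apply; exact/mem_set.
Qed.

Let next_law_sigma : semi_sigma_additive (next_law p t P).
Proof.
move=> F mF tF mUF; apply: cvg_toP.
  apply: is_cvg_ereal_nneg_natsum => i _.
  by rewrite next_lawE//; apply: integral_ge0 => h _; exact: middle_ge0.
rewrite [RHS]next_lawE//; under eq_eseriesr do rewrite next_lawE//.
rewrite -integral_nneseries//; last first.
  by move=> i; exact: measurable_middle.
apply: eq_integral => h _; rewrite /middle -integral_nneseries//; last first.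
  move=> i; exact: (measurableT_comp (measurable_inner (mF i))).
apply: eq_integral => a _; rewrite /inner -integral_nneseries//; last first.
  by move=> i; exact: (measurableT_comp (measurable_integrand (mF i))).
apply: eq_integral => x' _.
rewrite /integrand; under eq_eseriesr do rewrite EFinM.
by rewrite nneseriesZl// EFinM indic_bigcup.
Qed.

Let next_law_ge0 B : (0 <= next_law p t P B)%E.
Proof.
apply: integral_ge0 => h _; apply: integral_ge0 => a Da.
by apply: integral_ge0 => x' _; rewrite lee_fin q_ge0.
Qed.

Let next_law0 : next_law p t P set0 = 0%E.
Proof.
by apply: integral0_eq => h _; apply: integral0_eq => a _; exact: integral_set0.
Qed.

Let next_law1 (B : set (hist E A n.+1)) :
  H n.+1 `<=` B -> next_law p t P B = 1%E.
Proof.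
move=> HB; transitivity (\int[P]_(h in H n) (cst 1 h))%E; last first.
  by rewrite integral_cst ?mul1e//; exact: measurable_admissible.
apply: eq_integral => h /set_mem Hh.
transitivity (\int[rule p n h : probability (borel A) R]_(a in
    feasible n (last_state h)) (cst 1 a))%E; last first.
  rewrite integral_cst ?mul1e; first exact: rule_feasible.
  have mx : measurable_fun setT
      (fun a : borel A => (last_state h, a) : borel E * borel A).
    exact: measurable_pair1.
  by have := mx measurableT _ (measurable_D M n); rewrite setTI.
apply: eq_integral => a /set_mem Da.
rewrite /Q (_ : [set x' | B (h, a, x')] = setT); first exact: integral_q.
by apply/seteqP; split => // x' _; apply: HB.
Qed.

Lemma next_law_probability :
  exists2 P' : probability (hist E A n.+1) R,
    next_law p t P = P' :> (set _ -> \bar R) & P' (H n.+1) = 1%E.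
Proof.
pose m1 := isMeasure.Build _ _ _ (next_law p t P) next_law0 next_law_ge0
  next_law_sigma.
pose m : {measure set (hist E A n.+1) -> \bar R} := HB.pack (next_law p t P) m1.
have mT : m setT = 1%E by apply: next_law1.
pose P' : probability (hist E A n.+1) R :=
  HB.pack (Measure.sort m) (Measure_isProbability.Build _ _ _ m mT).
have PE : next_law p t P = P' :> (set _ -> \bar R) by exact: erefl.
by exists P'; [exact: PE | rewrite -PE; apply: next_law1; exact: subset_refl].
Qed.

End step.

Lemma Q0_probability t :
  exists2 P : probability (borel E) R, Q0 t = P :> (set _ -> \bar R) &
    P setT = 1%E.
Proof.
have Q00 : Q0 t set0 = 0%E by exact: integral_set0.
have Q0ge0 B : (0 <= Q0 t B)%E.
  by apply: integral_ge0 => x _; rewrite lee_fin q0_ge0.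
have mq : measurable_fun setT (fun x : borel E => (q0 M t x)%:E).
  apply/measurable_EFinP.
  exact: (measurableT_comp (measurable_q0 M) (measurable_pair1 t)).
have Q0s : semi_sigma_additive (Q0 t).
  move=> F mF tF mUF; apply: cvg_toP.
    by apply: is_cvg_ereal_nneg_natsum => i _; exact: Q0ge0.
  apply/esym; apply: ge0_integral_bigcup => //.
    exact: measurable_funTS.
  by move=> x _; rewrite lee_fin q0_ge0.
pose m : {measure set (borel E) -> \bar R} :=
  HB.pack (Q0 t) (isMeasure.Build _ _ _ (Q0 t) Q00 Q0ge0 Q0s).
have mT : m setT = 1%E by exact: integral_q0.
pose P : probability (borel E) R :=
  HB.pack (Measure.sort m) (Measure_isProbability.Build _ _ _ m mT).
have PE : Q0 t = P :> (set _ -> \bar R) by exact: erefl.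
by exists P; [exact: PE | rewrite -PE].
Qed.

Lemma law_probability p t n : (n <= N)%N ->
  exists2 P : probability (hist E A n) R, @law p t n = P :> (set _ -> \bar R) &
    P (H n) = 1%E.
Proof.
elim: n => [_|n IH nN]; first exact: Q0_probability.
have [P lawE PH] := IH (ltnW nN).
have [P' nextE P'H] := next_law_probability p t nN PH.
by exists P'; [rewrite -nextE -lawE | ].
Qed.

Definition path_law (p : policy) (t : Theta) : set (hist E A N) -> \bar R :=
  @law p t N.

Let path_law0 p t : path_law p t set0 = 0%E.
Proof. by rewrite /path_law; have [P -> _] := law_probability p t (leqnn N). Qed.

Let path_law_ge0 p t B : (0 <= path_law p t B)%E.
Proof. by rewrite /path_law; have [P -> _] := law_probability p t (leqnn N). Qed.

Let path_law_sigma p t : semi_sigma_additive (path_law p t).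
Proof.
rewrite /path_law; have [P -> _] := law_probability p t (leqnn N).
exact: measure_semi_sigma_additive.
Qed.

Let path_lawT p t : path_law p t setT = 1%E.
Proof.
rewrite /path_law; have [P -> _] := law_probability p t (leqnn N).
exact: probability_setT.
Qed.

HB.instance Definition _ p t := isMeasure.Build _ _ R (path_law p t)
  (path_law0 p t) (@path_law_ge0 p t) (@path_law_sigma p t).

HB.instance Definition _ p t :=
  Measure_isProbability.Build _ _ R (path_law p t) (path_lawT p t).

Definition total_cost (t : Theta) (h : hist E A N) : R :=
  \sum_(n < N) cost M n t (state n h) (action n h) +
  final_cost M t (state N h).

Definition expected_cost (p : policy) (t : Theta) : R :=
  \int[path_law p t]_(h in H N) total_cost t h.

Definition mean_expected_cost (p : policy) (mu : probability Theta R) : R :=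
  \int[mu]_t expected_cost p t.

Variables (mu0 : probability Theta R) (gamma : R).

Definition policy_value (p : policy) : R :=
  gamma^-1 * ln (\int[mu0]_t expR (gamma * expected_cost p t)).

Definition optimal_value : \bar R :=
  ereal_inf (range (fun p => (policy_value p)%:E)).

Definition lagrangian (mu : probability Theta R) (p : policy) : \bar R :=
  ((mean_expected_cost p mu)%:E - (gamma^-1)%:E * rel_entropy mu mu0)%E.

End model.

(* Main.v *)
(* Neither a minimax theorem nor measurable selection is used. A randomized rule
   is a measurable function of the history and of a uniform random variable, and
   under the dominating measures [lambda M n] the states do not depend on the
   actions: for fixed states, a policy is the law of its actions, encoded as
   infinite words of bits. Tail convex combinations of such laws, applied to any
   sequence of policies, converge almost everywhere (parallelogram identity in
   L^2). Word weights that are additive over extensions are the law of a code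
   computed from a uniform variable, and disintegration turns the limit codes
   into a policy. Compactness of the feasible sets keeps the limit actions
   feasible; lower semicontinuity of [q] and [cost] and Fatou's lemma bound its
   expected cost, for every parameter, by the lower limit of the convex
   combinations of the expected costs.

   Hence convex nondecreasing functionals of the expected cost attain their
   minimum, and mixtures of two policies are dominated by a policy. By the Gibbs
   variational principle, [sup_mu L(mu, p)] is the value of [p]. If [p0]
   is optimal and [m0] is its Gibbs measure, with density proportional to
   [exp (gamma * C p0)], differentiating the value along mixtures of [p0] and [p]
   gives [C p0 m0 <= C p m0], so that [(m0, p0)] is a saddle point. *)

Require Import Defs.
From HB Require Import structures.
From mathcomp Require Import all_boot all_order all_algebra.
From mathcomp Require Import all_classical all_reals all_analysis.
From mathcomp Require Import measurable_realfun.
From mathcomp Require Import lra ring.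

Set Implicit Arguments.
Unset Strict Implicit.
Unset Printing Implicit Defensive.

Import Order.TTheory GRing.Theory Num.Theory.
Import numFieldNormedType.Exports.

Local Open Scope measure_display_scope.
Local Open Scope charge_scope.
Local Open Scope classical_set_scope.
Local Open Scope ring_scope.

(** * Codes and the uniform distribution *)

(** Semicontinuity is assumed in the actions alone, with no regularity in the states, so weak limits
    of the laws of histories would not control the costs: convergence has to take place for almost
    every fixed sequence of states. The exceptional null sets refer to the measures [lambda M n],
    hence not to the parameter. This is why one limit policy serves all parameters at once, as
    needed by a criterion that is nonlinear in the expected cost as a function of the parameter. For
    fixed states the cost is linear in the law of the actions, so convergence of the countably many
    word weights is enough. The delicate point is causality: each stage yields a law of all actions
    so far given all states so far, in which earlier actions must not depend on later states. For
    each word this is a linear identity between finitely many weights, so it survives combinations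
    and limits, and it makes the stagewise disintegrations fit together. The limit theorem takes two
    sequences of policies with weights [1 - eps] and [eps]: [eps = 0] gives a form of compactness,
    constant sequences give mixtures. *)

Definition cylinder (w : seq bool) : set (nat -> bool) :=
  [set c | mkseq c (size w) = w].

(** The empty set is included because disjoint cylinders exist and a generating family stable under
    intersection is wanted. *)
Definition cylinders : set (set (nat -> bool)) :=
  [set X | X = set0 \/ exists w, X = cylinder w].

Definition code := g_sigma_algebraType cylinders.

Lemma cylinder_nil : cylinder [::] = setT.
Proof. by apply/seteqP; split. Qed.

Lemma mkseq_take (c : nat -> bool) (m n : nat) :
  (m <= n)%N -> take m (mkseq c n) = mkseq c m.
Proof. by move=> mn; rewrite /mkseq -map_take take_iota (minn_idPl mn). Qed.

(** Two cylinders with a common point are nested, the longer word giving the smaller set. *)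
Lemma cylinders_setI : setI_closed cylinders.
Proof.
have sub v w c : (size v <= size w)%N -> cylinder v c -> cylinder w c ->
    cylinder v `&` cylinder w = cylinder w.
  move=> vw vc wc; apply: setIidr => c' wc'.
  by rewrite /cylinder/= -(mkseq_take _ vw) wc' -wc mkseq_take.
move=> _ _ [->|[v ->]] [->|[w ->]]; rewrite ?set0I ?setI0; try by left.
have [->|/set0P[c [vc wc]]] := eqVneq (cylinder v `&` cylinder w) set0.
  by left.
right; have [vw|/ltnW wv] := leqP (size v) (size w).
  by exists w; exact: sub vc wc.
by exists v; rewrite setIC; exact: sub wc vc.
Qed.

Lemma measurable_cylinder w : measurable (cylinder w : set code).
Proof. by apply: sub_sigma_algebra; right; exists w. Qed.

Lemma code_measure_unique (R : realType) (m1 m2 : {measure set code -> \bar R}) :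
  (m1 setT < +oo)%E -> (forall w, m1 (cylinder w) = m2 (cylinder w)) ->
  forall B, measurable B -> m1 B = m2 B.
Proof.
move=> m1oo m12 B mB.
apply: (@measure_unique _ R code cylinders (fun=> setT)) => //.
- exact: cylinders_setI.
- by move=> _; right; exists [::]; rewrite cylinder_nil.
- by apply/seteqP; split => // c _; exists 0%N.
- by move=> _ [->|[w ->]]; rewrite ?measure0.
Qed.

Lemma measurable_code d (T : measurableType d) (f : T -> code) :
  (forall m, measurable_fun setT (fun t => f t m)) -> measurable_fun setT f.
Proof.
move=> mf; apply: (measurability (rT := code) cylinders) => //= _ [_ [->|[w ->]] <-].
  by rewrite preimage_set0 setI0.
rewrite setTI [X in measurable X](_ : _ =
   \bigcap_(m in [set m | (m < size w)%N]) (fun t => f t m) @^-1` [set nth false w m]).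
  apply: bigcap_measurableType => m _.
   rewrite -[X in measurable X]setTI; exact: mf.
apply/seteqP; split => t /=.
  by rewrite /cylinder/= => wE m /= mw; rewrite -wE nth_mkseq.
move=> wE; rewrite /cylinder/=; apply: (@eq_from_nth _ false).
  by rewrite size_mkseq.
by move=> m; rewrite size_mkseq => mw; rewrite nth_mkseq// wE.
Qed.

Definition prefix_tuple (L : nat) (c : nat -> bool) : L.-tuple bool :=
  [tuple of mkseq c L].

Lemma cylinder_tupleE (L : nat) (w : L.-tuple bool) c :
  cylinder w c <-> prefix_tuple L c = w.
Proof.
rewrite /cylinder/= size_tuple; split => [wE|<-//]; exact: val_inj.
Qed.

Section integral_prefix.
Context d (T : measurableType d) (R : realType).
Variables (mu : {measure set T -> \bar R}) (b : T -> code).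
Hypothesis mb : measurable_fun setT b.
Variables (L : nat) (G : L.-tuple bool -> R).

Lemma measurable_preimage_cylinder w : measurable (b @^-1` cylinder w).
Proof. rewrite -[X in measurable X]setTI; by apply: mb => //; exact: measurable_cylinder. Qed.

Lemma prefix_indicE y :
  G (prefix_tuple L (b y)) = \sum_w G w * \1_(b @^-1` cylinder w) y.
Proof.
rewrite (bigD1 (prefix_tuple L (b y)))//= big1 ?addr0 => [|w wE].
  by rewrite indicE mem_set ?mulr1//=; exact/cylinder_tupleE.
rewrite indicE memNset ?mulr0//= => /cylinder_tupleE bw.
by move/eqP: wE; apply.
Qed.

Lemma measurable_prefix : measurable_fun setT (fun y => G (prefix_tuple L (b y))).
Proof.
under eq_fun do rewrite prefix_indicE.
apply: measurable_sum => w; apply: measurable_funM => //.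
exact/measurable_indic/measurable_preimage_cylinder.
Qed.

Hypothesis G0 : forall w, 0 <= G w.

(** A function of the first [L] bits takes finitely many values; limits of word weights will pass
    through such finite sums. *)
Lemma integral_prefix : (\int[mu]_y (G (prefix_tuple L (b y)))%:E =
  \sum_w (G w)%:E * mu (b @^-1` cylinder w))%E.
Proof.
under eq_integral do rewrite prefix_indicE -sumEFin.
rewrite ge0_integral_sum; [|by []|move=> w|move=> w y _]; last 2 first.
- rewrite /=; apply/measurable_EFinP; apply: measurable_funM => //.
  exact/measurable_indic/measurable_preimage_cylinder.
- by rewrite lee_fin mulr_ge0.
apply: eq_bigr => w _; under eq_integral do rewrite EFinM.
rewrite ge0_integralZl; [|by []| |by move=> *; rewrite lee_fin|by rewrite lee_fin]; last first.
  apply/measurable_EFinP; apply: measurable_indic.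
  exact: measurable_preimage_cylinder.
by rewrite integral_indic// ?setIT//; exact: measurable_preimage_cylinder.
Qed.

End integral_prefix.

Lemma measure_prefix_set d (T : measurableType d) (R : realType)
    (mu : {measure set T -> \bar R}) (b : T -> code) (L : nat)
    (B : set (L.-tuple bool)) : measurable_fun setT b ->
  mu [set y | B (prefix_tuple L (b y))] =
  (\sum_(w : L.-tuple bool) (\1_B w)%:E * mu (b @^-1` cylinder w))%E.
Proof.
move=> mb; rewrite -integral_prefix//.
have mB := @measurable_prefix _ _ R _ mb L \1_B.
rewrite (_ : (fun y => (\1_B (prefix_tuple L (b y)))%:E) =
   EFin \o \1_[set y | B (prefix_tuple L (b y))]).
  rewrite integral_indic ?setIT//.
  have := mB measurableT [set 1] (measurable_set1 _); rewrite setTI.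
  congr (measurable _); apply/seteqP; split => y /=; rewrite indicE.
    by case: (boolP (_ \in _)) => [/set_mem//|_ /esym/eqP]; rewrite oner_eq0.
  by move=> By; rewrite mem_set.
apply/funext => y /=; rewrite !indicE; congr (_%:R%:E).
Qed.

Lemma measure_cylinder_split d (T : measurableType d) (R : realType)
    (mu : {measure set T -> \bar R}) (b : T -> code) w : measurable_fun setT b ->
  mu [set y | cylinder w (b y)] =
  (mu [set y | cylinder (rcons w false) (b y)] +
   mu [set y | cylinder (rcons w true) (b y)])%E.
Proof.
move=> mb; have mc v : measurable [set y | cylinder v (b y)].
  by have := measurable_preimage_cylinder mb v.
rewrite -measureU//.
  congr (mu _); apply/seteqP; split => u /=.
    rewrite /cylinder/= !size_rcons !mkseqS => ->.
    by case: (b u (size w)); [right|left].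
  by rewrite /cylinder/= !size_rcons !mkseqS => -[] /rcons_inj[].
apply/seteqP; split => // u /= [].
by rewrite /cylinder/= !size_rcons !mkseqS => /rcons_inj[_ ->] /rcons_inj[].
Qed.

Section uniform01.
Context (R : realType).

Let lt01 : (0 < 1 :> R). Proof. by []. Qed.

Definition unif : probability (measurableTypeR R) R := uniform_prob lt01.

(** The half-open interval can be cut into consecutive half-open pieces, one for each word; the
    endpoint 1 is a null set. *)
Lemma unifE (X : set (measurableTypeR R)) : measurable X ->
  unif X = lebesgue_measure (X `&` `[0, 1[).
Proof.
move=> mX; transitivity (\int[unif]_x (\1_X x)%:E)%E.
  by rewrite integral_indic// setIT.
rewrite integral_uniform//; last exact/measurable_EFinP/measurable_indic.
rewrite subr0 invr1 mul1e integral_indic//.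
have -> : X `&` `[0, 1] = (X `&` `[0, 1[) `|` (X `&` [set 1]).
  apply/seteqP; split => [x [Xx]|x []] /=; rewrite ?in_itv/=.
  - move=> /andP[x0 x1]; have [xlt|xge] := ltP x 1; [left|right]; split => //=.
      exact/andP.
    by apply/eqP; rewrite eq_le x1.
  - by move=> [Xx /andP[x0 /ltW x1]]; split => //; exact/andP.
  - by move=> [Xx x1]; rewrite x1 in Xx *; split => //; rewrite lexx ler01.
rewrite measureU//=.
- rewrite [X in (_ + X)%E](_ : _ = 0%E) ?adde0//.
  apply: (@subset_measure0 _ _ _ lebesgue_measure _ [set 1 : R]) => //.
  - exact: measurableI.
  - exact: lebesgue_measure_set1.
- exact: measurableI.
- exact: measurableI.
- apply/seteqP; split => // x [[_ /=]]; rewrite in_itv/= => /andP[_ x1] [_ x1'].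
  by rewrite x1' ltxx in x1.
Qed.

End uniform01.

Section code_of_weights.
Context d (T : measurableType d) (R : realType).
Variable p : T -> seq bool -> R.
Local Notation U := (measurableTypeR R).

(* [0, 1[ is cut, for each n, into consecutive intervals of lengths [p t w],
   for w of length n in lexicographic order; [wlo t w] is the left end of the
   interval of [w]. *)
Definition wlo (t : T) (w : seq bool) : R :=
  \sum_(i < size w)
    (if nth false w i then p t (rcons (take i w) false) else 0).

(** The interval of [rcons w false] begins where that of [w] does; the next bit is true when [u]
    lies at or beyond its right end. *)
Definition wdigit (t : T) (u : U) (w : seq bool) : bool :=
  wlo t w + p t (rcons w false) <= u.

Fixpoint wword (t : T) (u : U) (n : nat) : seq bool :=
  if n is n'.+1 then rcons (wword t u n') (wdigit t u (wword t u n')) else [::].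

Definition wcode (tu : T * U) : code :=
  fun m => wdigit tu.1 tu.2 (wword tu.1 tu.2 m).

Lemma mkseq_wcode tu n : mkseq (wcode tu) n = wword tu.1 tu.2 n.
Proof. by elim: n => //= n IH; rewrite mkseqS IH. Qed.

Lemma wlo_rcons t w b :
  wlo t (rcons w b) = wlo t w + if b then p t (rcons w false) else 0.
Proof.
rewrite /wlo size_rcons big_ord_recr/=; congr (_ + _).
  apply: eq_bigr => i _; rewrite nth_rcons ltn_ord.
  by rewrite -[rcons w b]cats1 takel_cat// ltnW.
by rewrite nth_rcons ltnn eqxx -[rcons w b]cats1 take_size_cat.
Qed.

Hypothesis mp : forall w, measurable_fun setT (p ^~ w).

Lemma measurable_wcode : measurable_fun setT wcode.
Proof.
have mlo w : measurable_fun setT (wlo ^~ w).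
  by apply: measurable_sum => i; case: nth.
have mdig w : measurable_fun setT (fun tu : T * U => wdigit tu.1 tu.2 w).
  apply: measurable_fun_ler => //; apply: measurable_funD.
    by apply: (measurableT_comp (mlo w)).
  by apply: (measurableT_comp (mp _)).
have mword n w : measurable [set tu : T * U | wword tu.1 tu.2 n = w].
  elim: n w => [|n IH] w /=.
    case: w => [|a w]; first by rewrite [X in measurable X](_ : _ = setT)//; apply/seteqP; split.
    by rewrite [X in measurable X](_ : _ = set0)//; apply/seteqP; split.
  case/lastP: w => [|w b].
    rewrite [X in measurable X](_ : _ = set0)//; apply/seteqP; split => // tu /=.
    by move/(congr1 size); rewrite size_rcons.
  rewrite [X in measurable X](_ : _ = [set tu | wword tu.1 tu.2 n = w] `&`
    (fun tu : T * U => wdigit tu.1 tu.2 w) @^-1` [set b]).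
    apply: measurableI => //.
    by rewrite -[X in measurable X]setTI; exact: mdig.
  apply/seteqP; split => tu /=.
    by move=> /rcons_inj[<- <-].
  by move=> [-> ->].
apply: measurable_code => m; apply: (measurable_fun_bool true).
rewrite setTI [X in measurable X](_ : _ = \bigcup_(w in setT)
   ([set tu | wword tu.1 tu.2 m = w] `&`
    (fun tu : T * U => wdigit tu.1 tu.2 w) @^-1` [set true])).
  apply: countable_bigcupT_measurable => // w; apply: measurableI => //.
  by rewrite -[X in measurable X]setTI; exact: mdig.
apply/seteqP; split => tu /=.
  by move=> h; exists (wword tu.1 tu.2 m).
by move=> [w _ [/= <-]].
Qed.

(** These are the values on cylinders of a probability on bit sequences; [wcode] realizes it from a
    uniform variable, measurably in [t]. *)
Definition consistent (t : T) := [/\ forall w, 0 <= p t w, p t [::] = 1 &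
  forall w, p t w = p t (rcons w false) + p t (rcons w true)].

Lemma unif_wcode t w : consistent t ->
  unif R [set u | cylinder w (wcode (t, u))] = (p t w)%:E.
Proof.
move=> [p0 p1 pD].
(* The interval of [w] stays inside [0, 1[, so that intersecting with [0, 1[ loses no length. *)
have [lo0 hi1] : 0 <= wlo t w /\ wlo t w + p t w <= 1.
  elim/last_ind: w => [|w b [lo0 hi1]].
    by rewrite /wlo big_ord0 add0r p1.
  rewrite wlo_rcons; move: (p0 (rcons w false)) (p0 (rcons w true)) (pD w).
  by case: b; split; lra.
(* The word read off [u] is [w] exactly when [u] lies in the interval of [w], by induction on [w]
   from its last letter. *)
have cylE u : 0 <= u < 1 -> cylinder w (wcode (t, u)) <->
    wlo t w <= u < wlo t w + p t w.
  move=> u01; rewrite /cylinder/= mkseq_wcode/=.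
  clear lo0 hi1; elim/last_ind: w => [|w b IH].
    by rewrite /wlo big_ord0 add0r p1 u01.
  rewrite size_rcons/= wlo_rcons; move: (p0 (rcons w false)) (p0 (rcons w true)) (pD w).
  move=> pf pt pE; split.
    move=> /rcons_inj[wE]; rewrite wE => bE.
    have /andP[l1 l2] := IH.1 wE.
    case: b bE; rewrite /wdigit => bE; first by apply/andP; split; lra.
    move/negbT: bE; rewrite -ltNge => bE; apply/andP; split; lra.
  move=> bu; have wE : wlo t w <= u < wlo t w + p t w.
    by case: b bu => /andP[? ?]; apply/andP; split; lra.
  rewrite (IH.2 wE); congr (rcons _ _); rewrite /wdigit.
  case: b bu => /andP[? ?]; first lra.
  by apply/negbTE; rewrite -ltNge; lra.
rewrite unifE; last first.
  rewrite [X in measurable X](_ : _ = (fun u => wcode (t, u)) @^-1` cylinder w)//.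
  rewrite -[X in measurable X]setTI.
  apply: (measurableT_comp measurable_wcode (measurable_pair1 t)) => //.
  exact: measurable_cylinder.
rewrite [X in lebesgue_measure X](_ : _ = `[wlo t w, wlo t w + p t w[%classic).
  rewrite lebesgue_measure_itv/= lte_fin; case: ifPn => [_|].
    by rewrite -EFinB addrAC subrr add0r.
  by rewrite -leNgt => h; congr EFin; have := p0 w; lra.
apply/seteqP; split => u /=; rewrite !in_itv/=.
  by move=> [/cylE h /h].
move=> h; have u01 : 0 <= u < 1.
  by move: h => /andP[? ?]; apply/andP; split; lra.
by split => //; apply/cylE.
Qed.

End code_of_weights.

(** * Coding of Borel spaces *)

Definition pair_nat (i j : nat) : nat := pickle (i, j).
Definition unpair_nat (m : nat) : nat * nat := odflt (0, 0)%N (unpickle m).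

Lemma pair_natK i j : unpair_nat (pair_nat i j) = (i, j).
Proof. by rewrite /unpair_nat /pair_nat pickleK. Qed.

Lemma mkseq_eqP (c c' : nat -> bool) L :
  mkseq c L = mkseq c' L <-> forall m, (m < L)%N -> c m = c' m.
Proof.
split => [cc' m mL|cc'].
  by rewrite -(nth_mkseq false c mL) cc' nth_mkseq.
apply: (@eq_from_nth _ false); rewrite !size_mkseq// => m mL.
by rewrite !nth_mkseq// cc'.
Qed.

Lemma measurable_code_bit m : measurable [set c : code | c m].
Proof.
rewrite [X in measurable X](_ : _ =
    \bigcup_(w in [set w : m.+1.-tuple bool | nth false w m]) cylinder w).
  by apply: fin_bigcup_measurable => // w _; exact: measurable_cylinder.
apply/seteqP; split => [c cm|c [w /= wm] /cylinder_tupleE wE] /=.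
  exists (prefix_tuple m.+1 c); last exact/cylinder_tupleE.
  by rewrite /= nth_mkseq.
by rewrite -wE /= nth_mkseq in wm.
Qed.

Lemma mdist_ball_open (R : realType) (P : metricType R) (p : P) (r : R) :
  open (ball p r).
Proof.
rewrite openE => q; rewrite ballEmdist/= => pq; apply/nbhs_ballP.
exists (r - mdist p q) => /=; first by rewrite subr_gt0.
move=> z; rewrite !ballEmdist/=; have := metric_triangle p q z; lra.
Qed.

Section coding.
Variables (R : realType) (A : ptopologicalType) (P : metricType R) (f : A -> P).
Variable e : nat -> P.
Hypothesis complete_P :
  forall F : set_system P, ProperFilter F -> cauchy F -> exists x : P, F --> x.
Hypothesis dense_e : forall p (r : R), 0 < r -> exists i, mdist p (e i) < r.
Hypothesis f_inj : injective f.
Hypothesis open_f : forall U : set A,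
  open U <-> exists2 V : set P, open V & U = f @^-1` V.
Hypothesis borel_f : <<s @open P >> (range f).

Let h (j : nat) : R := j.+1%:R^-1.

Let h_gt0 j : 0 < h j. Proof. by rewrite invr_gt0. Qed.

Let h_small (r : R) : 0 < r -> exists j, h j < r.
Proof.
move=> r0; have [j _ hj] := near_infty_natSinv_lt (PosNum r0).
by exists j; exact: hj j (leqnn j).
Qed.

Let dist_le0 (x y : P) : (forall r : R, 0 < r -> mdist x y <= r) -> x = y.
Proof.
move=> xy; apply: (@mdist_positivity R); apply/eqP; rewrite eq_le mdist_ge0 andbT.
by apply/ler_addgt0Pr => r r0; rewrite add0r xy.
Qed.

(* The bit of index [pair_nat j i] tells whether [f a] is within [h j] of the
   [i]-th point of the dense sequence. *)
Definition ball_code (a : borel A) : code :=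
  fun m => mdist (f a) (e (unpair_nat m).2) < h (unpair_nat m).1.

(** The first index whose bit at level [j] is set, and 0 if there is none. On the code of a point it
    designates a point of the dense sequence within [h j]. *)
Definition center (c : code) (j : nat) : nat :=
  xget 0%N [set i | c (pair_nat j i) /\ forall k, (k < i)%N -> ~~ c (pair_nat j k)].

(** The code of a point satisfies this by the triangle inequality; conversely, since [h j] tends to
    0, it makes the centers a Cauchy sequence with explicit rate. *)
Definition good (c : code) := forall j l,
  mdist (e (center c j)) (e (center c l)) <= h j + h l.

Definition limit_point (c : code) (z : P) :=
  good c /\ forall j, mdist (e (center c j)) z <= h j.

Definition decodeP (c : code) : P := xget (f point) [set z | limit_point c z].

(** Injectivity of [f] leaves at most one candidate; a code whose limit lies outside the range of
    [f] decodes to [point]. *)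
Definition decode (c : code) : borel A := xget point [set a | f a = decodeP c].

Let centerP (c : code) j : (exists i, c (pair_nat j i)) -> c (pair_nat j (center c j)).
Proof.
move=> ex; have [i ci mini] := ex_minnP ex.
rewrite /center; case: xgetP => [_ _ []//|] /(_ i); apply: contra_notP => _.
by split=> // k ki; apply: contraTN ki => /mini; rewrite leqNgt.
Qed.

Let limit_point_unique c z z' : limit_point c z -> limit_point c z' -> z = z'.
Proof.
move=> [_ cz] [_ cz']; apply: dist_le0 => r r0.
have [j hj] : exists j, h j < r / 2 by apply: h_small; rewrite divr_gt0.
apply: (le_trans (metric_triangle _ (e (center c j)) _)).
rewrite metric_sym; have := cz j; have := cz' j; lra.
Qed.

Let limit_point_exists c : good c -> exists z, limit_point c z.
Proof.
move=> gc; pose y j := e (center c j).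
have [z yz] : exists z : P, y @ \oo --> z.
  apply: (@complete_P (y @ \oo) _); apply: cauchy_exP => r r0.
  have [J hJ] : exists J, h J < r / 2 by apply: h_small; rewrite divr_gt0.
  exists (y J); exists J => // j /= Jj; rewrite ballEmdist/=.
  apply: (le_lt_trans (gc _ _)).
  have : h j <= h J by rewrite lef_pV2 ?posrE// ler_nat.
  lra.
exists z; split => // j; apply/ler_addgt0Pr => r r0.
have r4 : 0 < r / 2 by rewrite divr_gt0.
have [J _ HJ] : \forall l \near \oo, mdist z (y l) < r / 2.
  by have /cvg_ballP/(_ _ r4) := yz; under eq_near do rewrite ballEmdist.
have [K hK] := h_small r4.
pose l := maxn J K.
have := HJ l (leq_maxl _ _); have := gc j l.
have : h l <= h K by rewrite lef_pV2 ?posrE// ler_nat ltnS leq_maxr.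
have := metric_triangle (e (center c j)) (y l) z.
by rewrite (metric_sym (y l)) /y; lra.
Qed.

Let decodePP c : good c -> limit_point c (decodeP c).
Proof. by move=> gc; apply: (xgetPex (f point)); exact: limit_point_exists. Qed.

Let decodePE c z : limit_point c z -> decodeP c = z.
Proof.
move=> cz; apply: (@limit_point_unique c) => //.
by apply: decodePP; case: cz.
Qed.

Let decodeE c a : f a = decodeP c -> decode c = a.
Proof.
move=> fa; apply: f_inj; rewrite fa.
by apply: (@xgetPex _ point [set b | f b = decodeP c]); exists a.
Qed.

Lemma measurable_ball_code : measurable_fun setT ball_code.
Proof.
apply: measurable_code => m; apply: (measurable_fun_bool true).
rewrite setTI; apply: sub_sigma_algebra; apply/open_f.
exists (ball (e (unpair_nat m).2) (h (unpair_nat m).1)).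
  exact: mdist_ball_open.
by apply/seteqP; split => a; rewrite ballEmdist/= /ball_code metric_sym.
Qed.

Let measurable_center (S : set nat) j : measurable [set c | S (center c j)].
Proof.
pose F i := [set c : code | c (pair_nat j i) /\ forall k, (k < i)%N -> ~~ c (pair_nat j k)].
have mF i : measurable (F i).
  rewrite (_ : F i = [set c : code | c (pair_nat j i)] `&`
      \bigcap_(k in [set k | (k < i)%N]) ~` [set c : code | c (pair_nat j k)]).
    apply: measurableI; first exact: measurable_code_bit.
    apply: bigcap_measurableType => k _; apply: measurableC.
    exact: measurable_code_bit.
  by apply/seteqP; split => c [/= ci ck]; split => // k /ck/negP.
have FE i c : F i c -> center c j = i.
  move=> Fi; rewrite /center; case: xgetP => [k _ [ck mk]|/(_ i)//].
  case: Fi => ci mi; case: (ltngtP k i) => //.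
    by move=> /mi; rewrite ck.
  by move=> /mk; rewrite ci.
have F0 c : (forall i, ~ F i c) -> center c j = 0%N.
  by move=> nF; rewrite /center; case: xgetP => // k _ /nF.
rewrite [X in measurable X](_ : _ = (\bigcup_(i in S) F i) `|`
    (if `[< S 0%N >] then ~` (\bigcup_i F i) else set0)).
  apply: measurableU; first exact: bigcup_measurable.
  by case: asboolP => // _; apply: measurableC; exact: bigcup_measurable.
apply/seteqP; split => c /=.
  have [[i Fi]|nF] := pselect (exists i, F i c).
    by rewrite (FE _ _ Fi) => Si; left; exists i.
  rewrite F0 => [S0|i Fi]; last by apply: nF; exists i.
  by right; rewrite asboolT// => -[i _ Fi]; apply: nF; exists i.
case => [[i Si Fi]|]; first by rewrite (FE _ _ Fi).
by case: asboolP => // S0 nF; rewrite F0// => i Fi; apply: nF; exists i.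
Qed.

Let measurable_good : measurable [set c | good c].
Proof.
rewrite [X in measurable X](_ : _ = \bigcap_j \bigcap_l \bigcup_i
   ([set c | center c j = i] `&`
    [set c | mdist (e i) (e (center c l)) <= h j + h l])).
  apply: bigcap_measurableType => j _; apply: bigcap_measurableType => l _.
  apply: bigcup_measurable => i _.
  by apply: measurableI; [exact: (measurable_center (fun n => n = i))|
    exact: (measurable_center (fun n => mdist (e i) (e n) <= h j + h l))].
apply/seteqP; split => c /=.
  by move=> gc j _ l _; exists (center c j) => //; split => //; exact: gc.
by move=> gc j l; have [i _ [/= <-]] := gc j I l I.
Qed.

Let measurable_decodeP (X : set P) :
  <<s @open P >> X -> measurable (decodeP @^-1` X).
Proof.
suff : <<s @open P >> `<=` [set X | measurable (decodeP @^-1` X)] by exact.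
apply: smallest_sub.
  split => [|Y mY|F mF] /=.
  - by rewrite preimage_set0.
  - by rewrite setTD -preimage_setC; exact: measurableC.
  - by rewrite preimage_bigcup; apply: bigcupT_measurable => i; exact: mF.
move=> V oV /=.
(* The decoded point of a good code is within [h j] of its center of level [j]; it lies in the open
   set [V] iff some ball of radius [2 * h j] about a center is inside [V]. This involves countably
   many conditions on centers. *)
rewrite (_ : decodeP @^-1` V = ([set c | good c] `&` \bigcup_j
     [set c | ball (e (center c j)) (2 * h j) `<=` V]) `|`
   (~` [set c | good c] `&` (if `[< V (f point) >] then setT else set0))).
  apply: measurableU; apply: measurableI => //.
  - apply: bigcup_measurable => j _.
    exact: (measurable_center (fun i => ball (e i) (2 * h j) `<=` V)).
  - exact: measurableC.
  - by case: ifP.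
have ng c : ~ good c -> decodeP c = f point.
  by move=> ngc; rewrite /decodeP; case: xgetP => // z _ [].
apply/seteqP; split => c /=.
  have [gc|ngc] := pselect (good c); last first.
    by rewrite (ng _ ngc) => Vp; right; rewrite asboolT.
  move=> Vc; left; split => //.
  move: oV; rewrite openE => /(_ _ Vc); rewrite /interior.
  move=> /nbhs_ballP[r /= r0 rV].
  (* One third, because a point within [2 * h j] of the center is within [3 * h j] of the decoded
     point. *)
  have [j hj] : exists j, h j < r / 3 by apply: h_small; rewrite divr_gt0.
  exists j => // z; rewrite ballEmdist/= => cz; apply: rV.
  rewrite ballEmdist/=; have := (decodePP gc).2 j.
  have := metric_triangle (decodeP c) (e (center c j)) z.
  by rewrite (metric_sym (decodeP c) (e _)); lra.
case=> [[gc [j _]]|[ngc]].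
  apply; rewrite ballEmdist/=; have := (decodePP gc).2 j.
  by have := h_gt0 j; lra.
by rewrite (ng _ ngc); case: asboolP.
Qed.

(** The codes for which the default [point] is used form a measurable set because the range of [f]
    is Borel. *)
Lemma measurable_decode : measurable_fun setT decode.
Proof.
apply: (measurability (rT := borel A) (@open A)) => //= _ [U oU <-].
rewrite setTI; have [V oV UV] := (open_f U).1 oU.
have mR := measurable_decodeP borel_f.
have mV : measurable (decodeP @^-1` V).
  by apply: measurable_decodeP; exact: sub_sigma_algebra.
rewrite (_ : decode @^-1` U = (decodeP @^-1` range f `&` decodeP @^-1` V) `|`
   (~` (decodeP @^-1` range f) `&` (if `[< U point >] then setT else set0))).
  apply: measurableU; apply: measurableI => //; first exact: measurableC.
  by case: ifP.
apply/seteqP; split => c /=.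
  have [[a _ fa]|nr] := pselect (range f (decodeP c)).
    rewrite (decodeE fa) UV => Va; left; split; first by exists a.
    by rewrite -fa.
  move=> Uc; right; split => //; rewrite asboolT//.
  suff <- : decode c = point by [].
  by rewrite /decode; case: xgetP => // a _ /= fa; case: nr; exists a.
case=> [[[a _ fa] Vc]|[nr]].
  by rewrite (decodeE fa) UV /= fa.
case: asboolP => // Up _; suff -> : decode c = point by [].
by rewrite /decode; case: xgetP => // a _ /= fa; case: nr; exists a.
Qed.

Let center_ball_code a j : mdist (f a) (e (center (ball_code a) j)) < h j.
Proof.
have [i fi] := dense_e (f a) (h_gt0 j).
have := @centerP (ball_code a) j; rewrite /ball_code pair_natK; apply.
by exists i; rewrite pair_natK.
Qed.

Lemma ball_codeK : cancel ball_code decode.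
Proof.
move=> a; apply: decodeE; apply/esym/decodePE; split=> [j l|j].
  apply: (le_trans (metric_triangle _ (f a) _)).
  by rewrite metric_sym lerD// ltW// center_ball_code.
by rewrite metric_sym ltW// center_ball_code.
Qed.

Let continuous_f : continuous f.
Proof. by apply/continuousP => V oV; apply/open_f; exists V. Qed.

(** This replaces convergence of actions by agreement of prefixes. Each level of [c] involves a
    bounded number of bits, shared with the code of some point of [K]; these points approach the
    limit of the centers, which stays in the compact image of [K]. *)
Lemma decode_closure (K : set A) (c : code) : compact K ->
    (forall L, exists2 a, K a & mkseq (ball_code a) L = mkseq c L) ->
  K (decode c) /\ forall V, nbhs (decode c) V ->
    exists L, forall a, K a -> mkseq (ball_code a) L = mkseq c L -> V a.
Proof.
move=> cK Kc.
have bit j i L a : (pair_nat j i < L)%N -> mkseq (ball_code a) L = mkseq c L ->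
    c (pair_nat j i) -> mdist (f a) (e i) < h j.
  by move=> jL /mkseq_eqP/(_ _ jL) <-; rewrite /ball_code pair_natK.
(* Without compactness the set bits of level [j] could escape to infinity and leave none in [c]. A
   finite subcover by balls of radius [h j] bounds their indices, so that one of them is seen in a
   prefix of fixed length [L]. *)
have ex j : exists i, c (pair_nat j i).
  have := cK; rewrite compact_cover.
  move=> /(_ _ setT (fun i => [set a | mdist (f a) (e i) < h j])).
  case=> [i _||D _ KD].
  - apply/open_f; exists (ball (e i) (h j)); first exact: mdist_ball_open.
    by apply/seteqP; split => a; rewrite ballEmdist/= metric_sym.
  - by move=> a _; have [i fi] := dense_e (f a) (h_gt0 j); exists i.
  pose L := (\max_(i <- finmap.enum_fset D) pair_nat j i).+1.
  have [a Ka aL] := Kc L; have [i /= iD fi] := KD _ Ka.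
  exists i; have jL : (pair_nat j i < L)%N by rewrite ltnS; apply: leq_bigmax_seq.
  by have /mkseq_eqP/(_ _ jL) <- := aL; rewrite /ball_code pair_natK.
have agree j L a : (pair_nat j (center c j) < L)%N ->
    mkseq (ball_code a) L = mkseq c L -> mdist (f a) (e (center c j)) < h j.
  by move=> jL aL; apply: bit jL aL _; exact: centerP.
have gc : good c.
  move=> j l; pose L := (maxn (pair_nat j (center c j)) (pair_nat l (center c l))).+1.
  have [a Ka aL] := Kc L.
  have jL : (pair_nat j (center c j) < L)%N by rewrite ltnS leq_maxl.
  have lL : (pair_nat l (center c l) < L)%N by rewrite ltnS leq_maxr.
  have := agree j _ _ jL aL; have := agree l _ _ lL aL.
  have := metric_triangle (e (center c j)) (f a) (e (center c l)).
  by rewrite (metric_sym (e (center c j)) (f a)); lra.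
have [_ cz] := decodePP gc.
have near_z j : exists L, forall a, mkseq (ball_code a) L = mkseq c L ->
    mdist (decodeP c) (f a) < 2 * h j.
  exists (pair_nat j (center c j)).+1 => a /(agree j _ _ (leqnn _)).
  have := metric_triangle (decodeP c) (e (center c j)) (f a); have := cz j.
  by rewrite (metric_sym (decodeP c) (e _)) (metric_sym (f a)); lra.
(* The image of [K] is compact in a Hausdorff space, hence closed, and meets every ball about the
   decoded point. *)
have : (f @` K) (decodeP c).
  apply: (compact_closed (@metric_hausdorff _ P)).
    by apply: continuous_compact => //; exact: continuous_subspaceT.
  move=> B /nbhs_ballP[r /= r0 rB].
  have [j hj] : exists j, h j < r / 2 by apply: h_small; rewrite divr_gt0.
  have [L HL] := near_z j; have [a Ka aL] := Kc L.
  exists (f a); split; first by exists a.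
  by apply: rB; rewrite ballEmdist/=; have := HL _ aL; lra.
move=> [a Ka fa]; rewrite (decodeE fa); split => // V.
rewrite nbhsE => -[U [oU Ua] UV]; have [W oW UW] := (open_f U).1 oU.
have Wz : W (decodeP c) by move: Ua; rewrite UW -fa.
move: oW; rewrite openE => /(_ _ Wz); rewrite /interior.
move=> /nbhs_ballP[r /= r0 rW].
have [j hj] : exists j, h j < r / 2 by apply: h_small; rewrite divr_gt0.
have [L HL] := near_z j; exists L => b Kb bL; apply: UV; rewrite UW/=.
by apply: rW; rewrite ballEmdist/=; have := HL _ bL; lra.
Qed.

End coding.

Lemma borel_space_code (R : realType) (A : ptopologicalType) :
  borel_space R A -> exists (s : borel A -> code) (r : code -> borel A),
  [/\ measurable_fun setT s, measurable_fun setT r, cancel s r &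
    forall (K : set A) (c : code), compact K ->
      (forall L, exists2 a, K a & mkseq (s a) L = mkseq c L) ->
    K (r c) /\ forall V, nbhs (r c : A) V ->
      exists L, forall a, K a -> mkseq (s a) L = mkseq c L -> V a].
Proof.
move=> [P [f [cP [S /countable_injP[g ginj] dS] finj fopen fborel]]].
pose e i := xget (f point) [set p | S p /\ g p = i].
have de (p : P) (r : R) : 0 < r -> exists i, mdist p (e i) < r.
  move=> r0; have ball0 : ball p r !=set0 by exists p; exact: ballxx.
  have [q []] := dS _ ball0 (mdist_ball_open p r).
  rewrite ballEmdist/= => pq Sq; exists (g q).
  suff -> : e (g q) = q by [].
  rewrite /e; case: xgetP => [q' _ [Sq' gq']|/(_ q)]; last by case.
  by apply: ginj; rewrite ?inE.
exists (ball_code f e), (decode f e); split.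
- exact: measurable_ball_code.
- exact: measurable_decode.
- exact: ball_codeK.
- by move=> K c; exact: decode_closure.
Qed.

(** * Disintegration *)

Section image_probability.
Context d1 d2 (T1 : measurableType d1) (T2 : measurableType d2) (R : realType).
Variables (P : probability T1 R) (f : T1 -> T2).
Hypothesis mf : measurable_fun setT f.

Let mf_mixin := isMeasurableFun.Build _ _ _ _ f mf.
Let mfp : {mfun T1 >-> T2} := HB.pack f mf_mixin.

Definition image_prob : probability T2 R := distribution P mfp.

Lemma image_probE B : image_prob B = P (f @^-1` B).
Proof. by []. Qed.

Lemma integral_image_prob (F : T2 -> \bar R) :
  measurable_fun setT F -> (forall y, 0 <= F y)%E ->
  (\int[image_prob]_y F y = \int[P]_x F (f x))%E.
Proof.
by move=> mF F0; rewrite [LHS](ge0_integral_pushforward mf).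
Qed.

End image_probability.

Lemma ae_forall_count d (T : measurableType d) (R : realType)
    (mu : {measure set T -> \bar R}) (I : countType) (P : I -> T -> Prop) :
  (forall i, {ae mu, forall t, P i t}) -> {ae mu, forall t, forall i, P i t}.
Proof.
move=> aeP.
have : {ae mu, forall t, forall n : nat, if unpickle n is Some i then P i t else True}.
  apply: ae_foralln => n; case: (unpickle n) => [i|]; first exact: aeP.
  exact: aeW.
by apply: filterS => t Pt i; have := Pt (pickle i); rewrite pickleK.
Qed.

Section rectangle_unique.
Context d1 d2 (T1 : measurableType d1) (T2 : measurableType d2) (R : realType).
Variables P1 P2 : probability (T1 * T2)%type R.

Lemma rectangle_unique :
  (forall A B, measurable A -> measurable B -> P1 (A `*` B) = P2 (A `*` B)) ->
  forall C, measurable C -> P1 C = P2 C.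
Proof.
move=> P12 C mC.
apply: (@measure_unique _ R (T1 * T2)%type
  [set A `*` B | A in measurable & B in measurable] (fun=> setT)) => //.
- exact: measurable_prod_measurableType.
- move=> _ _ [A1 mA1 [B1 mB1 <-]] [A2 mA2 [B2 mB2 <-]].
  exists (A1 `&` A2); first exact: measurableI.
  by exists (B1 `&` B2); [exact: measurableI|rewrite setXI].
- by move=> _; exists setT => //; exists setT => //; rewrite setXTT.
- by apply/seteqP; split => // z _; exists 0%N.
- by move=> _ [A mA [B mB <-]]; exact: P12.
- by move=> _; apply: (le_lt_trans (probability_le1 _ _)) => //; exact: ltry.
Qed.

End rectangle_unique.

Lemma code_rectangle_unique d (T : measurableType d) (R : realType)
    (P1 P2 : probability (T * code)%type R) :
  (forall A w, measurable A -> P1 (A `*` cylinder w) = P2 (A `*` cylinder w)) ->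
  forall C, measurable C -> P1 C = P2 C.
Proof.
move=> P12; apply: rectangle_unique => A B mA mB.
have mAT : measurable (A `*` setT : set (T * code)) by exact: measurableX.
have mS : measurable_fun setT (snd : T * code -> code) by exact: measurable_snd.
pose m (P : probability (T * code)%type R) : {measure set code -> \bar R} :=
  pushforward (mrestr P mAT) (snd : T * code -> code).
have mE P X : m mS P X = P (A `*` X).
  rewrite /m /= /pushforward /mrestr; congr (P _).
  by apply/seteqP; split => -[t c] /=; tauto.
rewrite -!mE; apply: code_measure_unique => //.
  by rewrite mE (le_lt_trans (probability_le1 _ _)) ?ltry//; exact: measurableX.
by move=> w; rewrite !mE; exact: P12.
Qed.

Section density.
Context d (T : measurableType d) (R : realType).
Variables (nu : {finite_measure set T -> \bar R}) (m : probability T R).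
Hypothesis num : nu `<< m.

(** This version of the Radon-Nikodym derivative is finite and non-negative at every point, as word
    weights have to be. *)
Lemma density_exists : exists f : T -> R, [/\ measurable_fun setT f,
  forall t, 0 <= f t, m.-integrable setT (EFin \o f) &
  forall B, measurable B -> nu B = (\int[m]_(t in B) (f t)%:E)%E].
Proof.
pose g := Radon_Nikodym_SigmaFinite.f nu m.
have gE t : (fine (g t))%:E = g t.
  by rewrite fineK//; exact: Radon_Nikodym_SigmaFinite.f_fin_num.
have gE' : EFin \o (fine \o g) = g by apply/funext => t /=; rewrite gE.
exists (fine \o g); split.
- apply/measurable_EFinP; rewrite gE'.
  exact: measurable_int (Radon_Nikodym_SigmaFinite.f_integrable num).
- by move=> t; rewrite /= fine_ge0//; exact: Radon_Nikodym_SigmaFinite.f_ge0.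
- by rewrite gE'; exact: Radon_Nikodym_SigmaFinite.f_integrable.
- move=> B mB; under eq_integral do rewrite /= gE.
  exact: Radon_Nikodym_SigmaFinite.f_integral.
Qed.

End density.

Section disintegration.
Context d (T : measurableType d) (R : realType) (A : ptopologicalType).
Hypothesis hA : borel_space R A.
Local Notation U := (measurableTypeR R).
Variables (sigma : probability (T * borel A)%type R) (m : probability T R).
Hypothesis marg : forall B, measurable B -> m B = sigma (B `*` setT).

(** For each word [w], the measure [B |-> sigma (B * s^-1 (cylinder w))] has a density [p w] with
    respect to the marginal [m]. For almost all [t] these densities form consistent word weights,
    and decoding the resulting random code gives [alpha]. *)
Lemma disintegration : exists alpha : T * U -> borel A,
  measurable_fun setT alpha /\
  forall F : T * borel A -> \bar R, measurable_fun setT F ->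
    (forall z, 0 <= F z)%E ->
    (\int[sigma]_z F z = \int[m]_t \int[unif R]_u F (t, alpha (t, u)))%E.
Proof.
have [s [r [ms mr rs _]]] := borel_space_code hA.
have mX w : measurable (s @^-1` cylinder w) by exact: measurable_preimage_cylinder.
have mTX w : measurable (setT `*` (s @^-1` cylinder w) : set (T * borel A)).
  exact: measurableX.
have mfst : measurable_fun setT (fst : T * borel A -> T) by exact: measurable_fst.
pose nu0 w : {measure set T -> \bar R} := pushforward (mrestr sigma (mTX w)) (fst : T * borel A -> T).
have nu0E w B : nu0 mfst w B = sigma (B `*` (s @^-1` cylinder w)).
  rewrite /nu0 /= /pushforward /mrestr; congr (sigma _).
  by apply/seteqP; split => -[t c] /=; tauto.
have nu0fin w : fin_num_fun (nu0 mfst w).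
  move=> B mB; rewrite nu0E fin_num_measure//; exact: measurableX.
pose nu w : {finite_measure set T -> \bar R} :=
  HB.pack (Measure.sort (nu0 mfst w)) (Measure_isFinite.Build _ _ _ _ (nu0fin w)).
have nuE w B : nu w B = sigma (B `*` (s @^-1` cylinder w)) by exact: nu0E.
have num w : nu w `<< m.
  apply/null_content_dominatesP => B mB mB0.
  have B0 : sigma (B `*` setT) = 0%E by rewrite -marg.
  rewrite nuE; apply/eqP; rewrite eq_le measure_ge0 andbT -B0.
  by apply: le_measure; rewrite ?inE; [exact: measurableX|exact: measurableX|
    by move=> z [? _]; split].
have /choice[p pP] w := density_exists (num w).
pose pt t w := p w t.
have mpt w : measurable_fun setT (pt ^~ w) by case: (pP w).
have unq w (g : T -> R) : measurable_fun setT g ->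
    (forall B, measurable B -> nu w B = (\int[m]_(t in B) (g t)%:E)%E) ->
    {ae m, forall t, p w t = g t}.
  move=> mg gE; have [_ _ ip pE] := pP w.
  have : ae_eq m setT (EFin \o p w) (EFin \o g).
    apply: integral_ae_eq => //; first exact/measurable_EFinP.
    by move=> B _ mB; rewrite -gE// -pE.
  by apply: filterS => t /(_ I) [].
(* Each identity between densities holds off a null set, and there are only countably many words. *)
have cons : {ae m, forall t, consistent pt t}.
  have h1 : {ae m, forall t, p [::] t = 1}.
    apply: unq => // B mB; rewrite nuE cylinder_nil preimage_setT -marg//.
    by rewrite integral_cst// mul1e.
  have h2 : {ae m, forall t, forall w, p w t = p (rcons w false) t + p (rcons w true) t}.
    apply: ae_forall_count => w; apply: unq => [|B mB].
      by apply: measurable_funD; exact: mpt.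
    have [m0 p0 i0 E0] := pP (rcons w false); have [m1 p1 i1 E1] := pP (rcons w true).
    under eq_integral do rewrite EFinD.
    rewrite ge0_integralD; [|by []|by move=> t _; rewrite lee_fin| |
      by move=> t _; rewrite lee_fin|]; last 2 first.
    - exact/measurable_EFinP/measurable_funTS.
    - exact/measurable_EFinP/measurable_funTS.
    rewrite -E0// -E1// !nuE.
    rewrite -measureU; [|exact: measurableX|exact: measurableX|].
      congr (sigma _); apply/seteqP; split => -[t a] /=.
        move=> [Bt]; rewrite /cylinder/= !size_rcons !mkseqS => ->.
        by case: (s a (size w)); [right|left].
      by rewrite /cylinder/= !size_rcons !mkseqS => -[] [Bt /rcons_inj[]].
    apply/seteqP; split => // -[t a] /= [[_ +] [_ +]].
    by rewrite /cylinder/= !size_rcons !mkseqS => /rcons_inj[_ ->] /rcons_inj[].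
  apply: filterS2 h1 h2 => t ? ?; split => // w.
  by have [_ p0 _ _] := pP w; exact: p0.
have mcode := measurable_wcode mpt.
exists (r \o wcode pt); split; first exact: (measurableT_comp mr mcode).
move=> F mF F0.
have mis : measurable_fun setT (fun z : T * borel A => (z.1, s z.2) : T * code).
  apply/measurable_fun_pairP; split => /=; first exact: measurable_fst.
  exact: (measurableT_comp ms measurable_snd).
have miw : measurable_fun setT (fun z : T * U => (z.1, wcode pt z) : T * code).
  by apply/measurable_fun_pairP; split => //=; exact: measurable_fst.
(* Both laws of the pair of [t] and a code give a rectangle [B * cylinder w] the integral of [p w]
   over [B]. *)
have law : forall C, measurable C ->
    image_prob sigma mis C = image_prob (m \x unif R)%E miw C.
  apply: code_rectangle_unique => B w mB.
  apply: (etrans (image_probE _ _ _)); apply: (etrans _ (esym (image_probE _ _ _))).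
  have mBw : measurable (B `*` cylinder w : set (T * code)).
    by apply: measurableX => //; exact: measurable_cylinder.
  transitivity (nu w B).
    by rewrite nuE; congr (sigma _); apply/seteqP; split.
  have [_ _ _ ->//] := pP w.
  rewrite /product_measure1 [LHS]integral_mkcond; apply: ge0_ae_eq_integral => //.
  - apply/(measurable_restrictT _ mB); apply: measurable_funTS.
    exact/measurable_EFinP/mpt.
  - apply: measurable_fun_xsection.
    by rewrite -[X in measurable X]setTI; exact: miw.
  - move=> t _; rewrite patchE; case: ifP => // _; rewrite lee_fin.
    by case: (pP w).
  apply: filterS cons => t ct _ /=; rewrite patchE.
  have [Bt|Bt] := boolP (t \in B).
    rewrite -(unif_wcode mpt w ct); congr (unif R _).
    rewrite xsectionE; apply/seteqP; split => u /=; last by case.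
    by split => //; exact: set_mem.
  rewrite [X in unif R X](_ : _ = set0) ?measure0//.
  rewrite xsectionE; apply/seteqP; split => // u /= [/mem_set].
  by rewrite (negbTE Bt).
have mFr : measurable_fun setT (fun z : T * code => F (z.1, r z.2)).
  apply: (measurableT_comp mF); apply/measurable_fun_pairP; split => /=.
    exact: measurable_fst.
  exact: (measurableT_comp mr measurable_snd).
transitivity (\int[image_prob sigma mis]_z F (z.1, r z.2))%E.
  rewrite integral_image_prob//; apply: eq_integral => -[t a] _ /=.
  by rewrite rs.
transitivity (\int[image_prob (m \x unif R)%E miw]_z F (z.1, r z.2))%E.
  by apply: eq_measure_integral => B mB _; exact: law.
rewrite integral_image_prob// fubini_tonelli1//.
by apply: (measurableT_comp mFr miw).
Qed.

End disintegration.

(** * Almost everywhere convergence of convex combinations *)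

Section tail_weights.
Variable R : realType.
Implicit Types (n k : nat) (b x : nat -> R).

(** Convex weights on the indices from [k] to [n - 1]: a bound valid for all terms of index at least
    [k] passes to the combination. *)
Definition tail_weights k n b : Prop :=
  [/\ forall j, 0 <= b j, forall j, (j < k)%N -> b j = 0,
      forall j, (n <= j)%N -> b j = 0 & \sum_(j < n) b j = 1].

Definition comb n b x : R := \sum_(j < n) b j * x j.

Lemma sum_widen n n' b : (n <= n')%N -> (forall j, (n <= j)%N -> b j = 0) ->
  \sum_(j < n') b j = \sum_(j < n) b j.
Proof.
move=> nn' b0; rewrite -(big_mkord xpredT) -[RHS](big_mkord xpredT) /=.
rewrite (big_cat_nat _ nn')//= [X in _ + X]big_nat_cond [X in _ + X]big1 ?addr0//.
by move=> j /andP[/andP[/b0]].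
Qed.

Lemma tail_weights_le k k' n b : (k <= k')%N ->
  tail_weights k' n b -> tail_weights k n b.
Proof. by move=> kk' [b0 bk bn b1]; split => // j jk; apply/bk/(leq_trans jk). Qed.

Lemma tail_weights_dirac k : tail_weights k k.+1 (fun j => (j == k)%:R).
Proof.
split => [j|j jk|j jk|].
- by rewrite ler0n.
- by rewrite (ltn_eqF jk).
- by rewrite (gtn_eqF jk).
rewrite (bigD1 ord_max)//= eqxx big1 ?addr0// => i /eqP ik.
by case: eqP => // ik'; exfalso; apply/ik/val_inj.
Qed.

Lemma comb_le n b x x' k : tail_weights k n b ->
  (forall j, (k <= j)%N -> x j <= x' j) -> comb n b x <= comb n b x'.
Proof.
move=> [b0 bk _ _] xx'; apply: ler_sum => j _; have [jk|kj] := ltnP j k.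
  by rewrite bk// !mul0r.
by rewrite ler_wpM2l// xx'.
Qed.

Lemma comb_cst n b c k : tail_weights k n b -> comb n b (fun=> c) = c.
Proof. by move=> [_ _ _ b1]; rewrite /comb -mulr_suml b1 mul1r. Qed.

Lemma comb_widen n n' b x : (n <= n')%N -> (forall j, (n <= j)%N -> b j = 0) ->
  comb n' b x = comb n b x.
Proof. by move=> nn' b0; apply: (sum_widen (b := fun j => b j * x j)) => // j /b0 ->; rewrite mul0r. Qed.

Definition mid_weights b b' j := (b j + b' j) / 2.

Lemma tail_weights_mid k n n' b b' :
  tail_weights k n b -> tail_weights k n' b' ->
  tail_weights k (maxn n n') (mid_weights b b').
Proof.
move=> [b0 bk bn b1] [b0' bk' bn' b1']; split => [j|j jk|j|].
- by rewrite divr_ge0// addr_ge0.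
- by rewrite /mid_weights bk// bk'// addr0 mul0r.
- by rewrite geq_max => /andP[? ?]; rewrite /mid_weights bn// bn'// addr0 mul0r.
rewrite -mulr_suml big_split/= (sum_widen (leq_maxl n n') bn).
by rewrite (sum_widen (leq_maxr n n') bn') b1 b1' divff.
Qed.

Lemma comb_mid k n n' b b' x :
  tail_weights k n b -> tail_weights k n' b' ->
  comb (maxn n n') (mid_weights b b') x = (comb n b x + comb n' b' x) / 2.
Proof.
move=> [_ _ bn _] [_ _ bn' _].
rewrite -(comb_widen x (leq_maxl n n') bn) -(comb_widen x (leq_maxr n n') bn').
rewrite /comb -big_split/= mulr_suml; apply: eq_bigr => j _.
by rewrite /mid_weights; ring.
Qed.

End tail_weights.

Section convex_combinations.
Context d (Y : measurableType d) (R : realType) (mu : probability Y R).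
Variable h : nat -> Y -> R.
Hypotheses (mh : forall j, measurable_fun setT (h j))
  (h01 : forall j y, 0 <= h j y <= 1).

Let g (nb : nat * (nat -> R)) y := comb nb.1 nb.2 (h ^~ y).

Let mg nb : measurable_fun setT (g nb).
Proof. by apply: measurable_sum => j; apply: measurable_funM. Qed.

Let W k := [set nb : nat * (nat -> R) | tail_weights k nb.1 nb.2].

Let g01 k nb y : W k nb -> 0 <= g nb y <= 1.
Proof.
move=> Wnb; apply/andP; split.
  rewrite -(comb_cst 0 Wnb); apply: (comb_le Wnb) => j _.
  by have /andP[] := h01 j y.
rewrite -(comb_cst 1 Wnb); apply: (comb_le Wnb) => j _.
by have /andP[] := h01 j y.
Qed.

Let intb (f : Y -> R) : measurable_fun setT f -> (forall y, `|f y| <= 4) ->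
  mu.-integrable setT (EFin \o f).
Proof.
move=> mf f4; apply: measurable_bounded_integrable => //.
  by rewrite [X in (X < _)%E]probability_setT ltry.
exists 4; split => // M M4 y _ /=; apply: (le_trans (f4 y)); exact: ltW.
Qed.

Let intZ c (f : Y -> R) : mu.-integrable setT (EFin \o f) ->
  mu.-integrable setT (EFin \o (fun y => c * f y)).
Proof.
move=> /(integrableZl measurableT c); exact: eq_integrable.
Qed.

Let intD (f f' : Y -> R) : mu.-integrable setT (EFin \o f) ->
  mu.-integrable setT (EFin \o f') ->
  mu.-integrable setT (EFin \o (fun y => f y + f' y)).
Proof.
move=> /(integrableD measurableT)/[apply]; exact: eq_integrable.
Qed.

Let Q (f : Y -> R) : R := \int[mu]_y (f y) ^+ 2.

Let iQ (f : Y -> R) : measurable_fun setT f -> (forall y, `|f y| <= 1) ->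
  mu.-integrable setT (EFin \o (fun y => (f y) ^+ 2)).
Proof.
move=> mf f1; apply: intb; first exact: measurable_funX.
by move=> y; rewrite normrX; apply: (@le_trans _ _ 1); [exact: exprn_ile1|lra].
Qed.

Let g1 k nb y : W k nb -> `|g nb y| <= 1.
Proof. by move=> /(g01 y)/andP[? ?]; rewrite ger0_norm. Qed.

Let parallelogram k l nb nb' : W k nb -> W l nb' ->
  Q (fun y => g nb y - g nb' y) = 2 * Q (g nb) + 2 * Q (g nb') -
    4 * Q (fun y => (g nb y + g nb' y) / 2).
Proof.
move=> Wk Wl.
have i1 := iQ (mg nb) (fun y => g1 y Wk); have i2 := iQ (mg nb') (fun y => g1 y Wl).
have i3 : mu.-integrable setT
    (EFin \o (fun y => ((g nb y + g nb' y) / 2) ^+ 2)).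
  apply: iQ.
    by apply: measurable_funM => //; apply: measurable_funD.
  move=> y; have /andP[? ?] := g01 y Wk; have /andP[? ?] := g01 y Wl.
  by rewrite ler_norml; apply/andP; split; lra.
have i12 := intD (intZ 2 i1) (intZ 2 i2).
rewrite /Q -!RintegralZl// -RintegralD// -?RintegralB//; try exact: intZ.
by apply: eq_Rintegral => y _; field.
Qed.

(** Infimum of the squared L^2 norms of combinations of terms of index at least [k]; it is
    nondecreasing in [k] and at most 1. *)
Let inQ k := inf [set Q (g nb) | nb in W k].

Let Q_ge0 f : 0 <= Q f.
Proof. by apply: Rintegral_ge0 => y _; exact: sqr_ge0. Qed.

Let has_inf_Q k : has_inf [set Q (g nb) | nb in W k].
Proof.
split; last by exists 0 => _ [nb _ <-].
by eexists; exists (k.+1, fun j => (j == k)%:R) => //; exact: tail_weights_dirac.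
Qed.

Let inQ_le k nb : W k nb -> inQ k <= Q (g nb).
Proof. by move=> Wk; apply: ge_inf; [case: (has_inf_Q k)|exists nb]. Qed.

Let inQ_le1 k : inQ k <= 1.
Proof.
have Wk := tail_weights_dirac R k.
apply: (le_trans (inQ_le (nb := (_, _)) Wk)).
rewrite -[leRHS](_ : \int[mu]_y (cst 1 y) = 1); last first.
  by rewrite Rintegral_cst// [X in fine X]probability_setT mulr1.
apply: le_Rintegral => //.
- exact: iQ (mg _) (fun y => g1 (nb := (_, _)) y Wk).
- by apply: intb => // y; rewrite normr1; lra.
move=> y _; have /andP[g0 gle1] := g01 (nb := (_, _)) y Wk.
exact: exprn_ile1.
Qed.

(** Squared norms of order [4^-k] mean increments of norm of order [2^-k], which are summable. *)
Let e k : R := (1 / 4) ^+ k.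

(** Take near-minimizers at levels where [inQ] is within [e k] of its supremum [L]. Their midpoint
    is again a combination, so its squared norm exceeds [L - e k], and the parallelogram identity
    bounds the squared distance by [2 (L + e k) + 2 (L + e k) - 4 (L - e k)], which is [8 * e k]. *)
Let minimizing : exists nb : nat -> nat * (nat -> R),
  (forall k, W k (nb k)) /\
  forall k, Q (fun y => g (nb k) y - g (nb k.+1) y) <= 8 * e k.
Proof.
pose L := sup (range inQ).
have hL : has_sup (range inQ).
  by split; [exists (inQ 0); exists 0%N|exists 1 => _ [k _ <-]].
have inQ_nd k l : (k <= l)%N -> inQ k <= inQ l.
  move=> kl; apply: lb_le_inf; first by case: (has_inf_Q l).
  by move=> _ [nb Wl <-]; apply: inQ_le; exact: tail_weights_le kl Wl.
have e0 k : 0 < e k by rewrite exprn_gt0.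
have ex k : exists nb : nat * (nat * (nat -> R)), [/\ (k <= nb.1)%N, W nb.1 nb.2,
    L - e k < inQ nb.1 & Q (g nb.2) < L + e k].
  have [_ [K _ <-] LK] := sup_adherent (e0 k) hL.
  pose K' := maxn k K.
  have [_ [nb WK <-] QK] := inf_adherent (e0 k) (has_inf_Q K').
  exists (K', nb); split => //=; first exact: leq_maxl.
  - exact: (lt_le_trans LK (inQ_nd _ _ (leq_maxr _ _))).
  - apply: (lt_le_trans QK); rewrite lerD2r.
    by apply: sup_upper_bound => //; exists K'.
have [s sP] := choice ex.
exists (fun k => (s k).2); split.
  by move=> k; have [ks Ws _ _] := sP k; exact: tail_weights_le ks Ws.
move=> k; have [_ Wk Ik Qk] := sP k; have [_ Wl Il Ql] := sP k.+1.
have ekl : e k.+1 <= e k by rewrite /e exprS; have := e0 k; rewrite /e; lra.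
(* Both combinations, hence their midpoint, involve indices at least [m] only, and [inQ m] is one of
   the two infima known to exceed [L - e k]. *)
pose m := minn (s k).1 (s k.+1).1.
have Wk' : W m (s k).2 by exact: tail_weights_le (geq_minl _ _) Wk.
have Wl' : W m (s k.+1).2 by exact: tail_weights_le (geq_minr _ _) Wl.
have Im : L - e k < inQ m.
  by rewrite /m /minn; case: ifP => _ //; lra.
rewrite (parallelogram Wk' Wl').
have := inQ_le (nb := (_, _)) (tail_weights_mid Wk' Wl').
have -> : g (maxn (s k).2.1 (s k.+1).2.1, mid_weights (s k).2.2 (s k.+1).2.2) =
   (fun y => (g (s k).2 y + g (s k.+1).2 y) / 2).
  by apply/funext => y; exact: comb_mid Wk' Wl'.
lra.
Qed.

Lemma ae_convex_combinations : exists nb : nat -> nat * (nat -> R),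
  (forall k, tail_weights k (nb k).1 (nb k).2) /\
  {ae mu, forall y, cvgn (fun k => comb (nb k).1 (nb k).2 (h ^~ y))}.
Proof.
have [nb [Wnb Qnb]] := minimizing; exists nb; split => //.
pose D k y := g (nb k.+1) y - g (nb k) y.
have mD k : measurable_fun setT (D k) by apply: measurable_funB.
have D1 k y : `|D k y| <= 1.
  have /andP[? ?] := g01 y (Wnb k); have /andP[? ?] := g01 y (Wnb k.+1).
  by rewrite ler_norml /D; apply/andP; split; lra.
(* The constant is [8 / 2 + 1 / 2]: half of [2^k] times [8 * e k], plus half of [2^-k]. The bounds
   sum to 9. *)
have iD k : (\int[mu]_y (`|D k y|)%:E <= (9 / 2 * (1 / 2) ^+ k)%:E)%E.
  have i1 : mu.-integrable setT (EFin \o (fun y => (D k y) ^+ 2)) by exact: iQ.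
  have i2 : mu.-integrable setT (EFin \o (fun y => `|D k y|)).
    apply: intb; first exact: measurableT_comp.
    by move=> y; rewrite normr_id (le_trans (D1 _ _))//; lra.
  have i3 := intZ (2 ^+ k / 2) i1.
  have i4 : mu.-integrable setT (EFin \o (fun y : Y => (1 / 2) ^+ k / 2 : R)).
    by apply: finite_measure_integrable_cst.
  have -> : (\int[mu]_y (`|D k y|)%:E)%E = (\int[mu]_y `|D k y|)%:E.
    by rewrite /Rintegral fineK//; exact: integrable_fin_num.
  rewrite lee_fin.
  apply: (@le_trans _ _ (\int[mu]_y ((2 ^+ k / 2) * (D k y) ^+ 2 + (1 / 2) ^+ k / 2))).
    apply: le_Rintegral => //.
      exact: intD.
    move=> y _.
    (* AM-GM: 2 |D| <= 2^k D^2 + 2^-k *)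
    have : 0 <= 2 ^+ k * (`|D k y| - (1 / 2) ^+ k) ^+ 2.
      by apply: mulr_ge0; [exact: exprn_ge0|exact: sqr_ge0].
    have kk : 2 ^+ k * (1 / 2) ^+ k = 1 :> R by rewrite -exprMn mul1r divff// expr1n.
    rewrite -(real_normK (num_real (D k y))); move: kk.
    set a := `|D k y|; set p := 2 ^+ k; set q := (1 / 2) ^+ k => pq.
    have -> : p * (a - q) ^+ 2 = p * a ^+ 2 - 2 * a * (p * q) + q * (p * q) by ring.
    by rewrite pq; lra.
  rewrite RintegralD// RintegralZl// Rintegral_cst// [X in fine X]probability_setT/= mulr1.
  have := Qnb k; rewrite /Q.
  have -> : \int[mu]_y (g (nb k) y - g (nb k.+1) y) ^+ 2 = \int[mu]_y (D k y) ^+ 2.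
    by apply: eq_Rintegral => y _; rewrite /D; ring.
  have -> : e k = (1 / 2) ^+ k * (1 / 2) ^+ k.
    by rewrite /e -exprMn; congr (_ ^+ _); field.
  have kk : 2 ^+ k * (1 / 2) ^+ k = 1 :> R by rewrite -exprMn mul1r divff// expr1n.
  have q0 : 0 <= 2 ^+ k :> R by rewrite exprn_ge0.
  move=> H; have := ler_wpM2l q0 H; move: kk.
  set q := (1 / 2) ^+ k; set p := 2 ^+ k; set I := Rintegral _ _ _ => pq.
  have -> : p * (8 * (q * q)) = 8 * (p * q) * q by ring.
  rewrite pq; lra.
have fin_sum : (\int[mu]_y (\sum_(0 <= k <oo) (`|D k y|)%:E) < +oo)%E.
  have mDE k : measurable_fun setT (fun y => (`|D k y|)%:E).
    by apply/measurable_EFinP; exact: measurableT_comp.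
  rewrite integral_nneseries//.
  apply: (@le_lt_trans _ _ 9%:E); last exact: ltry.
  apply: lime_le.
    by apply: is_cvg_ereal_nneg_natsum => k _; apply: integral_ge0 => y _; rewrite lee_fin.
  apply: nearW => n.
  suff : (\sum_(0 <= k < n) \int[mu]_y (`|D k y|)%:E <= (9 - 9 * (1 / 2) ^+ n)%:E)%E.
    move=> /le_trans; apply; rewrite lee_fin.
    by have : 0 <= (1 / 2) ^+ n :> R; [rewrite exprn_ge0|lra].
  elim: n => [|n IH]; first by rewrite big_geq// lee_fin expr0; lra.
  rewrite big_nat_recr//=; apply: (le_trans (leeD IH (iD n))).
  by rewrite -EFinD lee_fin exprS; lra.
have ig : mu.-integrable setT (fun y => \sum_(0 <= k <oo) (`|D k y|)%:E)%E.
  apply/integrableP; split.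
    apply: ge0_emeasurable_sum => // k _.
    by apply/measurable_EFinP; exact: measurableT_comp.
  under eq_integral do rewrite gee0_abs ?nneseries_ge0//.
  exact: fin_sum.
have := integrable_ae measurableT ig; apply: filterS => y /(_ I) fy.
have : cvgn (series (fun k => D k y)).
  apply: normed_cvg.
  have nd : nondecreasing_seq [normed series (fun k => D k y)].
    apply/nondecreasing_seqP => n; rewrite /= /series/= big_nat_recr//=.
    by rewrite lerDl.
  apply: nondecreasing_is_cvgn => //.
  exists (fine (\sum_(0 <= k <oo) (`|D k y|)%:E)%E) => _ [n _ <-] /=.
  rewrite -lee_fin fineK// /series/= -sumEFin.
  by apply: nneseries_lim_ge => k _; rewrite lee_fin.
move=> cD; rewrite (_ : (fun k => _) = (fun k => g (nb 0%N) y + series (fun k => D k y) k)).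
  by apply: is_cvgD => //; exact: is_cvg_cst.
apply/funext => n; rewrite /series/= (telescope_sumr (fun k => g (nb k) y))//.
by rewrite addrC subrK.
Qed.

End convex_combinations.

(** One sequence of combinations has to serve all [i]. Instead of a diagonal extraction, the index
    becomes a second variable under a probability that charges every integer: a null set of the
    product has almost every section null, hence empty. *)
Lemma ae_convex_combinations_count d (T : measurableType d) (R : realType)
    (I : countType) (m : probability T R) (f : nat -> I -> T -> R) :
  (forall j i, measurable_fun setT (f j i)) ->
  (forall j i t, 0 <= f j i t <= 1) ->
  exists nb : nat -> nat * (nat -> R),
    (forall k, tail_weights k (nb k).1 (nb k).2) /\
    {ae m, forall t, forall i,
      cvgn (fun k => comb (nb k).1 (nb k).2 (fun j => f j i t))}.
Proof.
move=> mf f01.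
pose nu : probability nat R := poisson_prob (1 : R) 0.
have nu0 n : (0 < nu [set n])%E.
  rewrite /nu /= /poisson_prob ltr01 esum_set1.
    rewrite lte_fin /poisson_pmf ltr01 expr1n mul1r mulr_gt0 ?expR_gt0// invr_gt0 ltr0n fact_gt0.
  by rewrite lee_fin poisson_pmf_ge0.
pose h j (z : T * nat) : R := if unpickle z.2 is Some i then f j i z.1 else 0.
have mh j : measurable_fun setT (h j).
  move=> _ B mB; rewrite setTI.
  rewrite (_ : h j @^-1` B = \bigcup_n ([set t | B (h j (t, n))] `*` [set n])).
    apply: bigcupT_measurable => n; apply: measurableX => //.
    have mhn : measurable_fun setT (fun t => h j (t, n)).
      by rewrite /h /=; case: (unpickle n).
    by have := mhn measurableT B mB; rewrite setTI.
  apply/seteqP; split => [[t n] /= Bh|[t n] [k _ [/= + ->]]//].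
  by exists n.
have h01 j z : 0 <= h j z <= 1.
  by rewrite /h; case: (unpickle z.2) => [i|]; rewrite ?f01// lexx ler01.
have [nb [Wnb cnb]] := @ae_convex_combinations _ (T * nat)%type R (m \x nu)%E h mh h01.
exists nb; split => //.
case: cnb => X [mX X0 XP].
have : {ae m, forall t, nu (xsection X t) = 0%E}.
  have mXs : measurable_fun setT (nu \o xsection X) by exact: measurable_fun_xsection.
  have [+ _] := ae_eq_integral_abs m measurableT mXs.
  have -> : (\int[m]_t `|(nu \o xsection X) t|)%E = 0%E.
    rewrite -[RHS]X0 /product_measure1; apply: eq_integral => t _.
    by rewrite gee0_abs.
  by move=> /(_ erefl); apply: filterS => t /(_ Logic.I).
apply: filterS => t nuX i.
have hE : (fun j => f j i t) = h ^~ (t, pickle i).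
  by apply/funext => j; rewrite /h/= pickleK.
apply: contrapT; rewrite hE => ncv; have Xt : X (t, pickle i) by exact: XP.
have : (nu [set pickle i] <= nu (xsection X t))%E.
  have mn (B : set nat) : measurable B by [].
  apply: le_measure; [rewrite inE; exact: mn|rewrite inE; exact: mn|].
  by move=> _ ->; rewrite /xsection/= inE.
by rewrite nuX leNgt nu0.
Qed.

Lemma cvg_sumr (R : realType) (I : Type) (r : seq I) (f : nat -> I -> R) (l : I -> R) :
  (forall i, (fun k => f k i) @ \oo --> l i) ->
  (fun k => \sum_(i <- r) f k i) @ \oo --> \sum_(i <- r) l i.
Proof.
move=> fl; elim: r => [|i r IH].
  by under eq_fun do rewrite big_nil; rewrite big_nil; exact: cvg_cst.
by under eq_fun do rewrite big_cons; rewrite big_cons; exact: cvgD.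
Qed.

Lemma limn_einf_geP (R : realType) (l : R) (u : nat -> \bar R) :
  (l%:E <= limn_einf u)%E <->
  forall e : R, 0 < e -> exists K, forall k, (K <= k)%N -> ((l - e)%:E <= u k)%E.
Proof.
rewrite limn_einf_lim; split => [lu e e0|lu].
  have le : ((l - e)%:E < limn (einfs u))%E.
    by apply: lt_le_trans lu; rewrite lte_fin ltrBlDr ltrDl.
  have [K _ HK] := is_cvg_einfs (open_ereal_gt' le).
  exists K => k Kk; apply: (le_trans (ltW (HK K (leqnn K)))).
  by apply: ereal_inf_lbound; exists k.
apply/lee_subgt0Pr => e e0; have [K HK] := lu _ e0.
rewrite -EFinB; apply: lime_ge; first exact: is_cvg_einfs.
exists K => // k /= Kk; apply/le_ereal_inf_tmp => _ [j /= kj <-].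
exact/HK/(leq_trans Kk).
Qed.

Section code_liminf.
Context (R : realType) (X : Type).
Local Notation U := (measurableTypeR R).
Variables (X0 : set X) (b : X -> nat -> bool) (g : U -> code).
Variables (p : nat -> seq bool -> R) (q : seq bool -> R).
Variables (F : X -> \bar R) (G : code -> \bar R) (J : nat -> \bar R).
Hypothesis mg : measurable_fun setT g.
Hypothesis law_g : forall w, unif R (g @^-1` cylinder w) = (q w)%:E.
Hypothesis pq : forall w, (fun k => p k w) @ \oo --> q w.
Hypothesis F0 : forall x, (0 <= F x)%E.
Hypothesis mG : measurable_fun setT G.
Hypothesis G0 : forall c, (0 <= G c)%E.
Hypothesis lscF : forall c y, (y%:E < G c)%E ->
  exists L, forall x, X0 x -> mkseq (b x) L = mkseq c L -> (y%:E <= F x)%E.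
Hypothesis J_ge : forall k L (m : L.-tuple bool -> R), (forall w, 0 <= m w) ->
  (forall (w : L.-tuple bool) x, X0 x -> cylinder w (b x) -> ((m w)%:E <= F x)%E) ->
  ((\sum_w m w * p k w)%R%:E <= J k)%E.

(** The truncation at [L] keeps the value real, even when no point of [X0] has a code beginning with
    [w] and the infimum is [+oo]. *)
Let low L (w : L.-tuple bool) : R :=
  fine (mine L%:R%:E (ereal_inf [set F x | x in [set x | X0 x /\ cylinder w (b x)]])).

Let lowE L w : (low (L := L) w)%:E =
  mine L%:R%:E (ereal_inf [set F x | x in [set x | X0 x /\ cylinder w (b x)]]).
Proof.
rewrite /low fineK// ge0_fin_numE; last first.
  rewrite le_min lee_fin ler0n/=; apply/le_ereal_inf_tmp => _ [x _ <-].
  exact: F0.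
by rewrite gt_min ltry.
Qed.

Let low_ge0 L w : 0 <= low (L := L) w.
Proof.
rewrite -lee_fin lowE le_min lee_fin ler0n/=.
by apply/le_ereal_inf_tmp => _ [x _ <-]; exact: F0.
Qed.

Let lowc L c := low (prefix_tuple L c).

Let low_nd c : {homo (fun L => (lowc L c)%:E) : L L' / (L <= L')%N >-> (L <= L')%E}.
Proof.
move=> L L' LL'; rewrite /lowc !lowE le_min !ge_min lee_fin ler_nat LL'/=.
apply/orP; right; apply: ereal_inf_le_tmp => _ [x [Xx bx] <-]; exists x => //.
split=> //; apply/cylinder_tupleE; move/cylinder_tupleE : bx => bx.
apply: val_inj; have := congr1 (fun w => take L (val w)) bx.
by rewrite /= !mkseq_take.
Qed.

Let low_lim c : (G c <= limn (fun L => (lowc L c)%:E))%E.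
Proof.
have cvl : cvgn (fun L => (lowc L c)%:E).
  by apply: ereal_nondecreasing_is_cvgn; exact: low_nd.
rewrite leNgt; apply/negP => lG.
have [y ly yG] : exists2 y : R, (limn (fun L => (lowc L c)%:E) < y%:E)%E & (y%:E < G c)%E.
  have l0 : (0 <= limn (fun L => (lowc L c)%:E))%E.
    by apply: lime_ge => //; apply: nearW => L; rewrite lee_fin low_ge0.
  move: l0 lG (G0 c); move: (limn _) (G c) => [l| |] [r| |]//= l0 lG _.
    by rewrite lte_fin in lG; exists ((l + r) / 2); rewrite lte_fin; lra.
  by exists (l + 1); rewrite ?ltry// lte_fin; lra.
have [L HL] := lscF yG.
(* Long enough for [lscF] and larger than [|y|], so that the truncation in [low] does not fall below
   [y]. *)
pose L' := maxn L (Num.truncn `|y|).+1.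
suff yl : (y%:E <= (lowc L' c)%:E)%E.
  have : (y%:E <= limn (fun L => (lowc L c)%:E))%E.
    apply: (le_trans yl); apply: lime_ge => //.
    by exists L' => // n /= L'n; exact: low_nd.
  by rewrite leNgt ly.
rewrite /lowc lowE le_min lee_fin; apply/andP; split.
  apply: (le_trans (ler_norm y)); apply: ltW.
  apply: (lt_le_trans (truncnS_gt _)); by rewrite ler_nat leq_maxr.
apply/le_ereal_inf_tmp => _ [x [Xx /cylinder_tupleE bx] <-]; apply: HL => //.
have := congr1 (fun w => take L (val w)) bx.
by rewrite /= !mkseq_take// leq_maxl.
Qed.

(** A portmanteau inequality for codes. The prefix functions [low] increase with [L] to a limit that
    is at least [G]. For fixed [L] their integral is a finite sum of word weights, to which [pq] and
    [J_ge] apply; monotone convergence in [L] concludes. *)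
Lemma code_liminf : (\int[unif R]_u G (g u) <= limn_einf J)%E.
Proof.
have mlow L : measurable_fun setT (fun u => (lowc L (g u))%:E).
  by apply/measurable_EFinP; exact: (measurable_prefix mg).
apply: (@le_trans _ _ (\int[unif R]_u (limn (fun L => (lowc L (g u))%:E)))%E).
  apply: ge0_le_integral => //.
  - exact: (measurableT_comp mG mg).
  - apply: (emeasurable_fun_cvg _ _ mlow) => u _.
    by apply: ereal_nondecreasing_is_cvgn; exact: low_nd.
rewrite monotone_convergence//; last first.
  by move=> L u _; rewrite lee_fin; exact: low_ge0.
apply: lime_le.
  apply: ereal_nondecreasing_is_cvgn => L L' LL'.
  apply: ge0_le_integral => //; first by move=> u _; rewrite lee_fin; exact: low_ge0.
  by move=> u _; exact: low_nd.
apply: nearW => L; rewrite (integral_prefix _ mg)//.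
have -> : (\sum_w (low (L := L) w)%:E * unif R (g @^-1` cylinder w))%E =
    (\sum_w low (L := L) w * q w)%:E.
  by rewrite -sumEFin; apply: eq_bigr => w _; rewrite law_g EFinM.
have cv : (fun k => \sum_w low (L := L) w * p k w) @ \oo -->
    \sum_w low (L := L) w * q w.
  apply: cvg_sumr => w; apply: cvgM => //; exact: cvg_cst.
apply/limn_einf_geP => e e0.
have lt_e : \sum_w low (L := L) w * q w - e < \sum_w low (L := L) w * q w.
  by rewrite ltrBlDr ltrDl.
have [K _ HK] := cvgr_gt _ cv _ lt_e.
exists K => k Kk; apply: (@le_trans _ _ (\sum_w low (L := L) w * p k w)%:E).
  by rewrite lee_fin ltW//; exact: HK.
apply: J_ge => // w x Xx bx; rewrite lowE ge_min; apply/orP; right.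
by apply: ereal_inf_lbound; exists x.
Qed.

End code_liminf.

(** * Strategies and reference laws *)

Section iterated_product.

Fixpoint ipow_display (d : measure_display) (n : nat) : measure_display :=
  if n is n'.+1 then measure_prod_display (ipow_display d n', d) else d.

(** There are [n + 1] factors, as many as there are states in an element of [hist n], with the same
    nesting. *)
Fixpoint ipow d (T : measurableType d) (n : nat) :
    measurableType (ipow_display d n) :=
  match n return measurableType (ipow_display d n) with
  | 0 => T
  | n'.+1 => (ipow T n' * T)%type
  end.

Fixpoint ipow_prob d (T : measurableType d) (R : realType)
    (P : nat -> probability T R) (n : nat) : probability (ipow T n) R :=
  match n return probability (ipow T n) R with
  | 0 => P 0%N
  | n'.+1 => (ipow_prob P n' \x P n'.+1)%E
  end.

End iterated_product.

Section fubini.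
Context d1 d2 (T1 : measurableType d1) (T2 : measurableType d2) (R : realType).
Variables (m2 : probability T2 R).

Lemma measurable_partial_integral (F : T1 * T2 -> \bar R) :
  measurable_fun setT F -> (forall z, 0 <= F z)%E ->
  measurable_fun setT (fun x => \int[m2]_y F (x, y))%E.
Proof. by move=> mF F0; exact: measurable_fun_fubini_tonelli_F. Qed.

End fubini.

Section histories_of_randomizers.
Variables (R : realType) (E A : ptopologicalType).
Local Notation U := (measurableTypeR R).
Local Notation H := (hist E A).

Definition strategy := forall n, H n * U -> borel A.

Variables (alpha : strategy) (lam : nat -> probability (borel E) R).
Hypothesis malpha : forall n, measurable_fun setT (@alpha n).

(** Beware of the shift: the action of time [n'] is drawn from the coordinate of index [n'.+1] of
    the randomizers. *)
Fixpoint hist_of (n : nat) : ipow (borel E) n -> ipow U n -> H n :=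
  match n return ipow (borel E) n -> ipow U n -> H n with
  | 0 => fun x _ => x
  | n'.+1 => fun x u =>
      (hist_of x.1 u.1, alpha (hist_of x.1 u.1, u.2), x.2)
  end.

Lemma measurable_hist_of n : measurable_fun setT
  (fun z : ipow (borel E) n * ipow U n => hist_of z.1 z.2).
Proof.
elim: n => [|n IH] /=; first exact: measurable_fst.
have m1 : measurable_fun setT (fun z : ipow (borel E) n.+1 * ipow U n.+1 =>
    hist_of z.1.1 z.2.1).
  pose p (z : ipow (borel E) n.+1 * ipow U n.+1) := (z.1.1, z.2.1).
  have mp : measurable_fun setT p.
    apply/measurable_fun_pairP; split.
      exact: (measurableT_comp measurable_fst measurable_fst).
    exact: (measurableT_comp measurable_fst measurable_snd).
  exact: (measurableT_comp IH mp).
apply/measurable_fun_pairP; split; last first.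
  exact: (measurableT_comp measurable_snd measurable_fst).
apply/measurable_fun_pairP; split => //=.
apply: (measurableT_comp (@malpha n)).
apply/measurable_fun_pairP; split => //=.
exact: (measurableT_comp measurable_snd measurable_snd).
Qed.

Lemma measurable_step n : measurable_fun setT
  (fun z : H n * U * borel E => (z.1.1, alpha z.1, z.2) : H n.+1).
Proof.
apply/measurable_fun_pairP; split; last exact: measurable_snd.
apply/measurable_fun_pairP; split => /=.
  exact: (measurableT_comp measurable_fst measurable_fst).
exact: (measurableT_comp (@malpha n) measurable_fst).
Qed.

(* The law of the history under the dominating measures [lam], instead of the
   transition kernels of the decision process. *)
Fixpoint ref_law (n : nat) : probability (H n) R :=
  match n return probability (H n) R with
  | 0 => lam 0%N
  | n'.+1 => image_prob (ref_law n' \x unif R \x lam n'.+1)%E (@measurable_step n')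
  end.

Lemma integral_ref_lawS n (F : H n.+1 -> \bar R) : measurable_fun setT F ->
  (forall h, 0 <= F h)%E ->
  (\int[ref_law n.+1]_h F h =
   \int[ref_law n]_h \int[unif R]_u \int[lam n.+1]_x F (h, alpha (h, u), x))%E.
Proof.
move=> mF F0; rewrite integral_image_prob//.
have mFs := measurableT_comp mF (@measurable_step n).
rewrite (fubini_tonelli1 (fun z => F (z.1.1, alpha z.1, z.2)))//.
rewrite fubini_tonelli1//; last by move=> z; apply: integral_ge0.
exact: measurable_partial_integral.
Qed.

Local Notation Lam := (ipow_prob lam).
Local Notation Us := (ipow_prob (fun=> unif R)).

(** Under the reference law no state depends on an action, so Tonelli's theorem lets all states be
    integrated last. This is what allows the states to be frozen. *)
Lemma integral_ref_law n (F : H n -> \bar R) : measurable_fun setT F ->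
  (forall h, 0 <= F h)%E ->
  (\int[ref_law n]_h F h = \int[Lam n]_x \int[Us n]_u F (hist_of x u))%E.
Proof.
elim: n F => [|n IH] F mF F0.
  apply: eq_integral => x _ /=; rewrite integral_cst//.
  by rewrite [X in (_ * X)%E]probability_setT mule1.
have mFs := measurableT_comp mF (@measurable_step n).
have mF1 : measurable_fun setT (fun z : H n * U =>
    \int[lam n.+1]_x F (z.1, alpha z, x))%E.
  by apply: (measurable_partial_integral _
    (F := fun z : H n * U * borel E => F (z.1.1, alpha z.1, z.2))).
have mF1' : measurable_fun setT (fun z : H n * borel E =>
    \int[unif R]_u F (z.1, alpha (z.1, u), z.2))%E.
  apply: (measurable_partial_integral (T1 := (H n * borel E)%type) (T2 := U) _
    (F := fun z => F (z.1.1, alpha (z.1.1, z.2), z.1.2))) => //.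
  pose p (z : H n * borel E * U) : H n * U * borel E := (z.1.1, z.2, z.1.2).
  have mp : measurable_fun setT p.
    apply/measurable_fun_pairP; split; last first.
      exact: (measurableT_comp measurable_snd measurable_fst).
    apply/measurable_fun_pairP; split => /=; last exact: measurable_snd.
    exact: (measurableT_comp measurable_fst measurable_fst).
  exact: (measurableT_comp mFs mp).
have mF2 : measurable_fun setT (fun h : H n =>
    \int[unif R]_u \int[lam n.+1]_x F (h, alpha (h, u), x))%E.
  apply: (measurable_partial_integral _ (F := fun z : H n * U =>
    \int[lam n.+1]_x F (z.1, alpha z, x))%E) => // z; exact: integral_ge0.
rewrite integral_ref_lawS// IH//; last first.
  by move=> h; apply: integral_ge0 => u _; exact: integral_ge0.
rewrite /= fubini_tonelli1; last 2 first.
- apply: (measurable_partial_integral (T1 := ipow (borel E) n.+1) (T2 := ipow U n.+1)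
    _ (F := fun z => F (hist_of (n := n.+1) z.1 z.2))) => //.
  exact: (measurableT_comp mF (@measurable_hist_of n.+1)).
- by move=> z; exact: integral_ge0.
apply: eq_integral => x _; rewrite /fubini_F.
pose G (z : borel E * ipow U n) : \bar R :=
  (\int[unif R]_u' F (hist_of x z.2, alpha (hist_of x z.2, u'), z.1))%E.
have mhx : measurable_fun setT (fun u : ipow U n => hist_of x u).
  exact: (measurableT_comp (@measurable_hist_of n) (measurable_pair1 x)).
have mG : measurable_fun setT G.
  pose p (z : borel E * ipow U n) : H n * borel E := (hist_of x z.2, z.1).
  have mp : measurable_fun setT p.
    apply/measurable_fun_pairP; split => /=; last exact: measurable_fst.
    exact: (measurableT_comp mhx measurable_snd).
  exact: (measurableT_comp mF1' mp).
have G0 z : (0 <= G z)%E by exact: integral_ge0.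
(* The last state is moved out in two exchanges, first with the last randomizer, then with the
   earlier ones. *)
transitivity (\int[Us n]_u \int[lam n.+1]_x' G (x', u))%E.
  apply: eq_integral => u _; rewrite /G/=.
  apply: (fubini_tonelli (fun z : U * borel E =>
    F (hist_of x u, alpha (hist_of x u, z.1), z.2))) => //.
  pose p (z : U * borel E) : H n * U * borel E := (hist_of x u, z.1, z.2).
  have mp : measurable_fun setT p.
    apply/measurable_fun_pairP; split => /=; last exact: measurable_snd.
    apply/measurable_fun_pairP; split => /=; last exact: measurable_fst.
    exact: measurable_cst.
  exact: (measurableT_comp mFs mp).
rewrite -(fubini_tonelli G)//; apply: eq_integral => x' _.
rewrite fubini_tonelli1//.
apply: (measurableT_comp mF); apply/measurable_fun_pairP; split => /=; last first.
  exact: measurable_cst.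
apply/measurable_fun_pairP; split => /=.
  exact: (measurableT_comp mhx measurable_fst).
apply: (measurableT_comp (@malpha n)).
apply/measurable_fun_pairP; split => /=; last exact: measurable_snd.
exact: (measurableT_comp mhx measurable_fst).
Qed.

End histories_of_randomizers.

(** * Policies as laws of randomized strategies *)

Section strategies_and_policies.
Context (R : realType) (E A : ptopologicalType) (d : measure_display).
Context (Theta : measurableType d) (N : nat) (M : smdp R E A Theta N).
Hypothesis hA : borel_space R A.
Local Notation U := (measurableTypeR R).
Local Notation H n := (admissible (D M) n).

Definition admissible_strategy (alpha : strategy R E A) : Prop :=
  (forall n, measurable_fun setT (@alpha n)) /\
  forall n h u, D M n (last_state h, alpha n (h, u)).

Lemma measurable_feasible n (x : E) : measurable (feasible M n x : set (borel A)).
Proof.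
have mx : measurable_fun setT
    (fun a : borel A => (x, a) : borel E * borel A) by exact: measurable_pair1.
by have := mx measurableT _ (measurable_D M n); rewrite setTI.
Qed.

Lemma policy_of_strategy (alpha : strategy R E A) : admissible_strategy alpha ->
  exists p : policy M, forall n (h : hist E A n) B,
    (rule p h : probability (borel A) R) B = unif R [set u | B (alpha n (h, u))].
Proof.
move=> [malpha falpha].
have mh n (h : hist E A n) : measurable_fun setT (fun u : U => alpha n (h, u)).
  exact: (measurableT_comp (malpha n) (measurable_pair1 h)).
pose r n (h : hist E A n) : pprobability (borel A) R := image_prob (unif R) (mh n h).
have mr n : (n < N)%N -> measurable_fun (H n) (@r n).
  move=> _; apply: measurable_funTS.
  apply: (measurability (@pset _ _ _ : set (set (pprobability (borel A) R)))) => //.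
  move=> _ -[_ [y y01] [B mB <-]] <-; rewrite setTI.
  have mF : measurable_fun setT (fun z : hist E A n * U => (\1_B (alpha n z))%:E : \bar R).
    apply/measurable_EFinP; apply: (measurableT_comp (f := \1_B : borel A -> R)).
      exact: measurable_indic.
    exact: malpha.
  have mI : measurable_fun setT
      (fun h : hist E A n => \int[unif R]_u (\1_B (alpha n (h, u)))%:E)%E.
    by apply: (measurable_partial_integral (unif R) mF) => z; rewrite lee_fin.
  rewrite [X in measurable X](_ : _ = (fun h : hist E A n =>
    \int[unif R]_u (\1_B (alpha n (h, u)))%:E)%E @^-1` [set x | (x < y%:E)%E]).
    by rewrite -[X in measurable X]setTI; exact: emeasurable_fun_infty_o.
  apply/seteqP; suff e h : (r n h : probability (borel A) R) B =
      (\int[unif R]_u (\1_B (alpha n (h, u)))%:E)%E.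
    by split => h; [move=> Hh; rewrite /= -(e h)|rewrite /= -(e h)].
  rewrite (_ : (fun u => _) = (fun u : U => (\1_((fun u => alpha n (h, u)) @^-1` B) u)%:E))//.
  rewrite integral_indic ?setIT//.
  by rewrite -[X in measurable X]setTI; apply: (mh n h).
have fr n : (n < N)%N -> forall h : hist E A n, H n h ->
    (r n h : probability (borel A) R) (feasible M n (last_state h)) = 1%E.
  move=> _ h _; rewrite [LHS]image_probE [X in unif R X](_ : _ = setT).
    exact: probability_setT.
  by apply/seteqP; split => // u _; exact: falpha.
by exists (Policy mr fr).
Qed.

Lemma strategy_selection n : exists f : hist E A n -> borel A,
  measurable_fun setT f /\ forall h, D M n (last_state h, f h).
Proof.
have [f mf fD] := D_selector M n; exists (fun h => f (last_state h)); split => //.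
exact: (measurableT_comp mf (@measurable_last_state E A n)).
Qed.

(** Codes decode to feasible actions almost surely only; the measurable selectors of [D_selector]
    repair the exceptional cases. *)
Lemma feasible_modification (alpha : strategy R E A) :
  (forall n, measurable_fun setT (@alpha n)) ->
  exists beta : strategy R E A, admissible_strategy beta /\
    forall n h u, D M n (last_state h, alpha n (h, u)) ->
      beta n (h, u) = alpha n (h, u).
Proof.
move=> malpha.
pose f n := projT1 (cid (strategy_selection n)).
have mf n : measurable_fun setT (f n) by rewrite /f; case: cid => g [].
have fD n h : D M n (last_state h, f n h) by rewrite /f; case: cid => g [].
exists (fun n z => if z \in [set z | D M n (last_state z.1, alpha n z)]
  then alpha n z else f n z.1); split; last first.
  by move=> n h u Dh; rewrite mem_set.
split=> [n|n h u]; last first.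
  by case: ifPn => [/set_mem//|_]; exact: fD.
have mg : measurable_fun setT (fun z : hist E A n * U =>
    (last_state z.1, alpha n z) : borel E * borel A).
  apply/measurable_fun_pairP; split => //=.
  exact: (measurableT_comp (@measurable_last_state E A n) measurable_fst).
apply: measurable_fun_ifT; last 2 first.
- exact: malpha.
- exact: (measurableT_comp (mf n) measurable_fst).
apply: (measurable_fun_bool true); rewrite setTI preimage_mem_true.
by have := mg measurableT _ (measurable_D M n); rewrite setTI.
Qed.

(** The rule gives consistent weights to the words coding its action. Decoding [wcode] of these
    weights reproduces the rule, and the feasibility repair changes it with probability zero. *)
Lemma strategy_of_policy (p : policy M) : exists alpha : strategy R E A,
  admissible_strategy alpha /\
  forall n, (n < N)%N -> forall h : hist E A n, H n h ->
    forall B : set (borel A), measurable B ->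
    (rule p h : probability (borel A) R) B = unif R [set u | B (alpha n (h, u))].
Proof.
have [s [r [ms mr rs _]]] := borel_space_code hA.
have mX w : measurable (s @^-1` cylinder w) by exact: measurable_preimage_cylinder.
(* Off the admissible histories and from time [N] on nothing is known of the rule; the weight 0
   preserves measurability there. *)
pose w_ n (h : hist E A n) (w : seq bool) : R :=
  if (h \in H n) && (n < N)%N then
    fine ((rule p h : probability (borel A) R) (s @^-1` cylinder w))
  else 0.
have mw n w : measurable_fun setT (w_ n ^~ w).
  have [nN|nN] := ltnP n N; last first.
    rewrite (_ : w_ n ^~ w = cst 0)//; apply/funext => h; rewrite /w_.
    by rewrite [(n < N)%N]ltnNge nN andbF.
  rewrite (_ : w_ n ^~ w = (fun h => fine ((rule p h : probability (borel A) R)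
      (s @^-1` cylinder w))) \_ (H n)); last first.
    by apply/funext => h; rewrite /w_ nN andbT patchE.
  apply/(measurable_restrictT _ (measurable_admissible M n)).
  apply: (measurableT_comp (@fine_measurable R _ measurableT)).
  move=> mH Y mY.
  pose ev (P : pprobability (borel A) R) : \bar R :=
    (P : probability (borel A) R) (s @^-1` cylinder w).
  have mev : measurable_fun setT ev.
    have mid : measurable_fun setT (id : pprobability (borel A) R -> _) by [].
    exact: (measurable_kernel (kprobability mid) _ (mX w)).
  have := measurable_comp measurableT (subsetT _) mev (measurable_rule p nN).
  exact.
pose alpha0 : strategy R E A := fun n z => r (wcode (w_ n) z).
have malpha0 n : measurable_fun setT (@alpha0 n).
  exact: (measurableT_comp mr (measurable_wcode (mw n))).
have [alpha [aalpha alphaE]] := feasible_modification malpha0.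
exists alpha; split => // n nN h Hh B mB.
pose k : probability (borel A) R := rule p h.
have wE w : w_ n h w = fine (k (s @^-1` cylinder w)).
  by rewrite /w_ mem_set// nN.
have fk w : (fine (k (s @^-1` cylinder w)))%:E = k (s @^-1` cylinder w).
  by rewrite fineK// fin_num_measure.
have cons : consistent (w_ n) h.
  split=> [w||w]; rewrite ?wE.
  - by rewrite fine_ge0.
  - by rewrite cylinder_nil preimage_setT probability_setT.
  by apply: EFin_inj; rewrite EFinD !fk; exact: measure_cylinder_split.
have mcode : measurable_fun setT (fun u : U => wcode (w_ n) (h, u)).
  exact: (measurableT_comp (measurable_wcode (mw n)) (measurable_pair1 h)).
have law0 (C : set (borel A)) : measurable C -> k C = unif R [set u | C (alpha0 n (h, u))].
  move=> mC; have := @code_measure_unique _ (image_prob k ms) (image_prob (unif R) mcode).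
  move=> /(_ _ _ (r @^-1` C)) e.
  transitivity (image_prob k ms (r @^-1` C)).
    rewrite image_probE; congr (k _).
    by apply/seteqP; split => a /=; rewrite rs.
  rewrite e//.
  - by rewrite (le_lt_trans (probability_le1 _ _)) ?ltry.
  - move=> w; have := unif_wcode (mw n) w cons; rewrite wE fk => kw.
    exact/esym/kw.
  - by rewrite -[X in measurable X]setTI; exact: mr.
pose B' := B `&` feasible M n (last_state h).
have mf := measurable_feasible n (last_state h).
have k1 : k (feasible M n (last_state h)) = 1%E by exact: rule_feasible.
have k0 : k (~` feasible M n (last_state h)) = 0%E.
  by rewrite probability_setC// k1 subee.
have ma0 (C : set (borel A)) : measurable C -> measurable [set u | C (alpha0 n (h, u))].
  move=> mC; have m := measurableT_comp (malpha0 n) (measurable_pair1 h).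
  by have := m measurableT C mC; rewrite setTI.
have ma (C : set (borel A)) : measurable C -> measurable [set u | C (alpha n (h, u))].
  move=> mC; have m := measurableT_comp (aalpha.1 n) (measurable_pair1 h).
  by have := m measurableT C mC; rewrite setTI.
rewrite -/k law0//.
(* [alpha] and [alpha0] can differ on this event only; it is null because the rule gives mass 1 to
   the feasible actions. *)
pose Z := [set u | (~` feasible M n (last_state h)) (alpha0 n (h, u))].
have mZ : measurable Z by apply: ma0; exact: measurableC.
have Z0 : unif R Z = 0%E by rewrite -law0//; exact: measurableC.
have diff (X Y : set U) : measurable X -> measurable Y -> X `<=` Y `|` Z ->
    (unif R X <= unif R Y)%E.
  move=> mX' mY XY; apply: (@le_trans _ _ (unif R (Y `|` Z))).
    by apply: le_measure; rewrite ?inE//; exact: measurableU.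
  by apply: (le_trans (measureU2 _ mY mZ)); rewrite [X in (_ + X)%E]Z0 adde0.
apply/eqP; rewrite eq_le; apply/andP; split; apply: diff;
  [exact: ma0|exact: ma| |exact: ma|exact: ma0|] => u /= Bu;
  have [Dz|Dz] := pselect (D M n (last_state h, alpha0 n (h, u)));
  try (by right => /Dz); left.
  by rewrite alphaE.
by rewrite -alphaE.
Qed.

End strategies_and_policies.

Section probability_density.
Context d (T : measurableType d) (R : realType) (P m : probability T R).
Variable w : T -> R.
Hypotheses (mw : measurable_fun setT w) (w0 : forall x, 0 <= w x).
Hypothesis Pw : forall B, measurable B -> P B = (\int[m]_(x in B) (w x)%:E)%E.

Lemma density_dominates : P `<< m.
Proof.
apply/null_content_dominatesP => B mB mB0; rewrite Pw//.
apply: null_set_integral => //; exact/measurable_EFinP/measurable_funTS.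
Qed.

Lemma density_integrable : m.-integrable setT (EFin \o w).
Proof.
apply/integrableP; split; first exact/measurable_EFinP.
under eq_integral do rewrite /= ger0_norm//.
by rewrite -Pw// probability_setT ltry.
Qed.

Lemma density_Radon_Nikodym :
  ae_eq m setT ('d (charge_of_finite_measure P) '/d m) (EFin \o w).
Proof.
apply: ae_eq_sym; apply: integral_ae_eq => //; first exact: density_integrable.
  apply: measurable_int; apply: Radon_Nikodym_integrable.
  exact: density_dominates.
move=> B _ mB; rewrite -Radon_Nikodym_integral//; last exact: density_dominates.
exact/esym/Pw.
Qed.

Lemma density_integral (F : T -> \bar R) : measurable_fun setT F ->
  (forall x, 0 <= F x)%E -> (\int[P]_x F x = \int[m]_x (F x * (w x)%:E))%E.
Proof.
move=> mF F0; have Pm := density_dominates.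
rewrite -(Radon_Nikodym_SigmaFinite.change_of_variables Pm)//.
have mf : measurable_fun setT (Radon_Nikodym_SigmaFinite.f P m).
  exact: measurable_int (Radon_Nikodym_SigmaFinite.f_integrable Pm).
apply: ae_eq_integral => //.
- exact: emeasurable_funM.
- by apply: emeasurable_funM => //; exact/measurable_EFinP.
apply: ae_eqe_mul2l.
apply: (ae_eq_trans (ae_eq_Radon_Nikodym_SigmaFinite Pm measurableT)).
exact: density_Radon_Nikodym.
Qed.

End probability_density.

(** * Densities of the path laws with respect to the reference law *)

Section path_density.
Context (R : realType) (E A : ptopologicalType) (d : measure_display).
Context (Theta : measurableType d) (N : nat) (M : smdp R E A Theta N).
Local Notation U := (measurableTypeR R).
Local Notation H n := (admissible (D M) n).

(** Set to 0 off the admissible histories, where [q] is arbitrary; it thus becomes non-negative and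
    jointly measurable everywhere. *)
Definition step_density n (t : Theta) (h : hist E A n.+1) : R :=
  if h \in H n.+1 then q M n.+1 t (last_state h.1.1) h.1.2 h.2 else 0.

Fixpoint path_density n (t : Theta) : hist E A n -> R :=
  match n return hist E A n -> R with
  | 0 => q0 M t
  | n'.+1 => fun h => path_density t h.1.1 * step_density t h
  end.

Lemma step_density_ge0 n t (h : hist E A n.+1) : 0 <= step_density t h.
Proof. by rewrite /step_density; case: ifPn => // /set_mem[_ Du]; exact: q_ge0. Qed.

Lemma path_density_ge0 n t (h : hist E A n) : 0 <= path_density t h.
Proof.
elim: n h => [|n IH] h; first exact: q0_ge0.
by rewrite mulr_ge0// step_density_ge0.
Qed.

Lemma measurable_step_density n : measurable_fun setT
  (fun z : Theta * hist E A n.+1 => step_density z.1 z.2).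
Proof.
pose S := snd @^-1` H n.+1 : set (Theta * hist E A n.+1).
have mS : measurable S.
  rewrite -[S]setTI; apply: measurable_snd => //; exact: measurable_admissible.
rewrite (_ : (fun z => _) = (fun z : Theta * hist E A n.+1 =>
   q M n.+1 z.1 (last_state z.2.1.1) z.2.1.2 z.2.2) \_ S); last first.
  by apply/funext => z; rewrite patchE /step_density.
apply/(measurable_restrictT _ mS).
pose G (z : Theta * hist E A n.+1) : Theta * borel E * borel A * borel E :=
  (z.1, last_state z.2.1.1, z.2.1.2, z.2.2).
pose F := [set u : Theta * borel E * borel A * borel E | D M n (u.1.1.2, u.1.2)].
have mF : measurable F.
  have m12 : measurable_fun setT
      (fun u : Theta * borel E * borel A * borel E => (u.1.1.2, u.1.2)).
    apply/measurable_fun_pairP; split.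
      apply: (measurableT_comp measurable_snd).
      exact: (measurableT_comp measurable_fst measurable_fst).
    exact: (measurableT_comp measurable_snd measurable_fst).
  by have := m12 measurableT _ (measurable_D M n); rewrite setTI.
have m21 : measurable_fun setT (fun z : Theta * hist E A n.+1 => z.2.1).
  exact: (measurableT_comp measurable_fst measurable_snd).
have mG : measurable_fun setT G.
  apply/measurable_fun_pairP; split; last first.
    exact: (measurableT_comp measurable_snd measurable_snd).
  apply/measurable_fun_pairP; split => /=; last first.
    exact: (measurableT_comp measurable_snd m21).
  apply/measurable_fun_pairP; split => /=; first exact: measurable_fst.
  apply: (measurableT_comp (@measurable_last_state E A n)).
  exact: (measurableT_comp measurable_fst m21).
have sF : [set G u | u in S] `<=` F by move=> _ [u [_ Du] <-].
exact: (measurable_comp mF sF (@measurable_q _ _ _ _ _ _ M n) (measurable_funTS mG)).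
Qed.

Lemma measurable_path_density n : measurable_fun setT
  (fun z : Theta * hist E A n => path_density z.1 z.2).
Proof.
elim: n => [|n IH] /=; first exact: measurable_q0.
apply: measurable_funM; last exact: measurable_step_density.
pose p (z : Theta * hist E A n.+1) : Theta * hist E A n := (z.1, z.2.1.1).
have mp : measurable_fun setT p.
  apply/measurable_fun_pairP; split; first exact: measurable_fst.
  apply: (measurableT_comp measurable_fst).
  exact: (measurableT_comp measurable_fst measurable_snd).
exact: (measurableT_comp IH mp).
Qed.

Variables (p : policy M) (alpha : strategy R E A).
Arguments alpha : clear implicits.
Hypothesis salpha : admissible_strategy M alpha.
Hypothesis p_alpha : forall n, (n < N)%N -> forall h : hist E A n, H n h ->
  forall B : set (borel A), measurable B ->
  (rule p h : probability (borel A) R) B = unif R [set u | B (alpha n (h, u))].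

Local Notation ref n := (ref_law (lambda M) (salpha.1) n).

(** The parameter enters through the density only: one reference law, depending on the strategy
    alone, dominates the path laws of all parameters. In the induction the rule is replaced by the
    image of [unif R] under [alpha]. *)
Lemma law_density t n : (n <= N)%N -> forall B : set (hist E A n), measurable B ->
  law p t B = (\int[ref n]_(h in B) (path_density t h)%:E)%E.
Proof.
elim: n => [//|n IH] nN B mB.
have [P lawE _] := law_probability p t (ltnW nN).
have mdens k : measurable_fun setT (fun h : hist E A k => path_density t h).
  exact: (measurableT_comp (@measurable_path_density k) (measurable_pair1 t)).
have mstep : measurable_fun setT (fun h : hist E A n.+1 => step_density t h).
  exact: (measurableT_comp (@measurable_step_density n) (measurable_pair1 t)).
have PE C : measurable C -> P C = (\int[ref n]_(h in C) (path_density t h)%:E)%E.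
  by move=> mC; rewrite -IH ?(ltnW nN)// lawE.
pose f (h : hist E A n.+1) : \bar R := (step_density t h * \1_B h)%:E.
have mf : measurable_fun setT f.
  by apply/measurable_EFinP; apply: measurable_funM => //; exact: measurable_indic.
have f0 h : (0 <= f h)%E by rewrite lee_fin mulr_ge0// step_density_ge0.
pose I (z : hist E A n * borel A) : \bar R := (\int[lambda M n.+1]_x f (z, x))%E.
have mI : measurable_fun setT I by exact: measurable_partial_integral.
have I0 z : (0 <= I z)%E by exact: integral_ge0.
have f_out h : ~ H n.+1 h -> f h = 0%E.
  by move=> nH; rewrite /f /step_density memNset// mul0r.
have I_out h a : ~ (H n h /\ D M n (last_state h, a)) -> I (h, a) = 0%E.
  by move=> nH; apply: integral0_eq => x _; exact: f_out.
have mIa : measurable_fun setT (fun z : hist E A n * U => I (z.1, alpha n z)).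
  apply: (measurableT_comp mI); apply/measurable_fun_pairP; split => /=.
    exact: measurable_fst.
  exact: salpha.1.
pose G h : \bar R := (\int[unif R]_u I (h, alpha n (h, u)))%E.
have mG : measurable_fun setT G.
  by apply: (measurable_partial_integral (unif R) (F := fun z => I (z.1, alpha n z))).
have G0 h : (0 <= G h)%E by exact: integral_ge0.
transitivity (\int[P]_h G h)%E.
  rewrite /= /next_law lawE [LHS]integral_mkcond; apply: eq_integral => h _.
  rewrite patchE; case: ifPn => [/set_mem Hh|/negP nH]; last first.
    by rewrite /G integral0_eq// => u _; apply: I_out => -[/mem_set].
  have mah : measurable_fun setT (fun u : U => alpha n (h, u)).
    exact: (measurableT_comp (salpha.1 n) (measurable_pair1 h)).
  have mIh : measurable_fun setT (fun a : borel A => I (h, a)).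
    exact: (measurableT_comp mI (measurable_pair1 h)).
  transitivity (\int[rule p h : probability (borel A) R]_a I (h, a))%E.
    rewrite [LHS]integral_mkcond; apply: eq_integral => a _.
    rewrite patchE; case: ifPn => [/set_mem Da|/negP nD]; last first.
      by rewrite I_out// => -[_ /mem_set].
    rewrite /Q /I [LHS]integral_mkcond; apply: eq_integral => x _.
    rewrite patchE /f indicE /step_density [in RHS]ifT; last first.
      by apply/mem_set; exact: (conj Hh Da).
    case: ifPn => [/set_mem/= Bx|Bx]; first by rewrite mem_set// mulr1.
    by rewrite memNset ?mulr0// => Bx'; move/negP: Bx; apply; exact/mem_set.
  transitivity (\int[image_prob (unif R) mah]_a I (h, a))%E.
    by apply: eq_measure_integral => C mC _; exact: p_alpha.
  by rewrite integral_image_prob.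
rewrite (density_integral (mdens n) (@path_density_ge0 n t) PE)//.
rewrite [RHS]integral_mkcond.
have -> : ((fun h : hist E A n.+1 => (path_density t h)%:E) \_ B) =
    (fun h => (path_density t h.1.1)%:E * f h)%E.
  apply/funext => h; rewrite patchE /f -EFinM indicE.
  by case: ifPn => _; rewrite ?mulr1 ?mulr0.
rewrite integral_ref_lawS//; last 2 first.
- apply: emeasurable_funM => //; apply/measurable_EFinP.
  apply: (measurableT_comp (mdens n)).
  exact: (measurableT_comp measurable_fst measurable_fst).
- by move=> h; rewrite mule_ge0// lee_fin path_density_ge0.
apply: eq_integral => h _; rewrite muleC -ge0_integralZl//; last 2 first.
- exact: (measurableT_comp mIa (measurable_pair1 h)).
- by rewrite lee_fin path_density_ge0.
apply: eq_integral => u _; rewrite -ge0_integralZl//; last by rewrite lee_fin path_density_ge0.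
exact: (measurableT_comp mf (measurable_pair1 (h, alpha n (h, u)))).
Qed.

End path_density.

Section coordinates.
Variables (R : realType) (E A : ptopologicalType).

Lemma state_last n (h : hist E A n) : state n h = last_state h.
Proof. by case: n h => //= n h; rewrite eqxx. Qed.

Lemma measurable_state k n :
  measurable_fun setT (fun h : hist E A n => state k h : borel E).
Proof.
elim: n => [|n IH] /=; first exact: measurable_id.
case: (k == n.+1); first exact: measurable_snd.
apply: (measurableT_comp IH).
exact: (measurableT_comp measurable_fst measurable_fst).
Qed.

Lemma measurable_action k n :
  measurable_fun setT (fun h : hist E A n => action k h : borel A).
Proof.
elim: n => [|n IH] /=; first exact: measurable_cst.
case: (k == n); first exact: (measurableT_comp measurable_snd measurable_fst).
apply: (measurableT_comp IH).
exact: (measurableT_comp measurable_fst measurable_fst).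
Qed.

Lemma admissible_action (D : nat -> set (E * A)) k n (h : hist E A n) :
  admissible D n h -> (k < n)%N -> D k (state k h, action k h).
Proof.
elim: n h => //= n IH h [Hh Dh]; rewrite ltnS => kn.
rewrite (ltn_eqF (_ : k < n.+1)%N) ?ltnS//.
have [->|kn'] := eqVneq k n; first by rewrite state_last.
by apply: IH => //; rewrite ltn_neqAle kn'.
Qed.

End coordinates.

Section expected_cost.
Context (R : realType) (E A : ptopologicalType) (d : measure_display).
Context (Theta : measurableType d) (N : nat) (M : smdp R E A Theta N).
Local Notation U := (measurableTypeR R).
Local Notation H n := (admissible (D M) n).

Lemma cost_bound : exists K : R, [/\ 0 <= K,
  forall n t x a, (n < N)%N -> D M n (x, a) -> `|cost M n t x a| <= K &
  forall t x, `|final_cost M t x| <= K].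
Proof.
have [Kf Kf_bound] := bounded_final_cost M.
have ex n : exists K, (n < N)%N -> forall t x a, D M n (x, a) -> `|cost M n t x a| <= K.
  have [nN|nN] := ltnP n N; last by exists 0.
  by have [K KP] := bounded_cost M nN; exists K.
have [K KP] := choice ex.
have K0 : 0 <= \sum_(n < N) `|K n| by apply: sumr_ge0.
exists (`|Kf| + \sum_(n < N) `|K n|); split=> [|n t x a nN Dxa|t x].
- by rewrite addr_ge0.
- apply: (le_trans (KP n nN t x a Dxa)); apply: (le_trans (ler_norm _)).
  rewrite (bigD1 (Ordinal nN))//= addrCA lerDl addr_ge0//.
  exact: sumr_ge0.
- by apply: (le_trans (Kf_bound t x)); rewrite (le_trans (ler_norm _))// lerDl.
Qed.

Lemma measurable_total_cost : measurable_fun (snd @^-1` H N)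
  (fun z : Theta * hist E A N => total_cost M z.1 z.2).
Proof.
have mS : measurable (snd @^-1` H N : set (Theta * hist E A N)).
  rewrite -[X in measurable X]setTI; apply: measurable_snd => //.
  exact: measurable_admissible.
apply: measurable_funD; last first.
  pose G (z : Theta * hist E A N) : Theta * borel E := (z.1, state N z.2).
  have mG : measurable_fun setT G.
    apply/measurable_fun_pairP; split; first exact: measurable_fst.
    exact: (measurableT_comp (@measurable_state E A N N) measurable_snd).
  apply: measurable_funTS.
  exact: (measurableT_comp (measurable_final_cost M) mG).
apply: measurable_sum => n.
pose G (z : Theta * hist E A N) : Theta * borel E * borel A :=
  (z.1, state n z.2, action n z.2).
have mG : measurable_fun setT G.
  apply/measurable_fun_pairP; split; last first.
    exact: (measurableT_comp (@measurable_action E A n N) measurable_snd).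
  apply/measurable_fun_pairP; split; first exact: measurable_fst.
  exact: (measurableT_comp (@measurable_state E A n N) measurable_snd).
pose F := [set u : Theta * borel E * borel A | D M n (u.1.2, u.2)].
have mF : measurable F.
  have m12 : measurable_fun setT
      (fun u : Theta * borel E * borel A => (u.1.2, u.2)).
    apply/measurable_fun_pairP; split; last exact: measurable_snd.
    exact: (measurableT_comp measurable_snd measurable_fst).
  by have := m12 measurableT _ (measurable_D M n); rewrite setTI.
have sF : [set G z | z in snd @^-1` H N] `<=` F.
  by move=> _ [z /= Hz <-]; exact: admissible_action.
exact: (measurable_comp mF sF (@measurable_cost _ _ _ _ _ _ M n (ltn_ord n)) (measurable_funTS mG)).
Qed.

Variable K : R.
Hypothesis cost_K : forall n t x a, (n < N)%N -> D M n (x, a) ->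
  `|cost M n t x a| <= K.
Hypothesis final_K : forall t x, `|final_cost M t x| <= K.

(* Adding [shift] makes the total cost nonnegative, as Fatou's lemma requires. *)
Definition shift : R := K *+ N.+1.

(** The integrand of the shifted expected cost under the reference law; a product of non-negative
    factors, each lower semicontinuous in the actions. *)
Definition path_cost (t : Theta) (h : hist E A N) : R :=
  path_density M t h * (if h \in H N then total_cost M t h + shift else 0).

Lemma total_cost_bound t h : H N h -> `|total_cost M t h| <= shift.
Proof.
move=> Hh; apply: (le_trans (ler_normD _ _)).
rewrite /shift mulrSr lerD//; apply: (le_trans (ler_norm_sum _ _ _)).
rewrite -[leRHS](_ : \sum_(n < N) K = _); last by rewrite sumr_const card_ord.
by apply: ler_sum => n _; apply: cost_K => //; exact: admissible_action.
Qed.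

Lemma path_cost_ge0 t h : 0 <= path_cost t h.
Proof.
rewrite mulr_ge0 ?path_density_ge0//; case: ifPn => // /set_mem.
by move=> /(total_cost_bound t); rewrite ler_norml => /andP[]; lra.
Qed.

Lemma measurable_shifted_cost : measurable_fun setT
  (fun z : Theta * hist E A N => if z.2 \in H N then total_cost M z.1 z.2 + shift else 0).
Proof.
have mS : measurable (snd @^-1` H N : set (Theta * hist E A N)).
  rewrite -[X in measurable X]setTI; apply: measurable_snd => //.
  exact: measurable_admissible.
rewrite (_ : (fun z => _) = (fun z : Theta * hist E A N =>
    total_cost M z.1 z.2 + shift) \_ (snd @^-1` H N)).
  apply/(measurable_restrictT _ mS); apply: measurable_funD => //.
  exact: measurable_total_cost.
by apply/funext => z; rewrite patchE.
Qed.

Lemma measurable_path_cost :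
  measurable_fun setT (fun z : Theta * hist E A N => path_cost z.1 z.2).
Proof.
apply: measurable_funM; first exact: measurable_path_density.
exact: measurable_shifted_cost.
Qed.

Lemma path_law_admissible (p : policy M) t : path_law p t (H N) = 1%E.
Proof.
by have [P e PH] := law_probability p t (leqnn N); rewrite /path_law e.
Qed.

Lemma integrable_total_cost (p : policy M) t :
  (path_law p t).-integrable (H N) (EFin \o total_cost M t).
Proof.
have mH := measurable_admissible M N.
apply: measurable_bounded_integrable => //.
- by rewrite [X in (X < _)%E]path_law_admissible ltry.
- have : measurable_fun (H N) (fun h => total_cost M t h).
    apply: (measurable_comp (F := snd @^-1` H N) (f := fun z => total_cost M z.1 z.2)
      (g := fun h => (t, h))).
    + rewrite -[X in measurable X]setTI; apply: measurable_snd => //.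
    + by move=> _ [h Hh <-].
    + exact: measurable_total_cost.
    + by apply: measurable_funTS; exact: measurable_pair1.
  exact.
- exists shift; split; first exact: num_real.
  by move=> x sx h Hh; apply: (le_trans (total_cost_bound t Hh)); exact: ltW.
Qed.

Lemma expected_cost_bound (p : policy M) t : `|expected_cost p t| <= shift.
Proof.
have mH := measurable_admissible M N.
apply: (le_trans (le_normr_Rintegral mH (integrable_total_cost p t))).
rewrite -[leRHS](_ : \int[path_law p t]_(h in H N) shift = _); last first.
  by rewrite Rintegral_cst// [X in fine X]path_law_admissible mulr1.
apply: le_Rintegral => //.
- by have := integrable_abse (integrable_total_cost p t); apply: eq_integrable.
- exact: finite_measure_integrable_cst.
- by move=> h Hh; exact: total_cost_bound.
Qed.

Section formula.
Variables (p : policy M) (alpha : strategy R E A).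
Arguments alpha : clear implicits.
Hypothesis salpha : admissible_strategy M alpha.
Hypothesis p_alpha : forall n, (n < N)%N -> forall h : hist E A n, H n h ->
  forall B : set (borel A), measurable B ->
  (rule p h : probability (borel A) R) B = unif R [set u | B (alpha n (h, u))].

Lemma expected_costE t : (expected_cost p t + shift)%:E =
  (\int[ref_law (lambda M) (salpha.1) N]_h (path_cost t h)%:E)%E.
Proof.
have mH := measurable_admissible M N.
have mdens : measurable_fun setT (fun h : hist E A N => path_density M t h).
  exact: (measurableT_comp (@measurable_path_density _ _ _ _ _ _ M N) (measurable_pair1 t)).
pose f (h : hist E A N) : \bar R :=
  (if h \in H N then total_cost M t h + shift else 0)%:E.
have mf : measurable_fun setT f.
  by apply/measurable_EFinP; exact: (measurableT_comp measurable_shifted_cost (measurable_pair1 t)).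
have f0 h : (0 <= f h)%E.
  rewrite lee_fin; case: ifPn => // /set_mem.
  by move=> /(total_cost_bound t); rewrite ler_norml => /andP[]; lra.
transitivity (\int[path_law p t]_h f h)%E; last first.
  rewrite (density_integral (P := path_law p t) mdens (path_density_ge0 M t)
    (fun B => law_density salpha p_alpha t (leqnn N) (B := B)))//.
  by apply: eq_integral => h _; rewrite /path_cost EFinM muleC.
transitivity (\int[path_law p t]_(h in H N) ((total_cost M t h)%:E + shift%:E))%E.
  rewrite integralD//; last 2 first.
  - exact: integrable_total_cost.
  - exact: finite_measure_integrable_cst.
  rewrite integral_cst// [X in (_ * X)%E]path_law_admissible mule1 EFinD; congr (_ + _)%E.
  by rewrite /expected_cost /Rintegral fineK//; apply: integrable_fin_num => //;
    exact: integrable_total_cost.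
by rewrite integral_mkcond; apply: eq_integral => h _; rewrite patchE /f; case: ifPn.
Qed.

End formula.

Hypothesis hA : borel_space R A.

(** The path law varies with the parameter, but [expected_costE] turns the cost into a partial
    integral of a jointly measurable function under a fixed law. *)
Lemma measurable_expected_cost (p : policy M) :
  measurable_fun setT (expected_cost p).
Proof.
have [alpha [salpha p_alpha]] := strategy_of_policy hA p.
have mI : measurable_fun setT (fun t =>
    \int[ref_law (lambda M) (salpha.1) N]_h (path_cost t h)%:E)%E.
  apply: (measurable_partial_integral _ (F := fun z => (path_cost z.1 z.2)%:E)).
    by apply/measurable_EFinP; exact: measurable_path_cost.
  by move=> z; rewrite lee_fin path_cost_ge0.
have /measurable_EFinP : measurable_fun setT (EFin \o (fun t => expected_cost p t + shift)).
  by apply: (eq_measurable_fun _ _ mI) => t _ /=; rewrite (expected_costE salpha p_alpha).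
move=> /measurable_funB/(_ (measurable_cst shift)); apply: eq_measurable_fun => t _ /=.
by rewrite addrK.
Qed.

End expected_cost.

(** * Semicontinuity *)

Section lower_semicontinuity_along.
Context (T : Type) (R : realType) (F : set_system T) {FF : Filter F} (x0 : T).
Implicit Types f g : T -> R.

(** Stated for an arbitrary filter, since the histories that will approach [x0] keep its states and
    move in the actions only. *)
Definition lsc_along f := forall y, y < f x0 -> F [set x | y < f x].

Lemma lsc_along_eq f : F [set x | f x = f x0] -> lsc_along f.
Proof. by move=> fE y yf; apply: filterS fE => x /= ->. Qed.

Lemma lsc_alongD f g : lsc_along f -> lsc_along g -> lsc_along (fun x => f x + g x).
Proof.
move=> lf lg y yfg; pose e := (f x0 + g x0 - y) / 2.
have e0 : 0 < e by rewrite divr_gt0// subr_gt0.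
have f1 : f x0 - e < f x0 by lra.
have g1 : g x0 - e < g x0 by lra.
apply: filterS2 (lf _ f1) (lg _ g1) => x /= fx gx.
have : y = f x0 + g x0 - e - e by rewrite /e; field.
lra.
Qed.

Lemma lsc_along_sum (I : Type) (r : seq I) (f : I -> T -> R) :
  (forall i, lsc_along (f i)) -> lsc_along (fun x => \sum_(i <- r) f i x).
Proof.
move=> lf; elim: r => [|i r IH].
  by apply: lsc_along_eq; apply: filterS filterT => x _ /=; rewrite !big_nil.
move=> y; rewrite big_cons => yf.
have := lsc_alongD (lf i) IH (y := y) yf.
by apply: filterS => x /=; rewrite big_cons.
Qed.

Lemma lsc_alongM f g : F [set x | 0 <= f x /\ 0 <= g x] -> 0 <= f x0 -> 0 <= g x0 ->
  lsc_along f -> lsc_along g -> lsc_along (fun x => f x * g x).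
Proof.
move=> fg0 f0 g0 lf lg y yfg.
have [y0|y0] := ltP y 0.
  by apply: filterS fg0 => x [? ?] /=; rewrite (lt_le_trans y0)// mulr_ge0.
have fg : 0 < f x0 * g x0 by exact: le_lt_trans yfg.
have f1 : 0 < f x0.
  by rewrite lt_neqAle f0 andbT; apply: contraTneq fg => <-; rewrite mul0r ltxx.
have g1 : 0 < g x0.
  by rewrite lt_neqAle g0 andbT; apply: contraTneq fg => <-; rewrite mulr0 ltxx.
(* Midway between [y / g x0] and [f x0]; eventually [f] exceeds [a] and [g] exceeds [y / a]. *)
have [a [a0 af ya]] : exists a, [/\ 0 < a, a < f x0 & y < a * g x0].
  exists ((f x0 + y / g x0) / 2).
  have yg0 : 0 <= y / g x0 by rewrite divr_ge0.
  have ygf : y / g x0 < f x0 by rewrite ltr_pdivrMr.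
  split; [lra|lra|].
  rewrite mulrAC mulrDl divfK ?gt_eqF//; lra.
have yb : y / a < g x0 by rewrite ltr_pdivrMr// mulrC.
apply: filterS2 (lf _ af) (lg _ yb) => x /= ax.
rewrite ltr_pdivrMr// => yx; apply: (lt_le_trans yx); rewrite mulrC.
rewrite ler_wpM2r ?(ltW ax)//.
have : 0 < g x * a by exact: le_lt_trans yx.
by rewrite pmulr_lgt0// => /ltW.
Qed.

End lower_semicontinuity_along.

(** * Interleaved codes of the actions of a history *)

Section coded_histories.
Variables (R : realType) (E A : ptopologicalType).
Variables (s : borel A -> code) (r : code -> borel A).
Hypotheses (ms : measurable_fun setT s) (mr : measurable_fun setT r).

(** Bit [pair_nat i j] is bit [j] of the code of action [i]. It is false for [i >= n], so that the
    code of a shortened history is the truncation of the code of the history. *)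
Definition action_code n (h : hist E A n) : code :=
  fun m => ((unpair_nat m).1 < n)%N && s (action (unpair_nat m).1 h) (unpair_nat m).2.

Definition trunc n (c : code) : code := fun m => ((unpair_nat m).1 < n)%N && c m.

Definition decode_action (c : code) (i : nat) : borel A := r (fun j => c (pair_nat i j)).

Fixpoint coded_hist n : ipow (borel E) n -> code -> hist E A n :=
  match n return ipow (borel E) n -> code -> hist E A n with
  | 0 => fun x _ => x
  | n'.+1 => fun x c => (coded_hist x.1 c, decode_action c n', x.2)
  end.

Fixpoint states n : hist E A n -> ipow (borel E) n :=
  match n return hist E A n -> ipow (borel E) n with
  | 0 => fun h => h
  | n'.+1 => fun h => (states h.1.1, h.2)
  end.

Lemma measurable_bit m : measurable_fun setT (fun c : code => c m).
Proof.
apply: (measurable_fun_bool true); rewrite setTI.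
exact: (measurable_code_bit m).
Qed.

Lemma measurable_action_code n : measurable_fun setT (@action_code n).
Proof.
apply: measurable_code => m; apply: measurable_and; first exact: measurable_cst.
have msa := measurableT_comp ms (@measurable_action E A (unpair_nat m).1 n).
exact: (measurableT_comp (measurable_bit (unpair_nat m).2) msa).
Qed.

Lemma measurable_trunc n : measurable_fun setT (trunc n).
Proof.
apply: measurable_code => m; apply: measurable_and; first exact: measurable_cst.
exact: measurable_bit.
Qed.

Lemma measurable_decode_action i : measurable_fun setT (decode_action ^~ i).
Proof.
have m : measurable_fun setT (fun c : code => (fun j => c (pair_nat i j)) : code).
  by apply: measurable_code => j; exact: measurable_bit.
exact: (measurableT_comp mr m).
Qed.

Lemma measurable_coded_hist n : measurable_fun setT
  (fun z : ipow (borel E) n * code => coded_hist z.1 z.2).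
Proof.
elim: n => [|n IH]; first exact: measurable_fst.
apply/measurable_fun_pairP; split; last first.
  exact: (measurableT_comp measurable_snd measurable_fst).
apply/measurable_fun_pairP; split => /=; last first.
  exact: (measurableT_comp (measurable_decode_action n) measurable_snd).
pose p (z : ipow (borel E) n.+1 * code) : ipow (borel E) n * code := (z.1.1, z.2).
have mp : measurable_fun setT p.
  apply/measurable_fun_pairP; split => /=; last exact: measurable_snd.
  exact: (measurableT_comp measurable_fst measurable_fst).
exact: (measurableT_comp IH mp).
Qed.

Lemma decode_trunc n c i : (i < n)%N -> decode_action (trunc n c) i = decode_action c i.
Proof.
by move=> ni; congr r; apply/funext => j; rewrite /trunc pair_natK/= ni.
Qed.

Lemma coded_hist_trunc m n (x : ipow (borel E) n) c : (n <= m)%N ->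
  coded_hist x (trunc m c) = coded_hist x c.
Proof.
elim: n x => //= n IH x nm; rewrite IH ?(ltnW nm)//.
by rewrite decode_trunc.
Qed.

Lemma trunc_action_code n (h : hist E A n.+1) :
  trunc n (action_code h) = action_code h.1.1.
Proof.
apply/funext => m; rewrite /trunc /action_code /=.
have [mn|mn] := ltnP (unpair_nat m).1 n; last by [].
by rewrite ltnS ltnW//= ltn_eqF.
Qed.

Lemma states_coded_hist n (x : ipow (borel E) n) c : states (coded_hist x c) = x.
Proof. by elim: n x => //= n IH [x y] /=; rewrite IH. Qed.

Lemma states_hist_of (alpha : strategy R E A) n (x : ipow (borel E) n) u :
  states (hist_of alpha x u) = x.
Proof. by elim: n x u => //= n IH [x y] [u v] /=; rewrite IH. Qed.

Lemma action_coded_hist n (x : ipow (borel E) n) c i : (i < n)%N ->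
  action i (coded_hist x c) = decode_action c i.
Proof.
elim: n x => //= n IH x; rewrite ltnS leq_eqVlt => /predU1P[->|ni].
  by rewrite eqxx.
by rewrite ltn_eqF// IH.
Qed.

Lemma states_state n (h h' : hist E A n) : states h = states h' ->
  forall i, state i h = state i h'.
Proof.
elim: n h h' => [h h' hh' i|n IH h h' /= [hh' hh2] i]; first exact: hh'.
by case: (i == n.+1) => //; exact: IH.
Qed.

End coded_histories.

Section semicontinuity.
Context (R : realType) (E A : ptopologicalType) (d : measure_display).
Context (Theta : measurableType d) (N : nat) (M : smdp R E A Theta N).
Local Notation H n := (admissible (D M) n).
Hypothesis C2 : forall (n : nat) (x x' : E) (t : Theta), (n < N)%N ->
  lower_semicontinuous
    (fun a : subspace (feasible M n x) => (q M n.+1 t x a x')%:E).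
Hypothesis C3 : forall (n : nat) (x : E) (t : Theta), (n < N)%N ->
  lower_semicontinuous
    (fun a : subspace (feasible M n x) => (cost M n t x a)%:E).

(** States are eventually equal and not merely convergent, since the data are semicontinuous in the
    action for fixed states. *)
Definition hist_converges n (F : set_system (hist E A n)) (h0 : hist E A n) :=
  [/\ F (H n), H n h0, F [set h | states h = states h0] &
    forall i, (i < n)%N -> action i h @[h --> F] --> (action i h0 : A)].

Lemma lsc_along_subspace (T : Type) (F : set_system T) (FF : Filter F) (x0 : T)
    (K : set A) (f : A -> R) (a : T -> A) :
  lower_semicontinuous (fun a : subspace K => (f a)%:E) ->
  K (a x0) -> F [set x | K (a x)] -> a x @[x --> F] --> a x0 ->
  lsc_along F x0 (f \o a).
Proof.
move=> lf K0 FK Fa y yf.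
have [V nV Vf] := lf (a x0) y yf.
have wV : within K (nbhs (a x0)) V by rewrite (nbhs_subspace_in K0).
have {}nV : F [set x | K (a x) -> V (a x)] by exact: (Fa _ wV).
apply: filterS2 FK nV => x /= Kx /(_ Kx) Vx.
by have := Vf _ Vx; rewrite lte_fin.
Qed.

Lemma hist_convergesS n (F : set_system (hist E A n.+1)) (FF : Filter F) h0 :
  hist_converges F h0 -> hist_converges (h.1.1 @[h --> F]) h0.1.1.
Proof.
move=> [FH Hh0 Fs Fa].
have FH' : F [set h : hist E A n.+1 | H n h.1.1] by apply: filterS FH => h /= [].
have Fs' : F [set h : hist E A n.+1 | states h.1.1 = states h0.1.1].
  by apply: filterS Fs => h /= [].
split => //; first by case: Hh0.
move=> i ni; have := Fa i (ltnW ni); rewrite /= (ltn_eqF ni).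
by [].
Qed.

Lemma last_state_near n (F : set_system (hist E A n)) (FF : Filter F) h0 :
  hist_converges F h0 -> F [set h | last_state h = last_state h0].
Proof.
move=> [_ _ Fs _]; apply: filterS Fs => h /= /states_state/(_ n).
by rewrite !state_last.
Qed.

Lemma lsc_path_density t n (F : set_system (hist E A n)) (FF : Filter F) h0 :
  (n <= N)%N -> hist_converges F h0 -> lsc_along F h0 (path_density M t (n := n)).
Proof.
elim: n F FF h0 => [|n IH] F FF h0 nN Fh0.
  apply: lsc_along_eq; case: Fh0 => _ _ Fs _.
  by apply: filterS Fs => h /= ->.
have Fh := hist_convergesS FF Fh0.
apply: lsc_alongM.
- by apply: filterS filterT => h _; split;
    [exact: path_density_ge0|exact: step_density_ge0].
- exact: path_density_ge0.
- exact: step_density_ge0.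
- have := IH _ _ _ (ltnW nN) Fh; move=> l y yl.
  exact: l y yl.
have [FH Hh0 Fs Fa] := Fh0.
have Fl : F [set h : hist E A n.+1 | last_state h.1.1 = last_state h0.1.1].
  exact: (last_state_near _ Fh).
have FD : F [set h | feasible M n (last_state h0.1.1) h.1.2].
  by apply: filterS2 FH Fl => h /= [_ Dh] <-.
have Fan : h.1.2 @[h --> F] --> (h0.1.2 : A).
  by have := Fa n (leqnn _); rewrite /= eqxx.
have lq := lsc_along_subspace (a := fun h : hist E A n.+1 => h.1.2) FF
  (C2 (x := last_state h0.1.1) (x' := h0.2) (t := t) nN)
  (proj2 Hh0) FD Fan.
move=> y; rewrite {1}/step_density mem_set// => yq.
have := lq y yq; move=> {}lq.
have FE : F [set h | last_state h.1.1 = last_state h0.1.1 /\ h.2 = h0.2].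
  by apply: filterS2 Fl Fs => h /= -> [_ ->].
near=> h => /=; rewrite /step_density mem_set; last by near: h.
have [-> ->] : last_state h.1.1 = last_state h0.1.1 /\ h.2 = h0.2 by near: h.
by near: h.
Unshelve. all: by end_near.
Qed.

Variable K : R.
Hypothesis cost_K : forall n t x a, (n < N)%N -> D M n (x, a) ->
  `|cost M n t x a| <= K.
Hypothesis final_K : forall t x, `|final_cost M t x| <= K.

Lemma lsc_path_cost t (F : set_system (hist E A N)) (FF : Filter F) h0 :
  hist_converges F h0 -> lsc_along F h0 (path_cost M K t).
Proof.
move=> Fh0; have [FH Hh0 Fs Fa] := Fh0.
have cost0 h : H N h -> 0 <= total_cost M t h + shift N K.
  move=> /(total_cost_bound cost_K final_K t).
  by rewrite ler_norml => /andP[]; lra.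
apply: lsc_alongM.
- apply: filterS filterT => h _; split; first exact: path_density_ge0.
  by case: ifPn => // /set_mem; exact: cost0.
- exact: path_density_ge0.
- by rewrite mem_set//; exact: cost0.
- exact: lsc_path_density.
move=> y; rewrite {1}mem_set// => yc.
have FS i : F [set h | state i h = state i h0].
  by apply: filterS Fs => h /= /states_state.
have lc : lsc_along F h0 (fun h => total_cost M t h + shift N K).
  apply: lsc_alongD; last by apply: lsc_along_eq; apply: filterS filterT.
  apply: lsc_alongD; last first.
    by apply: lsc_along_eq; apply: filterS (FS N) => h /= ->.
  apply: lsc_along_sum => i y' yi.
  have FD : F [set h | feasible M i (state i h0) (action i h)].
    apply: filterS2 FH (FS i) => h Hh <-.
    exact: admissible_action.
  have lq := lsc_along_subspace (a := fun h : hist E A N => action i h) FF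
    (C3 (x := state i h0) (t := t) (ltn_ord i))
    (admissible_action Hh0 (ltn_ord i)) FD (Fa i (ltn_ord i)).
  have := lq y' yi; move=> {}lq.
  by apply: filterS2 lq (FS i) => h /= + ->.
have := lc y yc; move=> {}lc.
by apply: filterS2 FH lc => h /= Hh; rewrite mem_set.
Qed.

End semicontinuity.

(** * Limits of strategies *)

Section product_ae.
Context d1 d2 (T1 : measurableType d1) (T2 : measurableType d2) (R : realType).
Variables (m1 : probability T1 R) (m2 : probability T2 R).

(** If [Q] fails at [x], the whole fiber over [x] lies in the exceptional set, whereas almost every
    fiber is null. *)
Lemma ae_prod_fst (Q : T1 -> Prop) :
  {ae (m1 \x m2)%E, forall z, Q z.1} -> {ae m1, forall x, Q x}.
Proof.
case=> X [mX X0 XP].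
have mXs : measurable_fun setT (m2 \o xsection X) by exact: measurable_fun_xsection.
have [+ _] := ae_eq_integral_abs m1 measurableT mXs.
have -> : (\int[m1]_t `|(m2 \o xsection X) t|)%E = 0%E.
  rewrite -[RHS]X0 /product_measure1; apply: eq_integral => t _.
  by rewrite gee0_abs.
move=> /(_ erefl); apply: filterS => x /(_ Logic.I)/= x0.
apply: contrapT => nQ; have XE : xsection X x = setT.
  by rewrite xsectionE; apply/seteqP; split => // y _; exact: XP.
have /eqP : (1%:E : \bar R) = 0%:E.
  by rewrite -[RHS]x0 XE [RHS]probability_setT.
by rewrite eqe oner_eq0.
Qed.

Lemma ae_fst_prod (Q : T1 -> Prop) :
  {ae m1, forall x, Q x} -> {ae (m1 \x m2)%E, forall z, Q z.1}.
Proof.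
case=> X [mX X0 XP]; exists (X `*` setT); split; first exact: measurableX.
  by rewrite [LHS]product_measure1E// [X in (X * _)%E]X0 mul0e.
by move=> z nQ; split => //; exact: XP.
Qed.

End product_ae.

Section closure_of_codes.
Context (R : realType) (E A : ptopologicalType) (d : measure_display).
Context (Theta : measurableType d) (N : nat) (M : smdp R E A Theta N).
Local Notation H n := (admissible (D M) n).
Variables (s : borel A -> code) (r : code -> borel A).
Hypothesis closure_sr : forall (K : set A) (c : code), compact K ->
  (forall L, exists2 a, K a & mkseq (s a) L = mkseq c L) ->
  K (r c) /\ forall V, nbhs (r c : A) V ->
    exists L, forall a, K a -> mkseq (s a) L = mkseq c L -> V a.
Hypothesis C1 : forall (n : nat) (x : E), (n < N)%N -> compact (feasible M n x).

Lemma admissible_coded_hist n (z : ipow (borel E) n) (c : code) :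
  (forall i, (i < n)%N ->
     feasible M i (state i (coded_hist r z c)) (decode_action r c i)) ->
  H n (coded_hist r z c).
Proof.
elim: n z => //= n IH z Dz; split => /=.
  apply: IH => i ni; have := Dz i (ltnW ni).
  by rewrite (ltn_eqF (_ : i < n.+1)%N)// ltnW.
by have := Dz n (leqnn _); rewrite (ltn_eqF (leqnn n.+1)) state_last.
Qed.

Variables (n : nat) (z : ipow (borel E) n) (c : code).
Hypothesis nN : (n <= N)%N.

Definition fiber := [set h | H n h /\ states h = z].

(** Histories with states [z] whose action codes agree with [c] on longer and longer prefixes. *)
Definition code_filter : set_system (hist E A n) :=
  filter_from setT
    (fun L => [set h | fiber h /\ mkseq (action_code s h) L = mkseq c L]).

Lemma code_filter_filter : Filter code_filter.
Proof.
apply: filter_from_filter; first by exists 0%N.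
move=> L L' _ _; exists (maxn L L') => // h [fh /mkseq_eqP hL].
split; split=> //; apply/mkseq_eqP => m mL; apply: hL; rewrite leq_max mL//.
by rewrite orbT.
Qed.

Hypothesis cl : forall L, exists2 h : hist E A n, fiber h &
  mkseq (action_code s h) L = mkseq c L.

Lemma hist_converges_code_filter :
  hist_converges M code_filter (coded_hist r z c).
Proof.
have fc := code_filter_filter.
have stE h : fiber h -> forall i, state i h = state i (coded_hist r z c).
  by move=> [_ hz]; apply: states_state; rewrite states_coded_hist.
(* The first [L] bits of action [i] sit at finitely many positions of the interleaved code; a prefix
   beyond the largest of them determines these bits. *)
have words i L : (i < n)%N -> exists L', forall h, fiber h ->
    mkseq (action_code s h) L' = mkseq c L' ->
    mkseq (s (action i h)) L = mkseq (fun j => c (pair_nat i j)) L.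
  move=> ni; exists (\max_(j < L) pair_nat i j).+1 => h fh /mkseq_eqP hL.
  apply/mkseq_eqP => j jL.
  have := hL (pair_nat i j); rewrite ltnS (leq_bigmax (Ordinal jL)) => /(_ isT).
  by rewrite /action_code pair_natK/= ni.
have act i : (i < n)%N ->
    feasible M i (state i (coded_hist r z c)) (decode_action r c i) /\
    forall V, nbhs (decode_action r c i : A) V -> exists L, forall a,
      feasible M i (state i (coded_hist r z c)) a ->
      mkseq (s a) L = mkseq (fun j => c (pair_nat i j)) L -> V a.
  move=> ni; apply: closure_sr; first by apply: C1; exact: leq_trans ni nN.
  move=> L; have [L' HL'] := words i L ni; have [h fh hL'] := cl L'.
  exists (action i h); last exact: HL'.
  by rewrite /feasible/= -(stE _ fh); apply: admissible_action; case: fh.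
split.
- by exists 0%N => // h [[]].
- by apply: admissible_coded_hist => i ni; case: (act i ni).
- by exists 0%N => // h [[_ hz] _] /=; rewrite hz states_coded_hist.
move=> i ni V; rewrite action_coded_hist// => /((act i ni).2)[L HL].
have [L' HL'] := words i L ni.
exists L' => // h [fh hL'] /=; apply: HL; last exact: HL'.
by rewrite /feasible/= -(stE _ fh); apply: admissible_action; case: fh.
Qed.

End closure_of_codes.

Section truncated_prefixes.

(** Whether a truncated code begins with [w] depends on the first [size w] bits of the code, hence
    is a finite condition on prefixes. *)
Definition trunc_prefix n (w : seq bool) : set ((size w).-tuple bool) :=
  [set w' : (size w).-tuple bool | cylinder w (trunc n (nth false w'))].

Lemma trunc_prefixE n w (c : code) :
  cylinder w (trunc n c) <-> trunc_prefix n (prefix_tuple (size w) c).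
Proof.
have cE : mkseq (trunc n c) (size w) =
    mkseq (trunc n (nth false (prefix_tuple (size w) c))) (size w).
  by apply/mkseq_eqP => m mw; rewrite /trunc/= nth_mkseq.
by rewrite /trunc_prefix /cylinder/= cE.
Qed.

Lemma measure_trunc d (T : measurableType d) (R : realType)
    (mu : {measure set T -> \bar R}) (b : T -> code) n w :
  measurable_fun setT b ->
  mu [set y | cylinder w (trunc n (b y))] =
  (\sum_(w' : (size w).-tuple bool)
     (\1_(trunc_prefix n (w := w)) w')%:E * mu (b @^-1` cylinder w'))%E.
Proof.
move=> mb; rewrite -measure_prefix_set//; congr (mu _).
apply/seteqP; split => y; first exact: (trunc_prefixE n w (b y)).1.
exact: (trunc_prefixE n w (b y)).2.
Qed.

End truncated_prefixes.

Section limit_of_strategies.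
Context (R : realType) (E A : ptopologicalType) (d : measure_display).
Context (Theta : measurableType d) (N' : nat).
Local Notation N := N'.+1.
Context (M : smdp R E A Theta N).
Local Notation H n := (admissible (D M) n).
Local Notation U := (measurableTypeR R).
Local Notation Lam := (ipow_prob (lambda M)).
Local Notation Us := (ipow_prob (fun=> unif R)).
Variable s : borel A -> code.
Hypothesis ms : measurable_fun setT s.

Section one_strategy.
Variable alpha : strategy R E A.
Hypothesis salpha : admissible_strategy M alpha.

(* The actions of a history do not depend on its last state, for which [point]
   is used. *)
Definition strategy_code n (x : ipow (borel E) n) (u : ipow U n.+1) : code :=
  action_code s (hist_of alpha (n := n.+1) (x, point) u).

Lemma measurable_strategy_code n : measurable_fun setT
  (fun z : ipow (borel E) n * ipow U n.+1 => strategy_code z.1 z.2).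
Proof.
pose p (z : ipow (borel E) n * ipow U n.+1) : ipow (borel E) n.+1 * ipow U n.+1 :=
  ((z.1, point), z.2).
have mp : measurable_fun setT p.
  apply/measurable_fun_pairP; split => /=; last exact: measurable_snd.
  apply/measurable_fun_pairP; split => /=; first exact: measurable_fst.
  exact: measurable_cst.
have mh := measurableT_comp (@measurable_hist_of R E A alpha salpha.1 n.+1) mp.
exact: (measurableT_comp (measurable_action_code ms (n := n.+1)) mh).
Qed.

Lemma measurable_strategy_code1 n (x : ipow (borel E) n) :
  measurable_fun setT (fun u : ipow U n.+1 => strategy_code x u).
Proof.
exact: (measurableT_comp (@measurable_strategy_code n) (measurable_pair1 x)).
Qed.

Lemma strategy_code_trunc n (x : ipow (borel E) n) (x' : borel E) (u : ipow U n.+2) :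
  trunc n.+1 (strategy_code (n := n.+1) (x, x') u) = strategy_code x u.1.
Proof. by rewrite /strategy_code trunc_action_code. Qed.

(** The law of the actions [a_0, ..., a_n] given the states [x_0, ..., x_n], by its word weights. *)
Definition code_weight n (x : ipow (borel E) n) (w : seq bool) : R :=
  fine (Us n.+1 [set u | cylinder w (strategy_code x u)]).

Let mcyl n (x : ipow (borel E) n) w :
  measurable [set u : ipow U n.+1 | cylinder w (strategy_code x u)].
Proof.
by have := measurable_preimage_cylinder (@measurable_strategy_code1 n x) w.
Qed.

Lemma code_weightE n (x : ipow (borel E) n) w :
  (code_weight x w)%:E = Us n.+1 [set u | cylinder w (strategy_code x u)].
Proof. by rewrite /code_weight fineK//; apply: fin_num_measure; exact: mcyl. Qed.

Lemma measurable_code_weight n w :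
  measurable_fun setT (fun x : ipow (borel E) n => code_weight x w).
Proof.
apply/measurable_EFinP.
have mX := measurable_preimage_cylinder (@measurable_strategy_code n) w.
have mI : measurable_fun setT (fun z : ipow (borel E) n * ipow U n.+1 =>
    (\1_((fun z => strategy_code z.1 z.2) @^-1` cylinder w) z)%:E : \bar R).
  exact/measurable_EFinP/measurable_indic.
have mP : measurable_fun setT (fun x : ipow (borel E) n => \int[Us n.+1]_u
    (\1_((fun z => strategy_code z.1 z.2) @^-1` cylinder w) (x, u))%:E)%E.
  by apply: (measurable_partial_integral (Us n.+1) mI) => z; rewrite lee_fin.
apply: (eq_measurable_fun _ _ mP) => x _ /=; rewrite code_weightE.
by have := integral_indic (Us n.+1) measurableT (mcyl x w); rewrite setIT.
Qed.

Lemma code_weight01 n (x : ipow (borel E) n) w : 0 <= code_weight x w <= 1.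
Proof.
rewrite -!lee_fin code_weightE measure_ge0/=.
by apply: probability_le1; exact: mcyl.
Qed.

(** Causality: actions up to time [n] do not depend on the later state [x']. As a finite linear
    relation between weights it passes to combinations and limits. *)
Lemma code_weight_trunc n (x : ipow (borel E) n) x' w :
  code_weight x w = \sum_(w' : (size w).-tuple bool)
    \1_(trunc_prefix n.+1 (w := w)) w' * code_weight (n := n.+1) (x, x') w'.
Proof.
apply: EFin_inj; rewrite code_weightE -sumEFin.
under [in RHS]eq_bigr do rewrite EFinM code_weightE.
have := measure_trunc (Us n.+2) n.+1 w (@measurable_strategy_code1 n.+1 (x, x')).
move=> <-.
rewrite (_ : [set y | _] =
    [set u | cylinder w (strategy_code x u)] `*` (setT : set U)).
  rewrite [RHS]product_measure1E//; last exact: mcyl.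
  by rewrite [X in (_ * X)%E]probability_setT mule1.
by apply/seteqP; split => u /=; rewrite strategy_code_trunc => // -[].
Qed.

End one_strategy.

End limit_of_strategies.

Lemma convex_sum_le (R : realDomainType) n (b : nat -> R) e (p q : nat -> R)
    (P Q : nat -> \bar R) : (forall j, 0 <= b j) -> 0 <= e <= 1 ->
  (forall j, (p j)%:E <= P j)%E -> (forall j, (q j)%:E <= Q j)%E ->
  ((\sum_(j < n) b j * ((1 - e) * p j + e * q j))%R%:E <=
   \sum_(j < n) (b j)%:E * ((1 - e)%:E * P j + e%:E * Q j))%E.
Proof.
move=> b0 /andP[e0 e1] pP qQ; rewrite -sumEFin; apply: lee_sum => j _.
rewrite EFinM EFinD !EFinM; apply: lee_wpmul2l; first by rewrite lee_fin.
by apply: leeD; apply: lee_wpmul2l; rewrite ?lee_fin ?subr_ge0.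
Qed.

Lemma convex_sum (R : comRingType) (I : finType) (e : R) (i p q : I -> R) :
  (1 - e) * (\sum_w i w * p w) + e * (\sum_w i w * q w) =
  \sum_w i w * ((1 - e) * p w + e * q w).
Proof. by rewrite !mulr_sumr -big_split/=; apply: eq_bigr => w _; ring. Qed.

Lemma convexD (R : comRingType) (e p p' q q' : R) :
  (1 - e) * (p + p') + e * (q + q') = ((1 - e) * p + e * q) + ((1 - e) * p' + e * q').
Proof. by ring. Qed.

Lemma convex01 (R : realDomainType) (e p q : R) :
  0 <= e <= 1 -> 0 <= p <= 1 -> 0 <= q <= 1 -> 0 <= (1 - e) * p + e * q <= 1.
Proof. by nra. Qed.

Section limit_of_strategies.
Context (R : realType) (E A : ptopologicalType) (d : measure_display).
Context (Theta : measurableType d) (N' : nat).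
Local Notation N := N'.+1.
Context (M : smdp R E A Theta N).
Local Notation H n := (admissible (D M) n).
Local Notation U := (measurableTypeR R).
Local Notation Lam := (ipow_prob (lambda M)).
Local Notation Us := (ipow_prob (fun=> unif R)).
Variables (s : borel A -> code) (r : code -> borel A).
Hypotheses (ms : measurable_fun setT s) (mr : measurable_fun setT r).
Hypothesis closure_sr : forall (K : set A) (c : code), compact K ->
  (forall L, exists2 a, K a & mkseq (s a) L = mkseq c L) ->
  K (r c) /\ forall V, nbhs (r c : A) V ->
    exists L, forall a, K a -> mkseq (s a) L = mkseq c L -> V a.
Hypothesis C1 : forall (n : nat) (x : E), (n < N)%N -> compact (feasible M n x).

Lemma code_weight_nil (alpha : strategy R E A) (salpha : admissible_strategy M alpha)
  n (x : ipow (borel E) n) : code_weight s alpha x [::] = 1.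
Proof.
apply: EFin_inj; rewrite (code_weightE ms salpha) cylinder_nil.
exact: probability_setT.
Qed.

Lemma code_weight_split (alpha : strategy R E A) (salpha : admissible_strategy M alpha)
    n (x : ipow (borel E) n) w :
  code_weight s alpha x w =
  code_weight s alpha x (rcons w false) + code_weight s alpha x (rcons w true).
Proof.
have cE v := code_weightE ms salpha x v.
have m : measurable_fun setT (fun u : ipow U n.+1 => strategy_code s alpha x u).
  exact: (measurable_strategy_code1 ms salpha).
apply: EFin_inj; apply: (etrans (cE w)).
apply: (etrans (measure_cylinder_split (Us n.+1) w m)).
exact: (esym (congr2 (fun a b => a + b)%E (cE (rcons w false)) (cE (rcons w true)))).
Qed.

Lemma action_code_hist_of (alpha : strategy R E A) n (x : ipow (borel E) n)
    (x' : borel E) (u : ipow U n.+1) :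
  action_code s (hist_of alpha (n := n.+1) (x, x') u) = strategy_code s alpha x u.
Proof. by apply/funext => m; rewrite /action_code /=. Qed.

Lemma admissible_hist_of (alpha : strategy R E A) (salpha : admissible_strategy M alpha)
  n (x : ipow (borel E) n) (u : ipow U n) : H n (hist_of alpha x u).
Proof. by elim: n x u => //= n IH x u; split; [exact: IH|exact: salpha.2]. Qed.

(** A prefix function below [F] on the admissible histories with the given states has a smaller
    integral; it provides hypothesis [J_ge] of [code_liminf]. *)
Lemma code_weight_sum_le (alpha : strategy R E A) (salpha : admissible_strategy M alpha)
    n (x : ipow (borel E) n) (x' : borel E) L (m : L.-tuple bool -> R)
    (F : hist E A n.+1 -> \bar R) : measurable_fun setT F ->
  (forall h, 0 <= F h)%E -> (forall w, 0 <= m w) ->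
  (forall (w : L.-tuple bool) h, fiber M (n := n.+1) (x, x') h ->
     cylinder w (action_code s h) -> ((m w)%:E <= F h)%E) ->
  ((\sum_w m w * code_weight s alpha x w)%:E <=
   \int[Us n.+1]_u F (hist_of alpha (n := n.+1) (x, x') u))%E.
Proof.
move=> mF F0 m0 mF'.
have mc : measurable_fun setT (fun u : ipow U n.+1 => strategy_code s alpha x u).
  exact: (measurable_strategy_code1 ms salpha).
have cE v := code_weightE ms salpha x v.
apply: (@le_trans _ _ (\int[Us n.+1]_u (m (prefix_tuple L (strategy_code s alpha x u)))%:E)%E).
  rewrite (integral_prefix (Us n.+1) mc m0) -sumEFin.
  by apply: lee_sum => w _; rewrite EFinM cE.
apply: ge0_le_integral => //.
- by move=> u _; rewrite lee_fin.
- by apply/measurable_EFinP; exact: (measurable_prefix mc).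
- apply: (measurableT_comp mF).
  exact: (measurableT_comp (measurable_hist_of salpha.1 (n := n.+1)) (measurable_pair1 (x, x'))).
move=> u _; apply: mF'.
  split; first exact: admissible_hist_of.
  exact: (states_hist_of alpha (n := n.+1) (x, x') u).
by apply/cylinder_tupleE; rewrite action_code_hist_of.
Qed.

Variables (a1 a2 : nat -> strategy R E A) (eps : R).
Hypotheses (sa1 : forall l, admissible_strategy M (a1 l))
  (sa2 : forall l, admissible_strategy M (a2 l)).
Hypothesis eps01 : 0 <= eps <= 1.

(** What is mixed is the law of all actions given the states. Mixing the rules stage by stage would
    not mix the costs. *)
Definition mixed_weight l n (x : ipow (borel E) n) w : R :=
  (1 - eps) * code_weight s (a1 l) x w + eps * code_weight s (a2 l) x w.

Lemma mixed_weight01 l n (x : ipow (borel E) n) w : 0 <= mixed_weight l x w <= 1.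
Proof.
exact: (convex01 eps01 (code_weight01 ms (sa1 l) x w) (code_weight01 ms (sa2 l) x w)).
Qed.

Lemma measurable_mixed_weight l n w :
  measurable_fun setT (fun x : ipow (borel E) n => mixed_weight l x w).
Proof.
apply: measurable_funD; apply: measurable_funM => //.
  exact: (measurable_code_weight ms (sa1 l)).
exact: (measurable_code_weight ms (sa2 l)).
Qed.

Lemma mixed_weight_trunc l n (x : ipow (borel E) n) x' w :
  mixed_weight l x w = \sum_(w' : (size w).-tuple bool)
    \1_(trunc_prefix n.+1 (w := w)) w' * mixed_weight l (n := n.+1) (x, x') w'.
Proof.
rewrite /mixed_weight (code_weight_trunc ms (sa1 l) x x') (code_weight_trunc ms (sa2 l) x x').
exact: convex_sum.
Qed.

Variable nb : nat -> nat * (nat -> R).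
Hypothesis Wnb : forall k, tail_weights k (nb k).1 (nb k).2.

Definition combined_weight n k (x : ipow (borel E) n) w : R :=
  comb (nb k).1 (nb k).2 (fun l => mixed_weight l x w).

Lemma combined_weight_trunc n k (x : ipow (borel E) n) x' w :
  combined_weight k x w = \sum_(w' : (size w).-tuple bool)
    \1_(trunc_prefix n.+1 (w := w)) w' * combined_weight (n := n.+1) k (x, x') w'.
Proof.
rewrite /combined_weight /comb.
under eq_bigr do rewrite (mixed_weight_trunc _ _ x') mulr_sumr.
rewrite exchange_big/=; apply: eq_bigr => w' _; rewrite mulr_sumr.
by apply: eq_bigr => l _; rewrite mulrCA.
Qed.

Definition convergent n (x : ipow (borel E) n) :=
  forall w, cvgn (fun k => combined_weight k x w).

Hypothesis ae_convergent : {ae Lam N', forall x, convergent x}.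

(** By causality the weights of stage [n] are finite linear combinations of those of stage [n.+1],
    so convergence at the last stage is enough. *)
Lemma convergent_fst n (x : ipow (borel E) n) (x' : borel E) :
  convergent (n := n.+1) (x, x') -> convergent x.
Proof.
move=> c w; under eq_fun do rewrite (combined_weight_trunc _ _ x').
apply: cvgP; apply: cvg_sumr => w'; apply: cvgM; first exact: cvg_cst.
exact: c.
Qed.

Lemma ae_convergent_le n : (n <= N')%N -> {ae Lam n, forall x, convergent (n := n) x}.
Proof.
move=> nN; rewrite -(subKn nN); elim: (N' - n)%N (leq_subr n N') => [|j IH] jN.
  by rewrite subn0.
have := IH (ltnW jN).
have -> : (N' - j)%N = (N' - j.+1).+1 by rewrite subnS prednK// subn_gt0.
move=> h; apply: (@ae_prod_fst _ _ _ _ _ (Lam (N' - j.+1)%N) (lambda M (N' - j.+1).+1)).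
by apply: filterS h => -[x x'] /= /convergent_fst.
Qed.

(** The upper limit is measurable in [x] everywhere and agrees with the limit where that exists. *)
Definition limit_weight n (x : ipow (borel E) n) w : R :=
  fine (limn_esup (fun k => (combined_weight k x w)%:E)).

Lemma cvg_limit_weight n (x : ipow (borel E) n) w : convergent x ->
  (fun k => combined_weight k x w) @ \oo --> limit_weight x w.
Proof.
move=> /(_ w) /cvg_ex[/= l cl]; rewrite /limit_weight.
have /cvg_limn_einf_sup[_ ->//] : (fun k => (combined_weight k x w)%:E) @ \oo --> l%:E.
by apply: cvg_EFin => //; exact: nearW.
Qed.

Lemma measurable_limit_weight n w :
  measurable_fun setT (fun x : ipow (borel E) n => limit_weight x w).
Proof.
apply: (measurableT_comp (@fine_measurable R _ measurableT)).
apply: measurable_fun_limn_esup => k; apply/measurable_EFinP.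
apply: measurable_sum => l; apply: measurable_funM => //.
exact: measurable_mixed_weight.
Qed.

Lemma consistent_limit_weight n (x : ipow (borel E) n) : convergent x ->
  consistent (fun x w => limit_weight (n := n) x w) x.
Proof.
move=> cx; have cw w : (fun k => combined_weight k x w) @ \oo --> limit_weight x w.
  exact: cvg_limit_weight.
 split=> [w||w].
- have /cvg_lim <- // := cw w; apply: limr_ge; first exact: cx.
  apply: nearW => k; rewrite -(comb_cst 0 (Wnb k)); apply: (comb_le (Wnb k)) => l _.
  by have /andP[] := mixed_weight01 l x w.
- have /cvg_lim <- // := cw [::].
  rewrite (_ : (fun k => _) = cst 1) ?lim_cst//; apply/funext => k.
  rewrite -[RHS](comb_cst 1 (Wnb k)); apply: eq_bigr => l _; congr (_ * _).
  rewrite /mixed_weight (code_weight_nil (sa1 l)) (code_weight_nil (sa2 l)).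
  by rewrite !mulr1 subrK.
have c2 := cvgD (cw (rcons w false)) (cw (rcons w true)).
apply: (cvg_unique _ (cw w)) => //.
suff -> : (fun k => combined_weight k x w) =
    (fun k => combined_weight k x (rcons w false)) \+
    (fun k => combined_weight k x (rcons w true)) by exact: c2.
apply/funext => k; rewrite /= /combined_weight /comb -big_split/=.
apply: eq_bigr => l _; rewrite -mulrDr; congr (_ * _).
rewrite /mixed_weight (code_weight_split (sa1 l) x w) (code_weight_split (sa2 l) x w).
exact: convexD.
Qed.

(** From the states [x_0, ..., x_n], a random code of the actions [a_0, ..., a_n]: one action more
    than an element of [hist n] contains. *)
Definition limit_code n (z : ipow (borel E) n * U) : code :=
  wcode (fun x w => limit_weight (n := n) x w) z.

Lemma measurable_limit_code n : measurable_fun setT (@limit_code n).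
Proof. apply: measurable_wcode => w; exact: measurable_limit_weight. Qed.

Lemma measurable_limit_code1 n (x : ipow (borel E) n) :
  measurable_fun setT (fun u : U => limit_code (x, u)).
Proof. exact: (measurableT_comp (@measurable_limit_code n) (measurable_pair1 x)). Qed.

Lemma limit_code_law n (x : ipow (borel E) n) w : convergent x ->
  unif R [set u | cylinder w (limit_code (x, u))] = (limit_weight x w)%:E.
Proof.
move=> /consistent_limit_weight; apply: unif_wcode => v.
exact: measurable_limit_weight.
Qed.

(** Causality in the limit. The codes of two stages are unrelated as functions of [u]; only their
    laws agree. *)
Lemma limit_code_trunc_law n (x : ipow (borel E) n) (x' : borel E) (B : set code) :
  convergent (n := n.+1) (x, x') -> measurable B ->
  unif R [set u | B (trunc n.+1 (limit_code (n := n.+1) ((x, x'), u)))] =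
  unif R [set u | B (limit_code (x, u))].
Proof.
move=> cxx' mB; have cx := convergent_fst cxx'.
have mt : measurable_fun setT
    (fun u : U => trunc n.+1 (limit_code (n := n.+1) ((x, x'), u))).
  apply: (measurableT_comp (measurable_trunc n.+1)).
  exact: (@measurable_limit_code1 n.+1 (x, x')).
have := @code_measure_unique _ (image_prob (unif R) mt)
  (image_prob (unif R) (@measurable_limit_code1 n x)).
apply => //; first by rewrite (le_lt_trans (probability_le1 _ _)) ?ltry.
move=> w.
have lhs : image_prob (unif R) mt (cylinder w) =
    (\sum_(w' : (size w).-tuple bool) \1_(trunc_prefix n.+1 (w := w)) w' *
      limit_weight (n := n.+1) (x, x') w')%:E.
  rewrite [LHS](measure_trunc (unif R) n.+1 w (@measurable_limit_code1 n.+1 (x, x'))).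
  rewrite -sumEFin; apply: eq_bigr => w' _; rewrite EFinM; congr (_ * _)%E.
  exact: limit_code_law.
have rhs : image_prob (unif R) (@measurable_limit_code1 n x) (cylinder w) =
    (limit_weight x w)%:E by exact: limit_code_law.
apply: (etrans lhs); apply: (etrans _ (esym rhs)); congr EFin.
have c1 : (fun k => combined_weight k x w) @ \oo --> limit_weight x w.
  exact: cvg_limit_weight.
have c2 : (fun k => combined_weight k x w) @ \oo -->
    \sum_(w' : (size w).-tuple bool)
      \1_(trunc_prefix n.+1 (w := w)) w' * limit_weight (n := n.+1) (x, x') w'.
  under eq_fun do rewrite (combined_weight_trunc _ _ x').
  apply: cvg_sumr => w'; apply: cvgM; first exact: cvg_cst.
  exact: cvg_limit_weight.
exact: (cvg_unique _ c2 c1).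
Qed.

Definition mixed_integral k n (x : ipow (borel E) n) (F : hist E A n -> \bar R) : \bar R :=
  (\sum_(j < (nb k).1) ((nb k).2 j)%:E *
    ((1 - eps)%:E * \int[Us n]_u F (hist_of (a1 j) x u) +
     eps%:E * \int[Us n]_u F (hist_of (a2 j) x u)))%E.

Lemma limit_code_liminf n (x : ipow (borel E) n) (x' : borel E)
    (F : hist E A n.+1 -> \bar R) (G : code -> \bar R) : convergent x ->
  measurable_fun setT F -> (forall h, 0 <= F h)%E ->
  measurable_fun setT G -> (forall c, 0 <= G c)%E ->
  (forall c y, (y%:E < G c)%E -> exists L, forall h, fiber M (n := n.+1) (x, x') h ->
     mkseq (action_code s h) L = mkseq c L -> (y%:E <= F h)%E) ->
  (\int[unif R]_u G (limit_code (x, u)) <=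
   limn_einf (fun k => mixed_integral k (n := n.+1) (x, x') F))%E.
Proof.
move=> cx mF F0 mG G0 lscF.
apply: (@code_liminf R _ (fiber M (n := n.+1) (x, x')) (action_code s (n := n.+1))
  _ (fun k w => combined_weight k x w) (fun w => limit_weight x w) F) => //.
- exact: measurable_limit_code1.
- by move=> w; exact: limit_code_law.
- by move=> w; exact: cvg_limit_weight.
move=> k L m m0 mF'; have [b0 _ _ _] := Wnb k.
have -> : \sum_w m w * combined_weight k x w = \sum_(j < (nb k).1) (nb k).2 j *
    ((1 - eps) * (\sum_w m w * code_weight s (a1 j) x w) +
     eps * (\sum_w m w * code_weight s (a2 j) x w)).
  transitivity (\sum_w \sum_(j < (nb k).1) (nb k).2 j * (m w * mixed_weight j x w)).
    apply: eq_bigr => w _; rewrite /combined_weight /comb mulr_sumr.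
    by apply: eq_bigr => j _; exact: mulrCA.
  rewrite exchange_big; apply: eq_bigr => j _; rewrite -mulr_sumr; congr (_ * _).
  exact/esym/convex_sum.
have le1 (a : nat -> strategy R E A) (sa : forall l, admissible_strategy M (a l)) j :
    ((\sum_w m w * code_weight s (a j) x w)%:E <=
     \int[Us n.+1]_u F (hist_of (a j) (n := n.+1) (x, x') u))%E.
  exact: code_weight_sum_le.
exact: (convex_sum_le _ b0 eps01 (le1 _ sa1) (le1 _ sa2)).
Qed.

(** The liminf inequality is applied with [F = 0] and with [G] the indicator of the codes decoding
    to inadmissible histories; it bounds their probability by 0. Admissibility does not involve the
    last state, here [point]. *)
Lemma limit_code_feasible n (x : ipow (borel E) n) : (n <= N')%N -> convergent x ->
  {ae unif R, forall u,
    H n.+1 (coded_hist r (n := n.+1) (x, point) (limit_code (x, u)))}.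
Proof.
move=> nN cx; pose ch c := coded_hist r (n := n.+1) (x, point) c.
have mch : measurable_fun setT ch.
  have m := @measurable_coded_hist E A r mr n.+1.
  exact: (measurableT_comp m (measurable_pair1 (x, point))).
pose B := ~` (ch @^-1` H n.+1).
have mB : measurable B.
  apply: measurableC; rewrite -[X in measurable X]setTI; apply: mch => //.
  exact: measurable_admissible.
have mBg : measurable [set u | B (limit_code (x, u))].
  by have := measurable_limit_code1 x; move=> /(_ measurableT _ mB); rewrite setTI.
have mixed0 k : mixed_integral k (n := n.+1) (x, point) (cst 0%E) = 0%E.
  rewrite /mixed_integral big1// => j _; rewrite !integral0_eq//.
  by rewrite !mule0 adde0 mule0.
have le0 : (\int[unif R]_u (\1_B (limit_code (x, u)))%:E <= 0)%E.
  have := @limit_code_liminf n x point (cst 0%E) (fun c => (\1_B c)%:E) cx.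
  under [X in (_ <= limn_einf X)%E]eq_fun do rewrite mixed0.
  have /cvg_limn_einf_sup[-> _] : (fun _ : nat => 0%E : \bar R) @ \oo --> 0%E.
    exact: cvg_cst.
  apply => //; first by apply/measurable_EFinP; exact: measurable_indic.
  move=> c y; rewrite indicE; case: (boolP (c \in B)) => cB; last first.
    by rewrite lte_fin => y0; exists 0%N => h _ _; rewrite lee_fin ltW.
  (* A code approached by admissible histories decodes to an admissible one. Hence for a code in [B]
     some prefix excludes all of them, and the bound holds vacuously. *)
  move=> _; apply: contrapT => noL; move/set_mem: cB; apply.
  have cl L : exists2 h : hist E A n.+1, fiber M (n := n.+1) (x, point) h &
      mkseq (action_code s h) L = mkseq c L.
    apply: contrapT => noh; apply: noL; exists L => h fh hL.
    by case: noh; exists h.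
  by have [_ Hc _ _] := hist_converges_code_filter closure_sr C1 (nN : (n.+1 <= N)%N) cl.
exists [set u | B (limit_code (x, u))]; split; [exact: mBg| |by move=> u].
apply/eqP; rewrite eq_le measure_ge0 andbT.
by have := integral_indic (unif R) measurableT mBg; rewrite setIT => <-.
Qed.

End limit_of_strategies.

(** The inequality for the complement is the reverse inequality. *)
Lemma eq_probability_le d (T : measurableType d) (R : realType) (P Q : probability T R) :
  (forall B, measurable B -> (P B <= Q B)%E) -> forall B, measurable B -> P B = Q B.
Proof.
move=> PQ B mB; apply/eqP; rewrite eq_le PQ//=.
have := PQ _ (measurableC mB); rewrite !probability_setC//.
rewrite -(fineK (fin_num_measure P _ mB)) -(fineK (fin_num_measure Q _ mB)).
by rewrite !lee_fin lerBrDr => h; rewrite -subr_ge0 -(lerD2l 1); lra.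
Qed.

Lemma integral_ae0 d (T : measurableType d) (R : realType)
    (mu : {measure set T -> \bar R}) (f : T -> \bar R) :
  measurable_fun setT f -> {ae mu, forall x, f x = 0%E} -> (\int[mu]_x f x = 0)%E.
Proof.
move=> mf f0; rewrite (@ae_eq_integral _ _ _ mu setT (cst 0%E))//.
  by rewrite integral0_eq.
by apply: filterS f0 => x + _.
Qed.

(** * A strategy that follows the limit codes *)

Section realization.
Context (R : realType) (E A : ptopologicalType) (d : measure_display).
Context (Theta : measurableType d) (N' : nat).
Local Notation N := N'.+1.
Context (M : smdp R E A Theta N).
Local Notation H n := (admissible (D M) n).
Local Notation U := (measurableTypeR R).
Local Notation Lam := (ipow_prob (lambda M)).
Hypothesis hA : borel_space R A.
Variable r : code -> borel A.
Hypothesis mr : measurable_fun setT r.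
Variable g : forall n, ipow (borel E) n * U -> code.
Hypothesis mg : forall n, measurable_fun setT (@g n).
Hypothesis g_trunc : forall n, (n < N')%N -> {ae Lam n.+1,
  forall x : ipow (borel E) n.+1, forall B : set code, measurable B ->
    unif R [set u | B (trunc n.+1 (g (n := n.+1) (x, u)))] =
    unif R [set u | B (g (n := n) (x.1, u))]}.
Hypothesis g_feasible : forall n, (n <= N')%N -> {ae Lam n, forall x,
  {ae unif R, forall u, H n.+1 (coded_hist r (n := n.+1) (x, point) (g (x, u)))}}.

Let path n (z : ipow (borel E) n * U) : hist E A n := coded_hist r z.1 (g z).

Let mpath n : measurable_fun setT (@path n).
Proof.
have m := @measurable_coded_hist E A r mr n.
apply: (measurableT_comp m (g := fun z => (z.1, g z))).
by apply/measurable_fun_pairP; split => //=; exact: measurable_fst.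
Qed.

Let path_action n (z : ipow (borel E) n * U) : hist E A n * borel A :=
  (path z, decode_action r (g z) n).

Let mpath_action n : measurable_fun setT (@path_action n).
Proof.
apply/measurable_fun_pairP; split => /=; first exact: mpath.
exact: (measurableT_comp (measurable_decode_action mr n) (@mg n)).
Qed.

(** The law of the decoded history up to time [n]; [slaw n] adds the action of time [n].
    Disintegrating [slaw n] over its marginal [mlaw n] yields the rule of time [n]. *)
Let mlaw n : probability (hist E A n) R := image_prob (Lam n \x unif R)%E (@mpath n).
Let slaw n : probability (hist E A n * borel A)%type R :=
  image_prob (Lam n \x unif R)%E (@mpath_action n).

Let integral_mlaw n F : measurable_fun setT F -> (forall h, 0 <= F h)%E ->
  (\int[mlaw n]_h F h = \int[Lam n]_x \int[unif R]_u F (path (x, u)))%E.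
Proof.
move=> mF F0; rewrite integral_image_prob// (fubini_tonelli1 (fun z => F (path z)))//.
exact: (measurableT_comp mF (@mpath n)).
Qed.

Let integral_slaw n F : measurable_fun setT F -> (forall h, 0 <= F h)%E ->
  (\int[slaw n]_z F z = \int[Lam n]_x \int[unif R]_u F (path_action (x, u)))%E.
Proof.
move=> mF F0; rewrite integral_image_prob// (fubini_tonelli1 (fun z => F (path_action z)))//.
exact: (measurableT_comp mF (@mpath_action n)).
Qed.

Let Dset n : set (hist E A n * borel A) := [set z | D M n (last_state z.1, z.2)].

Let measurable_Dset n : measurable (@Dset n).
Proof.
have m : measurable_fun setT
    (fun z : hist E A n * borel A => (last_state z.1, z.2) : borel E * borel A).
  apply/measurable_fun_pairP; split => /=; last exact: measurable_snd.
  exact: (measurableT_comp (@measurable_last_state E A n) measurable_fst).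
by have := m measurableT _ (measurable_D M n); rewrite setTI.
Qed.

Let slaw_infeasible n : (n <= N')%N -> slaw n (~` @Dset n) = 0%E.
Proof.
move=> nN; have mC := measurableC (@measurable_Dset n).
have := integral_indic (slaw n) measurableT mC; rewrite setIT => <-.
have mC1 : measurable_fun setT (fun z => (\1_(~` @Dset n) z)%:E : \bar R).
  by apply/measurable_EFinP; exact: measurable_indic.
rewrite integral_slaw//.
have mI : measurable_fun setT (fun z => (\1_(~` @Dset n) (path_action z))%:E : \bar R).
  exact: (measurableT_comp mC1 (@mpath_action n)).
apply: integral_ae0.
  by apply: (measurable_partial_integral (unif R) mI) => z; rewrite lee_fin.
apply: filterS (g_feasible nN) => x gx; apply: integral_ae0.
  exact: (measurableT_comp mI (measurable_pair1 x)).
by apply: filterS gx => u [_ Du]; rewrite indicE memNset//= => /(_ Du).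
Qed.

Let strategy_of_slaw : exists beta : strategy R E A, admissible_strategy M beta /\
  forall n, (n <= N')%N -> forall F : hist E A n * borel A -> \bar R,
    measurable_fun setT F -> (forall z, 0 <= F z)%E ->
    (\int[slaw n]_z F z = \int[mlaw n]_h \int[unif R]_u F (h, beta n (h, u)))%E.
Proof.
have dis n : exists alpha : hist E A n * U -> borel A, measurable_fun setT alpha /\
    forall F : hist E A n * borel A -> \bar R, measurable_fun setT F ->
      (forall z, 0 <= F z)%E ->
      (\int[slaw n]_z F z = \int[mlaw n]_h \int[unif R]_u F (h, alpha (h, u)))%E.
  by apply: (disintegration hA) => B mB; congr ((Lam n \x unif R)%E _); apply/seteqP; split => z //= [].
pose alpha n := projT1 (cid (dis n)).
have alphaP n := projT2 (cid (dis n)).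
have [beta [sbeta betaE]] := feasible_modification M (fun n => (alphaP n).1).
exists beta; split => // n nN F mF F0.
pose ba (z : hist E A n * U) : hist E A n * borel A := (z.1, beta n z).
have mba : measurable_fun setT ba.
  by apply/measurable_fun_pairP; split => /=; [exact: measurable_fst|exact: sbeta.1].
pose blaw := image_prob (mlaw n \x unif R)%E mba.
have blawE G : measurable_fun setT G -> (forall z, 0 <= G z)%E ->
    (\int[blaw]_z G z = \int[mlaw n]_h \int[unif R]_u G (h, beta n (h, u)))%E.
  move=> mG G0; rewrite integral_image_prob// (fubini_tonelli1 (fun z => G (ba z)))//.
  exact: (measurableT_comp mG mba).
rewrite -blawE//; apply: eq_measure_integral => B mB _.
apply: eq_probability_le mB => {}B mB.
have mD := @measurable_Dset n.
have mBD : measurable (B `&` @Dset n) by exact: measurableI.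
(* Infeasible pairs are null for [slaw n], and [beta] keeps the feasible values of [alpha], so one
   probability is below the other; equality follows. *)
apply: (@le_trans _ _ (slaw n (B `&` @Dset n))).
  have B0 : slaw n (B `\` @Dset n) = 0%E.
    apply/eqP; rewrite eq_le measure_ge0 andbT -(slaw_infeasible nN).
    by apply: le_measure; rewrite ?inE; [exact: measurableD|exact: measurableC|move=> z []].
  by rewrite (measureDI (slaw n) mB mD) [X in (X + _)%E]B0 add0e.
have := integral_indic (slaw n) measurableT mBD; rewrite setIT => <-.
have := integral_indic blaw measurableT mB; rewrite setIT => <-.
have mI (C : set (hist E A n * borel A)) : measurable C ->
    measurable_fun setT (fun z => (\1_C z)%:E : \bar R).
  by move=> mC; apply/measurable_EFinP; exact: measurable_indic.
have I0 (C : set (hist E A n * borel A)) z : (0 <= (\1_C z)%:E :> \bar R)%E.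
  by rewrite lee_fin.
rewrite ((alphaP n).2 _ (mI _ mBD) (I0 _)) (blawE _ (mI _ mB) (I0 _)).
pose aa (z : hist E A n * U) : hist E A n * borel A := (z.1, alpha n z).
have maa : measurable_fun setT aa.
  by apply/measurable_fun_pairP; split => /=; [exact: measurable_fst|exact: (alphaP n).1].
have mIa := measurableT_comp (mI _ mBD) maa.
have mIb := measurableT_comp (mI _ mB) mba.
apply: ge0_le_integral => //.
- by move=> h _; apply: integral_ge0 => u _; exact: I0.
- apply: (measurable_partial_integral (unif R) mIa) => z; exact: I0.
- apply: (measurable_partial_integral (unif R) mIb) => z; exact: I0.
move=> h _; apply: ge0_le_integral => //.
- exact: (measurableT_comp mIa (measurable_pair1 h)).
- exact: (measurableT_comp mIb (measurable_pair1 h)).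
move=> u _; rewrite !indicE lee_fin ler_nat.
have [/set_mem[Ba Da]|//] := boolP ((h, alpha n (h, u)) \in B `&` @Dset n).
by rewrite betaE// mem_set.
Qed.

(* Consistency of the codes under truncation makes the histories built from
   [beta] follow the limit codes. *)
Lemma realization : exists beta : strategy R E A, exists sbeta : admissible_strategy M beta,
  forall F : hist E A N -> \bar R, measurable_fun setT F -> (forall h, 0 <= F h)%E ->
    (\int[ref_law (lambda M) sbeta.1 N]_h F h = \int[Lam N']_x \int[lambda M N]_x'
       \int[unif R]_u F (coded_hist r (n := N) (x, x') (g (x, u))))%E.
Proof.
have [beta [sbeta betaE]] := strategy_of_slaw; exists beta, sbeta.
(* If [beta] reproduces the law of the histories up to time [n], then by disintegration it also
   reproduces the next action, still drawn from the single code [g n]. *)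
have step n (F : hist E A n.+1 -> \bar R) : (n <= N')%N ->
    (forall F : hist E A n -> \bar R, measurable_fun setT F -> (forall h, 0 <= F h)%E ->
      (\int[ref_law (lambda M) sbeta.1 n]_h F h = \int[mlaw n]_h F h)%E) ->
    measurable_fun setT F -> (forall h, 0 <= F h)%E ->
    (\int[ref_law (lambda M) sbeta.1 n.+1]_h F h = \int[Lam n]_x \int[lambda M n.+1]_x'
       \int[unif R]_u F (coded_hist r (n := n.+1) (x, x') (g (n := n) (x, u))))%E.
  move=> nN IH mF F0; rewrite integral_ref_lawS//.
  pose F1 (z : hist E A n * borel A) : \bar R := (\int[lambda M n.+1]_x' F (z, x'))%E.
  have mF1 : measurable_fun setT F1 by exact: measurable_partial_integral.
  have F10 z : (0 <= F1 z)%E by apply: integral_ge0.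
  have mb : measurable_fun setT (fun z : hist E A n * U => (z.1, beta n z) : hist E A n * borel A).
    by apply/measurable_fun_pairP; split => /=; [exact: measurable_fst|exact: sbeta.1].
  have mF1b := measurableT_comp mF1 mb.
  rewrite IH; last 2 first.
  - by apply: (measurable_partial_integral (unif R) mF1b) => z; exact: F10.
  - by move=> h; apply: integral_ge0 => u _; exact: F10.
  rewrite -(betaE n nN F1 mF1 F10) integral_slaw//.
  apply: eq_integral => x _.
  pose k (z : U * borel E) : hist E A n.+1 := (path_action (x, z.1), z.2).
  have mk : measurable_fun setT k.
    apply/measurable_fun_pairP; split => /=; last exact: measurable_snd.
    have m := measurableT_comp (@mpath_action n) (measurable_pair1 x).
    exact: (measurableT_comp m measurable_fst).
  exact: (fubini_tonelli (m1 := unif R) (m2 := lambda M n.+1) (fun z => F (k z))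
    (measurableT_comp mF mk)).
suff IH n : (n <= N')%N -> forall F : hist E A n -> \bar R,
    measurable_fun setT F -> (forall h, 0 <= F h)%E ->
    (\int[ref_law (lambda M) sbeta.1 n]_h F h = \int[mlaw n]_h F h)%E.
  by move=> F; apply: step => //; exact: IH.
elim: n => [_ F mF F0|n IH nN F mF F0].
  rewrite integral_mlaw//; apply: eq_integral => x _; rewrite /path /=.
  by rewrite integral_cst// [X in (_ * X)%E]probability_setT mule1.
rewrite step ?(ltnW nN)//; last by apply: IH; exact: ltnW.
(* [step] decodes the code of stage [n], [mlaw n.+1] that of stage [n.+1]. Only actions of index at
   most [n] are read, and on these [g_trunc] identifies the two laws. *)
pose k (z : ipow (borel E) n.+1 * U) : hist E A n.+1 :=
  coded_hist r z.1 (g (n := n) (z.1.1, z.2)).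
have mk : measurable_fun setT k.
  have m := @measurable_coded_hist E A r mr n.+1.
  apply: (measurableT_comp m (g := fun z => (z.1, g (n := n) (z.1.1, z.2)))).
  apply/measurable_fun_pairP; split => /=; first exact: measurable_fst.
  apply: (measurableT_comp (@mg n)).
  apply/measurable_fun_pairP; split => /=; last exact: measurable_snd.
  exact: (measurableT_comp measurable_fst measurable_fst).
transitivity (\int[Lam n.+1]_x \int[unif R]_u F (k (x, u)))%E.
  rewrite /= [RHS]fubini_tonelli1//; last by move=> z; apply: integral_ge0.
  by apply: (measurable_partial_integral (unif R) (measurableT_comp mF mk)) => z; exact: F0.
rewrite integral_mlaw//; apply: ae_eq_integral => //.
- by apply: (measurable_partial_integral (unif R) (measurableT_comp mF mk)) => z; exact: F0.
- by apply: (measurable_partial_integral (unif R) (measurableT_comp mF (@mpath n.+1))) => z; exact: F0.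
apply: filterS (g_trunc nN) => x gx _.
have mg1 : measurable_fun setT (fun u => trunc n.+1 (g (n := n.+1) (x, u))).
  apply: (measurableT_comp (measurable_trunc n.+1)).
  exact: (measurableT_comp (@mg n.+1) (measurable_pair1 x)).
have mg0 : measurable_fun setT (fun u => g (n := n) (x.1, u)).
  exact: (measurableT_comp (@mg n) (measurable_pair1 x.1)).
pose G c := F (coded_hist r (n := n.+1) x c).
have mG : measurable_fun setT G.
  apply: (measurableT_comp mF).
  exact: (measurableT_comp (@measurable_coded_hist E A r mr n.+1) (measurable_pair1 x)).
have e1 := integral_image_prob (unif R) mg1 mG (fun c => F0 _).
have e0 := integral_image_prob (unif R) mg0 mG (fun c => F0 _).
transitivity (\int[image_prob (unif R) mg0]_c G c)%E; first exact/esym/e0.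
transitivity (\int[image_prob (unif R) mg1]_c G c)%E.
  by apply: eq_measure_integral => B mB _; exact/esym/gx.
rewrite e1; apply: eq_integral => u _; rewrite /G /path.
by rewrite coded_hist_trunc.
Qed.

End realization.

Lemma limn_einf_ge0 (R : realType) (u : nat -> \bar R) :
  (forall k, 0 <= u k)%E -> (0 <= limn_einf u)%E.
Proof.
move=> u0; apply/limn_einf_geP => e e0; exists 0%N => k _.
by rewrite (le_trans _ (u0 k))// lee_fin sub0r oppr_le0 ltW.
Qed.

Lemma measurable_limn_einf d (T : measurableType d) (R : realType)
    (f : nat -> T -> \bar R) : (forall k, measurable_fun setT (f k)) ->
  measurable_fun setT (fun x => limn_einf (f ^~ x)).
Proof.
move=> mf; under eq_fun do rewrite -[limn_einf _]oppeK -limn_esupN.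
apply: measurableT_comp => //; apply: measurable_fun_limn_esup => k.
exact: measurableT_comp.
Qed.

(** * Existence of limit policies *)

Section limits.
Context (R : realType) (E A : ptopologicalType) (d : measure_display).
Context (Theta : measurableType d) (N' : nat).
Local Notation N := N'.+1.
Context (M : smdp R E A Theta N).
Local Notation H n := (admissible (D M) n).
Local Notation U := (measurableTypeR R).
Local Notation Lam := (ipow_prob (lambda M)).
Local Notation Us := (ipow_prob (fun=> unif R)).
Hypothesis hA : borel_space R A.
Hypothesis C1 : forall (n : nat) (x : E), (n < N)%N -> compact (feasible M n x).
Hypothesis C2 : forall (n : nat) (x x' : E) (t : Theta), (n < N)%N ->
  lower_semicontinuous
    (fun a : subspace (feasible M n x) => (q M n.+1 t x a x')%:E).
Hypothesis C3 : forall (n : nat) (x : E) (t : Theta), (n < N)%N ->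
  lower_semicontinuous
    (fun a : subspace (feasible M n x) => (cost M n t x a)%:E).

Section strategies.
Variables (a1 a2 : nat -> strategy R E A) (eps : R).
Hypotheses (sa1 : forall l, admissible_strategy M (a1 l))
  (sa2 : forall l, admissible_strategy M (a2 l)).
Hypothesis eps01 : 0 <= eps <= 1.

Let mhist_of (alpha : strategy R E A) (sa : admissible_strategy M alpha) n
    (F : hist E A n -> \bar R) : measurable_fun setT F -> (forall h, 0 <= F h)%E ->
  measurable_fun setT (fun x => \int[Us n]_u F (hist_of alpha x u))%E.
Proof.
move=> mF F0; have m := measurableT_comp mF (measurable_hist_of sa.1 (n := n)).
by apply: (measurable_partial_integral (Us n) m) => z; exact: F0.
Qed.

Let convex_integral d' (T : measurableType d') (mu : {measure set T -> \bar R})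
    (P Q : T -> \bar R) : measurable_fun setT P -> (forall x, 0 <= P x)%E ->
  measurable_fun setT Q -> (forall x, 0 <= Q x)%E ->
  (\int[mu]_x ((1 - eps)%:E * P x + eps%:E * Q x) =
   (1 - eps)%:E * \int[mu]_x P x + eps%:E * \int[mu]_x Q x)%E.
Proof.
move=> mP P0 mQ Q0; have /andP[e0 e1] := eps01.
have e1' : 0 <= 1 - eps by rewrite subr_ge0.
rewrite ge0_integralD//; last 4 first.
- by move=> x _; rewrite mule_ge0.
- by apply: measurable_funeM.
- by move=> x _; rewrite mule_ge0.
- by apply: measurable_funeM.
by rewrite !ge0_integralZl.
Qed.

Variable nb : nat -> nat * (nat -> R).
Hypothesis Wnb : forall k, tail_weights k (nb k).1 (nb k).2.

Let mixed k n (x : ipow (borel E) n) F := mixed_integral a1 a2 eps nb k x F.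

Let term n (F : hist E A n -> \bar R) j (x : ipow (borel E) n) : \bar R :=
  ((1 - eps)%:E * \int[Us n]_u F (hist_of (a1 j) x u) +
     eps%:E * \int[Us n]_u F (hist_of (a2 j) x u))%E.

Let term_ge0 n (F : hist E A n -> \bar R) j x : (forall h, 0 <= F h)%E ->
  (0 <= term F j x)%E.
Proof.
have /andP[e0 e1] := eps01.
move=> F0; apply: adde_ge0; apply: mule_ge0; rewrite ?lee_fin ?subr_ge0//;
  by apply: integral_ge0 => u _; exact: F0.
Qed.

Let mterm n (F : hist E A n -> \bar R) j : measurable_fun setT F ->
  (forall h, 0 <= F h)%E -> measurable_fun setT (term F j).
Proof.
move=> mF F0; apply: emeasurable_funD; apply: measurable_funeM.
  exact: mhist_of.
exact: mhist_of.
Qed.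

Lemma measurable_mixed_integral n (F : hist E A n -> \bar R) k :
  measurable_fun setT F -> (forall h, 0 <= F h)%E ->
  measurable_fun setT (fun x : ipow (borel E) n => mixed k x F).
Proof.
move=> mF F0; apply: emeasurable_sum => j; apply: measurable_funeM.
exact: mterm.
Qed.

Lemma mixed_integral_ge0 n (F : hist E A n -> \bar R) k x :
  (forall h, 0 <= F h)%E -> (0 <= mixed k x F)%E.
Proof.
move=> F0; apply: sume_ge0 => j _; have [b0 _ _ _] := Wnb k.
by rewrite mule_ge0 ?lee_fin//; exact: term_ge0.
Qed.

Lemma integral_mixed_integral n (F : hist E A n -> \bar R) k :
  measurable_fun setT F -> (forall h, 0 <= F h)%E ->
  (\int[Lam n]_x mixed k x F = \sum_(j < (nb k).1) ((nb k).2 j)%:E *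
    ((1 - eps)%:E * \int[ref_law (lambda M) (sa1 j).1 n]_h F h +
     eps%:E * \int[ref_law (lambda M) (sa2 j).1 n]_h F h))%E.
Proof.
move=> mF F0; have [b0 _ _ _] := Wnb k.
transitivity (\int[Lam n]_x \sum_(j < (nb k).1) ((nb k).2 j)%:E * term F j x)%E.
  by [].
rewrite ge0_integral_sum//; last 2 first.
- by move=> j; apply: measurable_funeM; exact: mterm.
- by move=> j x _; rewrite mule_ge0 ?lee_fin//; exact: term_ge0.
apply: eq_bigr => j _; rewrite ge0_integralZl ?lee_fin//; last 2 first.
- exact: mterm.
- by move=> x _; exact: term_ge0.
congr (_ * _)%E; rewrite !integral_ref_law//.
apply: convex_integral; [exact: mhist_of| |exact: mhist_of|];
  by move=> x; apply: integral_ge0 => u _; exact: F0.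
Qed.

End strategies.

Section limit_strategy.
Variable K : R.
Hypothesis cost_K : forall n t x a, (n < N)%N -> D M n (x, a) ->
  `|cost M n t x a| <= K.
Hypothesis final_K : forall t x, `|final_cost M t x| <= K.
Variables (a1 a2 : nat -> strategy R E A) (eps : R).
Hypotheses (sa1 : forall l, admissible_strategy M (a1 l))
  (sa2 : forall l, admissible_strategy M (a2 l)).
Hypothesis eps01 : 0 <= eps <= 1.

Lemma limit_strategy : exists beta (sbeta : admissible_strategy M beta) nb,
  (forall k, tail_weights k (nb k).1 (nb k).2) /\
  forall t, (\int[ref_law (lambda M) sbeta.1 N]_h (path_cost M K t h)%:E <=
    limn_einf (fun k => \sum_(j < (nb k).1) ((nb k).2 j)%:E *
      ((1 - eps)%:E * \int[ref_law (lambda M) (sa1 j).1 N]_h (path_cost M K t h)%:E +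
       eps%:E * \int[ref_law (lambda M) (sa2 j).1 N]_h (path_cost M K t h)%:E)))%E.
Proof.
have [s [r [ms mr rs closure_sr]]] := borel_space_code hA.
(* Stage [N'] is the last one with an action; the countable index is the set of all words, and
   earlier stages follow by causality. *)
have [nb [Wnb cnb]] := ae_convex_combinations_count (Lam N')
  (fun j w => measurable_mixed_weight ms eps sa1 sa2 j w (n := N'))
  (fun j w x => mixed_weight01 ms sa1 sa2 eps01 j x w).
have cN := fun n => ae_convergent_le ms sa1 sa2 cnb (n := n).
pose g n (z : ipow (borel E) n * U) := limit_code s a1 a2 eps nb z.
have mg n : measurable_fun setT (@g n) by exact: (measurable_limit_code ms eps sa1 sa2).
have [n nN|n nN|beta [sbeta betaE]] := @realization R E A d Theta N' M hA r mr g mg.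
- apply: filterS (cN n.+1 nN) => -[x x'] cx B mB.
  exact: (limit_code_trunc_law ms sa1 sa2 eps01 Wnb cx mB).
- apply: filterS (cN n nN) => x cx.
  exact: (limit_code_feasible ms mr closure_sr C1 sa1 sa2 eps01 Wnb nN cx).
exists beta, sbeta, nb; split => // t.
pose F h : \bar R := (path_cost M K t h)%:E.
have F0 h : (0 <= F h)%E by rewrite lee_fin path_cost_ge0.
have mF : measurable_fun setT F.
  apply/measurable_EFinP.
  exact: (measurableT_comp (measurable_path_cost M K) (measurable_pair1 t)).
rewrite (betaE F mF F0).
pose mixed k (x : ipow (borel E) N) := mixed_integral a1 a2 eps nb k x F.
have mmixed k : measurable_fun setT (mixed k).
  exact: (measurable_mixed_integral eps sa1 sa2 nb k mF F0).
have mixed0 k x : (0 <= mixed k x)%E by exact: (mixed_integral_ge0 a1 a2 eps01 Wnb).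
pose chF (x : ipow (borel E) N) c := F (coded_hist r x c).
have mchF : measurable_fun setT (fun z => chF z.1 z.2).
  exact: (measurableT_comp mF (@measurable_coded_hist E A r mr N)).
pose L (x : ipow (borel E) N) := (\int[unif R]_u chF x (g N' (x.1, u)))%E.
have mL : measurable_fun setT L.
  pose k (z : ipow (borel E) N * U) := (z.1, g N' (z.1.1, z.2)).
  have mk : measurable_fun setT k.
    apply/measurable_fun_pairP; split => /=; first exact: measurable_fst.
    apply: (measurableT_comp (mg N')).
    apply/measurable_fun_pairP; split => /=; last exact: measurable_snd.
    exact: (measurableT_comp measurable_fst measurable_fst).
  by apply: (measurable_partial_integral (unif R) (measurableT_comp mchF mk)) => z; exact: F0.
have L0 x : (0 <= L x)%E by apply: integral_ge0 => u _; exact: F0.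
have -> : (\int[Lam N']_x \int[lambda M N]_x' \int[unif R]_u
    F (coded_hist r (n := N) (x, x') (g N' (x, u))) = \int[Lam N]_z L z)%E.
  by rewrite /= [RHS]fubini_tonelli1.
apply: (@le_trans _ _ (\int[Lam N]_z limn_einf (mixed ^~ z))%E); last first.
  apply: (le_trans (fatou _ measurableT mmixed (fun k x _ => mixed0 k x))).
  by under eq_fun do rewrite (integral_mixed_integral sa1 sa2 eps01 Wnb _ mF F0).
apply: ae_ge0_le_integral => //.
- by move=> z _; exact: limn_einf_ge0.
- exact: measurable_limn_einf.
have cx := ae_fst_prod (lambda M N) cnb.
apply: filterS cx => -[x x'] /= cx _.
apply: (limit_code_liminf ms sa1 sa2 eps01 Wnb cx mF F0) => [|c|c y yc].
- exact: (measurableT_comp mchF (measurable_pair1 (x, x'))).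
- exact: F0.
(* If [c] is approached by admissible histories with these states, semicontinuity applies along
   [code_filter]; otherwise some prefix excludes them all. *)
have [cl|] := pselect (forall L, exists2 h : hist E A N,
    fiber M (n := N) (x, x') h & mkseq (action_code s h) L = mkseq c L).
  have hc := hist_converges_code_filter closure_sr C1 (leqnn N) cl.
  have FF := @code_filter_filter R E A d Theta N M s N (x, x') c.
  have := lsc_path_cost C2 C3 cost_K final_K FF hc (y := y) yc.
  move=> [L' _ HL]; exists L' => h fh hL; rewrite lee_fin ltW//.
  exact: HL.
move=> /existsNP[L' noh]; exists L' => h fh hL.
by case: noh; exists h.
Qed.

End limit_strategy.

(** All that the minimization needs: an inequality holding for every [t] with the same [p] and [nb].
    The shift cancels because the weights sum to 1. *)
Lemma limit_policy (p1 p2 : nat -> policy M) eps : 0 <= eps <= 1 ->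
  exists (p : policy M) nb, (forall k, tail_weights k (nb k).1 (nb k).2) /\
  forall t e, 0 < e -> exists k0, forall k, (k0 <= k)%N ->
    expected_cost p t - e <= comb (nb k).1 (nb k).2
      (fun j => (1 - eps) * expected_cost (p1 j) t + eps * expected_cost (p2 j) t).
Proof.
move=> eps01; have [K [K0 cost_K final_K]] := cost_bound M.
pose a (p : policy M) := projT1 (cid (strategy_of_policy hA p)).
have aP p : admissible_strategy M (a p) /\
    forall n, (n < N)%N -> forall h : hist E A n, H n h ->
    forall B : set (borel A), measurable B ->
    (rule p h : probability (borel A) R) B = unif R [set u | B (a p n (h, u))].
  exact: projT2 (cid (strategy_of_policy hA p)).
have [beta [sbeta [nb [Wnb le_beta]]]] := limit_strategy cost_K final_K
  (fun j => (aP (p1 j)).1) (fun j => (aP (p2 j)).1) eps01.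
have [p pbeta] := policy_of_strategy sbeta.
exists p, nb; split => // t e e0.
have := le_beta t.
rewrite -(expected_costE cost_K final_K sbeta (fun n _ h _ B _ => pbeta n h B)).
move=> /limn_einf_geP/(_ e e0)[k0 Hk]; exists k0 => k /Hk.
have E1 q := expected_costE cost_K final_K (aP q).1 (aP q).2 t.
under eq_bigr do rewrite -!E1.
rewrite (_ : (\sum_(j < _) _)%E = (comb (nb k).1 (nb k).2 (fun j =>
    (1 - eps) * (expected_cost (p1 j) t + shift N K) +
    eps * (expected_cost (p2 j) t + shift N K)))%:E); last by rewrite -sumEFin.
rewrite lee_fin => le.
rewrite -(lerD2r (shift N K)) addrAC; apply: (le_trans le).
rewrite -[X in _ <= _ + X](comb_cst (shift N K) (Wnb k)) /comb -big_split/=.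
by apply: ler_sum => j _; rewrite le_eqVlt; apply/orP; left; apply/eqP; ring.
Qed.

End limits.

(** * Relative entropy *)

(** Integrability is not assumed because the logarithm of a density may have infinite integral. *)
Lemma le_integral_measurable d (T : measurableType d) (R : realType)
    (mu : {measure set T -> \bar R}) (f g : T -> \bar R) :
  measurable_fun setT f -> measurable_fun setT g -> (forall x, f x <= g x)%E ->
  (\int[mu]_x f x <= \int[mu]_x g x)%E.
Proof.
move=> mf mg fg; rewrite integralE [leRHS]integralE; apply: leeB.
- apply: ge0_le_integral => //; [exact: measurable_funepos|exact: measurable_funepos|].
  by move=> x _; apply: (@funepos_le _ _ setT f g) => [y _|]; [exact: fg|rewrite inE].
- apply: ge0_le_integral => //; [exact: measurable_funeneg|exact: measurable_funeneg|].
  by move=> x _; apply: (@funeneg_le _ _ setT f g) => [y _|]; [exact: fg|rewrite inE].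
Qed.

Lemma measurable_lne (R : realType) : measurable_fun setT (@lne R).
Proof.
have -> : @lne R = fun x => if (x <= 0)%E then -oo%E else
    if (x == +oo)%E then +oo%E else (ln (fine x))%:E.
  by apply/funext => -[x| |] //=; rewrite ?lee_fin ?leNye// leNgt ltry.
apply: (@measurable_fun_ifT _ _ (\bar R) (\bar R) (fun=> -oo%E)
    (fun x => if (x == +oo)%E then +oo%E else (ln (fine x))%:E)
    (fun x => (x <= 0)%E)); [| exact: measurable_cst|].
  apply: (measurable_fun_bool true).
  rewrite (_ : _ @^-1` _ = [set x | (x <= 0)%E]); last by apply/seteqP; split.
  exact: emeasurable_fun_infty_c.
apply: (@measurable_fun_ifT _ _ (\bar R) (\bar R) (fun=> +oo%E)
    (fun x => (ln (fine x))%:E) (fun x => (x == +oo)%E)); [| exact: measurable_cst|].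
  apply: (measurable_fun_bool true).
  rewrite (_ : _ @^-1` _ = [set +oo%E]); last by apply/seteqP; split => x /= /eqP.
  by rewrite setTI; exact: emeasurable_set1.
apply/measurable_EFinP; apply: (measurableT_comp (@measurable_ln R)).
exact: fine_measurable.
Qed.

Section bounded.
Context d (T : measurableType d) (R : realType) (P : probability T R) (B : R).
Implicit Types f g : T -> R.

Lemma bounded_integrable f : measurable_fun setT f -> (forall x, `|f x| <= B) ->
  P.-integrable setT (EFin \o f).
Proof.
move=> mf fB; apply: measurable_bounded_integrable => //.
  by rewrite [X in (X < _)%E]probability_setT ltry.
by exists B; split; [exact: num_real|move=> x Bx y _; exact: le_trans (fB y) (ltW Bx)].
Qed.

Lemma Rintegral_probability_cst (r : R) : \int[P]_x r = r.
Proof. by rewrite Rintegral_cst// [X in fine X]probability_setT mulr1. Qed.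

Lemma EFin_Rintegral f : P.-integrable setT (EFin \o f) ->
  (\int[P]_x f x)%R%:E = (\int[P]_x (f x)%:E)%E.
Proof. by move=> fi; rewrite fineK//; exact: integrable_fin_num. Qed.

End bounded.

Section entropy.
Context d (T : measurableType d) (R : realType) (m : probability T R).
Variables (f : T -> R) (B : R).
Hypotheses (mf : measurable_fun setT f) (fB : forall x, `|f x| <= B).

Definition partition_function : R := \int[m]_x expR (f x).
Local Notation Z := partition_function.

Lemma measurable_expf : measurable_fun setT (fun x => expR (f x)).
Proof. exact: measurableT_comp. Qed.

Lemma expf_bound x : `|expR (f x)| <= expR B.
Proof.
by rewrite ger0_norm ?expR_ge0// ler_expR (le_trans (ler_norm _)).
Qed.

Lemma integrable_expf (P : probability T R) : P.-integrable setT (EFin \o (fun x => expR (f x))).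
Proof. exact: (bounded_integrable P measurable_expf expf_bound). Qed.

Lemma partition_function_gt0 : 0 < Z.
Proof.
apply: (lt_le_trans (expR_gt0 (- B))); rewrite -(Rintegral_probability_cst m (expR (- B))).
apply: le_Rintegral => //; first exact: finite_measure_integrable_cst.
  exact: integrable_expf.
by move=> x _; rewrite ler_expR; have := fB x; rewrite ler_norml => /andP[].
Qed.

Section density.
Variables (P : probability T R) (w : T -> R).
Hypotheses (mw : measurable_fun setT w) (w0 : forall x, 0 <= w x).
Hypothesis Pw : forall S, measurable S -> P S = (\int[m]_(x in S) (w x)%:E)%E.

Lemma ae_density_gt0 : {ae P, forall x, 0 < w x}.
Proof.
have mN : measurable (w @^-1` [set 0]).
  by rewrite -[X in measurable X]setTI; exact: mw.
exists (w @^-1` [set 0]); split=> //=.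
  by rewrite Pw// integral0_eq// => x /= ->.
by move=> x /= /negP; rewrite lt_neqAle w0 andbT negbK => /eqP.
Qed.

(** [ln] and [lne] disagree where [w] vanishes, but that set is [P]-null; the almost everywhere
    equality of the derivative with [w] passes from [m] to [P] by domination. *)
Lemma rel_entropy_density : rel_entropy P m = (\int[P]_x (ln (w x))%:E)%E.
Proof.
have Pm := density_dominates mw Pw.
rewrite /rel_entropy asboolT//; apply: ae_eq_integral => //.
- apply: (measurableT_comp (@measurable_lne R)).
  by apply: measurable_int; apply: Radon_Nikodym_integrable.
- by apply/measurable_EFinP; exact: measurableT_comp.
have [X [mX X0 XP]] := density_Radon_Nikodym mw w0 Pw.
have aeRN : {ae P, forall x, ('d (charge_of_finite_measure P) '/d m) x = (w x)%:E}.
  exists X; split => //; first exact: (null_content_dominatesP _ _).1 Pm _ mX X0.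
  by move=> x nx; apply: XP => /(_ Logic.I).
apply: filterS2 aeRN ae_density_gt0 => x /= -> wx _.
by rewrite lne_EFin.
Qed.

(* Young's inequality: [f - ln Z + 1 - expR (f - ln Z - ln w) <= ln w]. *)
Lemma rel_entropy_density_ge : ((\int[P]_x f x - ln Z)%:E <= rel_entropy P m)%E.
Proof.
have Z0 := partition_function_gt0.
pose k x := expR (f x - ln Z - ln (w x)).
have mlw : measurable_fun setT (fun x => ln (w x)) by exact: measurableT_comp.
have mk : measurable_fun setT k.
  apply: measurableT_comp => //; apply: measurable_funB => //.
  exact: measurable_funB.
(* Multiplied by [w], the function [k] becomes [expR (f x) / Z] where [w > 0] and 0 elsewhere. *)
have k1 : (\int[P]_x (k x)%:E <= 1)%E.
  rewrite (density_integral mw w0 Pw)//; last 2 first.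
  - exact/measurable_EFinP.
  - by move=> x; rewrite lee_fin expR_ge0.
  apply: (@le_trans _ _ (\int[m]_x (Z^-1 * expR (f x))%:E)%E).
    apply: ge0_le_integral => //.
    - by move=> x _; rewrite -EFinM lee_fin mulr_ge0// expR_ge0.
    - by apply: emeasurable_funM; exact/measurable_EFinP.
    - apply/measurable_EFinP; apply: measurable_funM => //; exact: measurable_expf.
    move=> x _; rewrite -EFinM lee_fin /k.
    have [wx|wx] := ltP 0 (w x).
      rewrite !expRB !lnK// mulfVK ?gt_eqF//; first by rewrite mulrC.
    have -> : w x = 0 by apply/eqP; rewrite eq_le wx w0.
    by rewrite mulr0 mulr_ge0 ?expR_ge0// invr_ge0 ltW.
  rewrite -EFin_Rintegral; last first.
    apply: (@bounded_integrable _ _ _ m (Z^-1 * expR B)) => [|x].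
      by apply: measurable_funM => //; exact: measurable_expf.
    by rewrite normrM ler_pM// ?expf_bound// ger0_norm// invr_ge0 ltW.
  rewrite RintegralZl//; last exact: integrable_expf.
  by rewrite mulVf// gt_eqF.
have ki : P.-integrable setT (EFin \o k).
  apply/integrableP; split; first exact/measurable_EFinP.
  under eq_integral do rewrite /= ger0_norm ?expR_ge0//.
  by rewrite (le_lt_trans k1)// ltry.
have fi := bounded_integrable P mf fB.
rewrite rel_entropy_density.
apply: (@le_trans _ _ (\int[P]_x (f x - ln Z + (1 - k x))%:E)%E); last first.
  apply: le_integral_measurable.
  - apply/measurable_EFinP; apply: measurable_funD; exact: measurable_funB.
  - exact/measurable_EFinP.
  move=> x; rewrite lee_fin /k; have := expR_ge1Dx (f x - ln Z - ln (w x)).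
  lra.
have ci r : P.-integrable setT (EFin \o (fun=> r)).
  exact: finite_measure_integrable_cst.
have i1 : P.-integrable setT (EFin \o (fun x => f x - ln Z)).
  exact: (integrableB measurableT fi (ci _)).
have i2 : P.-integrable setT (EFin \o (fun x => 1 - k x)).
  exact: (integrableB measurableT (ci _) ki).
rewrite -EFin_Rintegral; last exact: (integrableD measurableT i1 i2).
rewrite RintegralD// !RintegralB// !Rintegral_probability_cst lee_fin.
rewrite lerDl subr_ge0 -lee_fin EFin_Rintegral//.
Qed.

End density.

Lemma rel_entropy_ge (P : probability T R) :
  ((\int[P]_x f x - ln Z)%:E <= rel_entropy P m)%E.
Proof.
have [Pm|nPm] := pselect (P `<< m); last by rewrite /rel_entropy asboolF// leey.
have [w [mw w0 _ Pw]] := density_exists Pm.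
exact: (rel_entropy_density_ge mw w0 Pw).
Qed.

Definition gibbs_density x := expR (f x) / Z.

Lemma gibbs_density_gt0 x : 0 < gibbs_density x.
Proof. by rewrite divr_gt0 ?expR_gt0// partition_function_gt0. Qed.

Lemma measurable_gibbs_density : measurable_fun setT gibbs_density.
Proof. by apply: measurable_funM => //; exact: measurable_expf. Qed.

Lemma gibbs_exists : exists P : probability T R,
  forall S, measurable S -> P S = (\int[m]_(x in S) (gibbs_density x)%:E)%E.
Proof.
have mw := measurable_gibbs_density.
pose nu (S : set T) : \bar R := (\int[m]_(x in S) (gibbs_density x)%:E)%E.
have nu0 : nu set0 = 0%E by exact: integral_set0.
have nu_ge0 S : (0 <= nu S)%E.
  by apply: integral_ge0 => x _; rewrite lee_fin ltW// gibbs_density_gt0.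
have nu_sigma : semi_sigma_additive nu.
  move=> F mF tF mUF; apply: cvg_toP.
    by apply: is_cvg_ereal_nneg_natsum => i _; exact: nu_ge0.
  apply/esym; apply: ge0_integral_bigcup => //.
    by apply: measurable_funTS; exact/measurable_EFinP.
  by move=> x _; rewrite lee_fin ltW// gibbs_density_gt0.
pose mu : {measure set T -> \bar R} :=
  HB.pack nu (isMeasure.Build _ _ _ nu nu0 nu_ge0 nu_sigma).
have muT : mu setT = 1%E.
  rewrite /mu /= /nu -EFin_Rintegral.
    rewrite /gibbs_density; under eq_Rintegral do rewrite mulrC.
    rewrite RintegralZl//; last exact: integrable_expf.
    by rewrite mulVf// gt_eqF// partition_function_gt0.
  apply: (@bounded_integrable _ _ _ m (expR B / Z)) => // x.
  rewrite normrM ler_pM// ?expf_bound// ger0_norm// invr_ge0 ltW//.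
  exact: partition_function_gt0.
pose P : probability T R :=
  HB.pack (Measure.sort mu) (Measure_isProbability.Build _ _ _ mu muT).
by exists P.
Qed.

Lemma rel_entropy_gibbs (P : probability T R) :
  (forall S, measurable S -> P S = (\int[m]_(x in S) (gibbs_density x)%:E)%E) ->
  rel_entropy P m = (\int[P]_x f x - ln Z)%:E.
Proof.
move=> Pw; have w0 x := ltW (gibbs_density_gt0 x).
rewrite (rel_entropy_density measurable_gibbs_density w0 Pw).
have ci r : P.-integrable setT (EFin \o (fun=> r)).
  exact: finite_measure_integrable_cst.
have fi := bounded_integrable P mf fB.
rewrite -[X in _ - X](Rintegral_probability_cst P) -RintegralB//.
rewrite EFin_Rintegral; last exact: (integrableB measurableT fi (ci _)).
apply: eq_integral => x _; congr EFin.
by rewrite ln_div ?posrE ?expR_gt0 ?partition_function_gt0// expRK.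
Qed.

Lemma integral_gibbs (P : probability T R) (g : T -> R) (C : R) :
  (forall S, measurable S -> P S = (\int[m]_(x in S) (gibbs_density x)%:E)%E) ->
  measurable_fun setT g -> (forall x, `|g x| <= C) ->
  \int[P]_x g x = (\int[m]_x (expR (f x) * g x)) / Z.
Proof.
move=> Pw mg gC; have Z0 := partition_function_gt0.
have mw := measurable_gibbs_density; have w0 x := ltW (gibbs_density_gt0 x).
have gi Q := bounded_integrable Q mg gC.
have ci (Q : probability T R) r : Q.-integrable setT (EFin \o (fun=> r)).
  exact: finite_measure_integrable_cst.
have egi : m.-integrable setT (EFin \o (fun x => expR (f x) * g x)).
  apply: (@bounded_integrable _ _ _ m (expR B * C)) => [|x].
    by apply: measurable_funM => //; exact: measurable_expf.
  by rewrite normrM ler_pM// expf_bound.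
(* [density_integral] is stated for non-negative functions, hence the shift by [C], removed at the
   end. *)
have gC0 x : 0 <= g x + C by have := gC x; rewrite ler_norml => /andP[]; lra.
have : (\int[P]_x (g x + C)%:E = \int[m]_x ((g x + C)%:E * (gibbs_density x)%:E))%E.
  apply: (density_integral mw w0 Pw) => [|x]; last by rewrite lee_fin.
  by apply/measurable_EFinP; exact: measurable_funD.
rewrite -EFin_Rintegral; last exact: (integrableD measurableT (gi P) (ci P C)).
rewrite (RintegralD measurableT (gi P) (ci P C)) Rintegral_probability_cst.
have -> : (\int[m]_x ((g x + C)%:E * (gibbs_density x)%:E) =
    (\int[m]_x (Z^-1 * (expR (f x) * g x) + C * Z^-1 * expR (f x)))%R%:E)%E.
  rewrite EFin_Rintegral.
    apply: eq_integral => x _; rewrite -EFinM /gibbs_density; congr EFin; ring.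
  exact: (integrableD measurableT (integrableZl measurableT _ egi)
    (integrableZl measurableT _ (integrable_expf m))).
move=> [] /=; rewrite (RintegralD measurableT (integrableZl measurableT Z^-1 egi)
  (integrableZl measurableT (C * Z^-1) (integrable_expf m))).
rewrite !RintegralZl//; last exact: integrable_expf.
by rewrite -/Z -mulrA mulVf ?gt_eqF// mulr1 => /addIr ->; rewrite mulrC.
Qed.

End entropy.

(** * Minimizers and saddle points *)

(** [expR x] is at most the inverse of [1 - x], and the product of [1 - x] with the right-hand side
    is [1 + x^2 (1 - 2 x)], at least 1. *)
Lemma expR_le_quadratic (R : realType) (x : R) : x <= 2^-1 -> expR x <= 1 + x + 2 * x ^+ 2.
Proof.
move=> x2; have x1 : 0 < 1 - x by lra.
have h : expR x <= (1 - x)^-1.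
  rewrite -[leLHS]invrK lef_pV2 ?posrE ?invr_gt0 ?expR_gt0//.
  by rewrite -expRN expR_ge1Dx.
apply: (le_trans h); rewrite -[leLHS]mul1r ler_pdivrMr//.
have := mulr_ge0 (sqr_ge0 x) (_ : 0 <= 1 - 2 * x); nra.
Qed.

Lemma integral_comb d (T : measurableType d) (R : realType) (mu : probability T R)
    (n : nat) (b : nat -> R) (f : nat -> T -> R) :
  (forall j, mu.-integrable setT (EFin \o f j)) ->
  mu.-integrable setT (EFin \o (fun t => comb n b (f ^~ t))) /\
  \int[mu]_t comb n b (f ^~ t) = comb n b (fun j => \int[mu]_t f j t).
Proof.
move=> fi; rewrite /comb; elim: n => [|n [IHi IH]].
  rewrite (_ : (fun t => _) = (fun=> 0)); last by apply/funext => t; rewrite big_ord0.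
  rewrite big_ord0 Rintegral_probability_cst; split => //.
  exact: finite_measure_integrable_cst.
have bi := integrableZl measurableT (b n) (fi n).
rewrite (_ : (fun t => _) = (fun t => \sum_(j < n) b j * f j t + b n * f n t)); last first.
  by apply/funext => t; rewrite big_ord_recr.
split; first exact: (integrableD measurableT IHi bi).
by rewrite (RintegralD measurableT IHi bi) IH RintegralZl// big_ord_recr.
Qed.

Section minimizers.
Context d (T : measurableType d) (R : realType).
Variables (Pol : Type) (p0 : Pol) (C : Pol -> T -> R) (B : R).
Hypotheses (mC : forall p, measurable_fun setT (C p)) (CB : forall p t, `|C p t| <= B).
Hypothesis C_limit : forall (p1 p2 : nat -> Pol) eps, 0 <= eps <= 1 ->
  exists (p : Pol) nb, (forall k, tail_weights k (nb k).1 (nb k).2) /\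
  forall t e, 0 < e -> exists k0, forall k, (k0 <= k)%N ->
    C p t - e <= comb (nb k).1 (nb k).2
      (fun j => (1 - eps) * C (p1 j) t + eps * C (p2 j) t).

(** With constant sequences every convex combination equals the mixed cost itself. *)
Lemma C_mix p q eps : 0 <= eps <= 1 ->
  exists r, forall t, C r t <= (1 - eps) * C p t + eps * C q t.
Proof.
move=> eps01; have [r [nb [Wnb le_r]]] := C_limit (fun=> p) (fun=> q) eps01.
exists r => t; apply/ler_addgt0Pr => e e0; have [k0 /(_ _ (leqnn k0))] := le_r t e e0.
by rewrite (comb_cst _ (Wnb k0)) lerBlDr.
Qed.

Section convex_function.
Variables (mu : probability T R) (phi : R -> R).
Hypothesis mphi : measurable_fun setT phi.
Hypothesis phi_nd : {homo phi : x y / x <= y}.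
Hypothesis phi_left : forall x e, 0 < e -> exists2 dl, 0 < dl & phi x - e <= phi (x - dl).
Hypothesis phi_convex : forall n b k x, tail_weights k n b ->
  phi (comb n b x) <= comb n b (phi \o x).

Let J p := \int[mu]_t phi (C p t).

Let mphiC p : measurable_fun setT (fun t => phi (C p t)).
Proof. exact: measurableT_comp. Qed.

Let CB2 p t : - B <= C p t <= B.
Proof. by rewrite -ler_norml. Qed.

Let phi_ge p t : phi (- B) <= phi (C p t).
Proof. by apply: phi_nd; have /andP[] := CB2 p t. Qed.

Let phiC_integrable p : mu.-integrable setT (EFin \o (fun t => phi (C p t))).
Proof.
apply: (@bounded_integrable _ _ _ mu (`|phi (- B)| + `|phi B|)) => // t.
have /andP[l1 l2] := CB2 p t; have := phi_nd l1; have := phi_nd l2.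
have := ler_norm (phi B); have := ler_norm (- phi (- B)); rewrite normrN.
have := normr_ge0 (phi B); have := normr_ge0 (phi (- B)).
by rewrite ler_norml => *; apply/andP; split; lra.
Qed.

Let J_ge p : phi (- B) <= J p.
Proof.
rewrite -(Rintegral_probability_cst mu (phi (- B))); apply: le_Rintegral => //.
exact: finite_measure_integrable_cst.
Qed.

(** Direct method, with a limit policy of a minimizing sequence. Left continuity of [phi] absorbs
    the error in [C_limit], convexity compares [phi] of a combination with the combination, and
    Fatou's lemma concludes. It is used with an exponential and with the identity. *)
Lemma minimizer : exists p, forall p', \int[mu]_t phi (C p t) <= \int[mu]_t phi (C p' t).
Proof.
pose m := inf (range J).
have hinf : has_inf (range J).
  by split; [exists (J p0); exists p0|exists (phi (- B)) => _ [p _ <-]; exact: J_ge].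
have ex l : exists p, J p < m + l.+1%:R^-1.
  have l0 : 0 < l.+1%:R^-1 :> R by rewrite invr_gt0 ltr0n.
  by have [_ [p _ <-] lt_p] := inf_adherent l0 hinf; exists p.
have [ps Jps] := choice ex.
have zero01 : 0 <= (0 : R) <= 1 by rewrite lexx ler01.
have [p [nb [Wnb le_p]]] := C_limit ps ps zero01.
exists p => p'; suff : J p <= m.
  by move=> /le_trans; apply; apply: ge_inf; [case: hinf|exists p'].
(* Subtracting the lower bound [phi (- B)] gives Fatou's lemma non-negative functions. *)
pose F t : \bar R := (phi (C p t) - phi (- B))%:E.
pose G k t : R := comb (nb k).1 (nb k).2 (fun j => phi (C (ps j) t)).
have [Gi GE] : (forall k, mu.-integrable setT (EFin \o G k)) /\
    forall k, \int[mu]_t G k t = comb (nb k).1 (nb k).2 (fun j => J (ps j)).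
  split=> k; have [i e] := integral_comb (nb k).1 (nb k).2
    (fun j => phiC_integrable (ps j)); [exact: i|exact: e].
have FG t : (F t <= limn_einf (fun k => (G k t - phi (- B))%:E))%E.
  apply/limn_einf_geP => e e0; have [dl dl0 Hdl] := phi_left (C p t) e0.
  have [k0 Hk] := le_p t dl dl0; exists k0 => k /Hk le_k.
  rewrite lee_fin addrAC lerD2r; apply: (le_trans Hdl).
  apply: (le_trans (phi_nd le_k)); apply: (le_trans (phi_convex _ (Wnb k))).
  rewrite /G /comb; apply: ler_sum => j _ /=.
  by rewrite subr0 mul1r mul0r addr0.
have ci r : mu.-integrable setT (EFin \o (fun=> r)) by exact: finite_measure_integrable_cst.
have GBi k := integrableB measurableT (Gi k) (ci (phi (- B))).
have mGB k : measurable_fun setT (fun t => (G k t - phi (- B))%:E).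
  exact: measurable_int (GBi k).
have G0 k t : (0 <= (G k t - phi (- B))%:E)%E.
  rewrite lee_fin subr_ge0 -[leLHS](comb_cst _ (Wnb k)).
  by apply: (comb_le (Wnb k)) => j _; exact: phi_ge.
have : ((J p - phi (- B))%:E <= limn_einf (fun k => (\int[mu]_t G k t - phi (- B))%:E))%E.
  rewrite -[X in _ - X](Rintegral_probability_cst mu).
  rewrite -(RintegralB measurableT (phiC_integrable p) (ci _)).
  rewrite EFin_Rintegral; last first.
    exact: (integrableB measurableT (phiC_integrable p) (ci _)).
  apply: (@le_trans _ _ (\int[mu]_t limn_einf (fun k => (G k t - phi (- B))%:E))%E).
    apply: le_integral_measurable => //.
      by apply/measurable_EFinP; exact: measurable_funB.
    exact: measurable_limn_einf.
  apply: (le_trans (fatou _ measurableT mGB (fun k t _ => G0 k t))).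
  rewrite (_ : (fun k => _) = (fun k => (\int[mu]_t G k t - phi (- B))%:E))//.
  apply/funext => k; rewrite -[X in _ - X](Rintegral_probability_cst mu).
  by rewrite -(RintegralB measurableT (Gi k) (ci _)) (EFin_Rintegral (GBi k)).
move=> /limn_einf_geP le_J; apply/ler_addgt0Pr => e e0.
have e20 : 0 < e / 2 by rewrite divr_gt0.
have [k0 Hk] := le_J _ e20.
pose k := maxn k0 (Num.truncn (e / 2)^-1).
have := Hk k (leq_maxl _ _); rewrite lee_fin GE.
have : comb (nb k).1 (nb k).2 (fun j => J (ps j)) <= m + k.+1%:R^-1.
  rewrite -[leRHS](comb_cst _ (Wnb k)); apply: (comb_le (Wnb k)) => j kj.
  apply: (le_trans (ltW (Jps j))); rewrite lerD2l lef_pV2 ?posrE ?ltr0n//.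
  by rewrite ler_nat.
have : k.+1%:R^-1 <= e / 2.
  rewrite -[leRHS]invrK lef_pV2 ?posrE ?invr_gt0 ?ltr0n//.
  apply: ltW; apply: (lt_le_trans (truncnS_gt _)).
  by rewrite ler_nat ltnS leq_maxr.
move: (comb _ _ _) (k.+1%:R^-1) (J p) (phi (- B)) => x y z v; lra.
Qed.

End convex_function.

Section saddle_point.
Variables (m : probability T R) (gamma : R).
Hypotheses (B0 : 0 <= B) (gamma0 : 0 < gamma).
Local Notation f p := (fun t => gamma * C p t).
Local Notation Z p := (partition_function m (f p)).

Variables (p q : Pol) (P : probability T R).
Hypothesis Z_min : forall r, Z p <= Z r.
Hypothesis P_gibbs : forall S, measurable S ->
  P S = (\int[m]_(x in S) (gibbs_density m (f p) x)%:E)%E.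

Let mf r : measurable_fun setT (f r).
Proof. exact: measurable_funM. Qed.

Let fB r t : `|gamma * C r t| <= gamma * B.
Proof. by rewrite normrM gtr0_norm// ler_pM2l. Qed.

(* [gamma * a] is the derivative at [eps = 0] of [Z] along the mixtures of [p]
   and [q]. *)
Let a := \int[m]_t (expR (f p t) * (C q t - C p t)).
Let c := gamma * (2 * B).

Let DB t : `|C q t - C p t| <= 2 * B.
Proof. by rewrite (le_trans (ler_normB _ _))// mulr2n mulrDl mul1r lerD. Qed.

Let ei := integrable_expf (mf p) (fB p) m.

Let di : m.-integrable setT (EFin \o (fun t => expR (f p t) * (C q t - C p t))).
Proof.
apply: (@bounded_integrable _ _ _ m (expR (gamma * B) * (2 * B))) => [|t].
  apply: measurable_funM; first exact: measurable_expf.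
  exact: measurable_funB.
by rewrite normrM ler_pM// (expf_bound (fB p)).
Qed.

(** Minimality of [Z p] against a policy dominated by the mixture, with the exponential expanded to
    second order. The exponent changes by at most [eps * c], which must not exceed the bound of
    [expR_le_quadratic]. *)
Let derivative_bound eps : 0 < eps <= 1 -> eps * c <= 2^-1 ->
  0 <= gamma * a + 2 * eps * c ^+ 2 * Z p.
Proof.
move=> /andP[e0 e1] ec.
have eps01 : 0 <= eps <= 1 by rewrite ltW.
have [r le_r] := C_mix p q eps01.
have c0 : 0 <= c by rewrite mulr_ge0// ?mulr_ge0// ltW.
have bound t : expR (f r t) <= (gamma * eps) * (expR (f p t) * (C q t - C p t)) +
    (1 + 2 * (eps * c) ^+ 2) * expR (f p t).
  pose x := gamma * (eps * (C q t - C p t)).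
  have xc : `|x| <= eps * c.
    by rewrite /x !normrM (gtr0_norm gamma0) (gtr0_norm e0) mulrCA !ler_pM2l.
  have x2 : x <= 2^-1 by rewrite (le_trans (ler_norm _))// (le_trans xc).
  apply: (@le_trans _ _ (expR (f p t + x))).
    rewrite ler_expR /x -mulrDr ler_pM2l// (le_trans (le_r t))//.
    by rewrite le_eqVlt; apply/orP; left; apply/eqP; ring.
  rewrite expRD; have : x ^+ 2 <= (eps * c) ^+ 2.
    by rewrite -[x ^+ 2]real_normK ?num_real// lerXn2r// nnegrE// mulr_ge0// ltW.
  move=> xx; apply: (@le_trans _ _ (expR (f p t) * (1 + x + 2 * (eps * c) ^+ 2))).
    rewrite ler_wpM2l ?expR_ge0// (le_trans (expR_le_quadratic x2))//.
    by rewrite lerD2l ler_pM2l.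
  by rewrite le_eqVlt; apply/orP; left; apply/eqP; rewrite /x; ring.
have i1 := integrableZl measurableT (gamma * eps) di.
have i2 := integrableZl measurableT (1 + 2 * (eps * c) ^+ 2) ei.
have : Z p <= (gamma * eps) * a + (1 + 2 * (eps * c) ^+ 2) * Z p.
  apply: (le_trans (Z_min r)).
  rewrite /partition_function /a -(RintegralZl (gamma * eps) measurableT di).
  rewrite -(RintegralZl (1 + 2 * (eps * c) ^+ 2) measurableT ei).
  rewrite -(RintegralD measurableT i1 i2).
  exact: (le_Rintegral measurableT (integrable_expf (mf r) (fB r) m)
    (integrableD measurableT i1 i2) (fun t _ => bound t)).
rewrite -(pmulr_rge0 _ e0).
have -> : eps * (gamma * a + 2 * eps * c ^+ 2 * Z p) =
    gamma * eps * a + 2 * (eps * c) ^+ 2 * Z p by ring.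
move: (Z p) (gamma * eps * a) ((eps * c) ^+ 2) => x y z; rewrite mulrDl mul1r; lra.
Qed.

(** First order condition: the difference of the two sides is [a / Z p], and a negative [a] would
    contradict [derivative_bound] for small [eps]. *)
Lemma saddle_point : \int[P]_t C p t <= \int[P]_t C q t.
Proof.
have Z0 := partition_function_gt0 m (mf p) (fB p).
have c0 : 0 <= c by rewrite mulr_ge0// ?mulr_ge0// ltW.
have a0 : 0 <= a.
  rewrite leNgt; apply/negP => alt.
  have b0 : 0 < - (gamma * a) by rewrite -mulrN mulr_gt0// oppr_gt0.
  pose D := 2 * c ^+ 2 * Z p.
  have D0 : 0 <= D by rewrite mulr_ge0 ?(ltW Z0)// mulr_ge0// sqr_ge0.
  (* Three non-negative summands, one for each requirement: [e <= 1], [e * c <= 1 / 2] and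
     [e * D < - (gamma * a)]. *)
  pose e := (1 + 2 * c + D / - (gamma * a))^-1.
  have q0 : 0 <= D / - (gamma * a) by rewrite divr_ge0// ltW.
  have s0 : 0 < 1 + 2 * c + D / - (gamma * a) by lra.
  have e0 : 0 < e by rewrite invr_gt0.
  have es : e * (1 + 2 * c + D / - (gamma * a)) = 1 by rewrite mulVf// gt_eqF.
  have ec0 : 0 <= e * c by rewrite mulr_ge0// ltW.
  have eq0 : 0 <= e * (D / - (gamma * a)) by rewrite mulr_ge0// ltW.
  have eE : e + 2 * (e * c) + e * (D / - (gamma * a)) = 1 by rewrite -[RHS]es; ring.
  have e1 : 0 < e <= 1 by rewrite e0/=; lra.
  have ec : e * c <= 2^-1 by lra.
  have eD : e * D < - (gamma * a).
    have : e * (D / - (gamma * a)) < 1 by lra.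
    by rewrite mulrA ltr_pdivrMr// mul1r.
  have := derivative_bound e1 ec.
  rewrite (_ : 2 * e * c ^+ 2 * Z p = e * D); last by rewrite /D; ring.
  lra.
rewrite -subr_ge0 -RintegralB//; last 2 first.
- exact: (bounded_integrable P (mC q) (CB q)).
- exact: (bounded_integrable P (mC p) (CB p)).
rewrite (integral_gibbs (mf p) (fB p) P_gibbs (measurable_funB (mC q) (mC p)) DB).
by rewrite divr_ge0// ltW.
Qed.

End saddle_point.

End minimizers.

Section exponential_cost.
Context (R : realType) (gamma : R).
Hypothesis gamma0 : 0 < gamma.

(** The exponential lies above its tangent at [x], whose slope is [gamma * expR (gamma * x)]; [dl]
    is [e] divided by this slope. *)
Lemma expRM_left (x e : R) : 0 < e ->
  exists2 dl, 0 < dl & expR (gamma * x) - e <= expR (gamma * (x - dl)).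
Proof.
move=> e0; have y0 := expR_gt0 (gamma * x).
have gy0 : 0 < gamma * expR (gamma * x) by exact: mulr_gt0.
exists (e / (gamma * expR (gamma * x))); first exact: divr_gt0.
rewrite mulrBr expRD.
have := expR_ge1Dx (- (gamma * (e / (gamma * expR (gamma * x))))).
rewrite -(ler_pM2l y0); apply: le_trans.
rewrite mulrDr mulr1 lerD2l mulrN lerN2 le_eqVlt; apply/orP; left; apply/eqP.
by field; rewrite !gt_eqF.
Qed.

(** Jensen's inequality: the tangent at the barycenter lies below the exponential and averages to
    its value there. *)
Lemma expRM_convex n b k (x : nat -> R) : tail_weights k n b ->
  expR (gamma * comb n b x) <= comb n b (fun j => expR (gamma * x j)).
Proof.
move=> W; set c := comb n b x; have [b0 _ _ b1] := W.
rewrite -[leLHS](_ : comb n b (fun j =>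
    expR (gamma * c) * (1 + gamma * (x j - c))) = _); last first.
  rewrite /comb (eq_bigr (fun j : 'I_n => expR (gamma * c) * (1 - gamma * c) * b j +
    expR (gamma * c) * gamma * (b j * x j))); last by move=> j _; ring.
  rewrite big_split/= -!mulr_sumr b1 -[\sum_(j < n) _]/(comb n b x) -/c; ring.
apply: (comb_le W) => j _.
have -> : gamma * x j = gamma * c + gamma * (x j - c) by ring.
by rewrite expRD ler_pM2l ?expR_gt0// expR_ge1Dx.
Qed.

End exponential_cost.

Theorem theorem3p4 (R : realType) (E A : ptopologicalType)
    (hE : borel_space R E) (hA : borel_space R A)
    (d : measure_display) (Theta : measurableType d)
    (N : nat) (hN : (0 < N)%N) (M : smdp R E A Theta N)
    (mu0 : probability Theta R) (gamma : R) (hgamma : 0 < gamma)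
    (C1 : forall (n : nat) (x : E), (n < N)%N -> compact (feasible M n x))
    (C2 : forall (n : nat) (x x' : E) (t : Theta), (n < N)%N ->
      lower_semicontinuous
        (fun a : subspace (feasible M n x) => (q M n.+1 t x a x')%:E))
    (C3 : forall (n : nat) (x : E) (t : Theta), (n < N)%N ->
      lower_semicontinuous
        (fun a : subspace (feasible M n x) => (cost M n t x a)%:E)) :
  (is_min (fun p : policy M =>
       ereal_sup (range (fun mu => lagrangian mu0 gamma mu p)))
     (optimal_value M mu0 gamma) /\
   exists m : probability Theta R -> \bar R,
     (forall mu, is_min (lagrangian (M := M) mu0 gamma mu) (m mu)) /\
     optimal_value M mu0 gamma = ereal_sup (range m)) /\
  exists p : policy M,
    (policy_value mu0 gamma p)%:E = optimal_value M mu0 gamma.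
Proof.
case: N hN M C1 C2 C3 => // N' _ M C1 C2 C3.
have [K [K0 cost_K final_K]] := cost_bound M.
pose B := shift N'.+1 K.
have B0 : 0 <= B by exact: mulrn_wge0.
have CB (p : policy M) t : `|expected_cost p t| <= B by exact: expected_cost_bound.
have mC (p : policy M) : measurable_fun setT (expected_cost p).
  exact: (measurable_expected_cost cost_K final_K hA).
have lim := limit_policy hA C1 C2 C3.
(* The set of policies is non-empty thanks to the measurable selectors. *)
have [p0 _] : exists p : policy M, True.
  pose f n := projT1 (cid (strategy_selection M n)).
  have fP n : measurable_fun setT (f n) /\ forall h, D M n (last_state h, f n h).
    exact: projT2 (cid (strategy_selection M n)).
  have [|p _] := @policy_of_strategy _ _ _ _ _ _ M (fun n z => f n z.1).
    split=> [n|n h u]; last exact: (fP n).2.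
    exact: (measurableT_comp (fP n).1 measurable_fst).
  by exists p.
pose f (p : policy M) t := gamma * expected_cost p t.
have mf p : measurable_fun setT (f p) by exact: measurable_funM.
have fB p t : `|f p t| <= gamma * B by rewrite normrM gtr0_norm// ler_pM2l.
pose Z p := partition_function mu0 (f p).
have Z0 p : 0 < Z p by exact: (partition_function_gt0 mu0 (mf p) (fB p)).
have VE (p : policy M) : policy_value mu0 gamma p = gamma^-1 * ln (Z p) by [].
have fi (mu : probability Theta R) (p : policy M) : \int[mu]_t f p t = gamma * mean_expected_cost p mu.
  by rewrite /f RintegralZl//; exact: (bounded_integrable mu (mC p) (CB p)).
have gVE (p : policy M) : gamma * policy_value mu0 gamma p = ln (Z p).
  by rewrite VE mulVKf// gt_eqF.
have LV mu (p : policy M) : (lagrangian mu0 gamma mu p <= (policy_value mu0 gamma p)%:E)%E.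
  have := rel_entropy_ge mu0 (mf p) (fB p) mu; rewrite fi -/(Z p) -gVE -mulrBr => h.
  rewrite /lagrangian; apply: (@le_trans _ _ ((mean_expected_cost p mu)%:E -
    (mean_expected_cost p mu - policy_value mu0 gamma p)%:E)%E); last first.
    by rewrite -EFinB lee_fin opprB addrC subrK.
  apply: leeB => //; rewrite -(mulKf (lt0r_neq0 hgamma) (_ - _)) EFinM.
  by rewrite lee_pmul2l// lte_fin invr_gt0.
have LG (p : policy M) (P : probability Theta R) :
    (forall S, measurable S -> P S = (\int[mu0]_(x in S) (gibbs_density mu0 (f p) x)%:E)%E) ->
    lagrangian mu0 gamma P p = (policy_value mu0 gamma p)%:E.
  move=> Pw; rewrite /lagrangian (rel_entropy_gibbs (mf p) (fB p) Pw) fi -/(Z p) -gVE.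
  rewrite -mulrBr -EFinM -EFinB mulKf ?gt_eqF//; congr EFin; ring.
have supL (p : policy M) : ereal_sup (range (fun mu => lagrangian mu0 gamma mu p)) =
    (policy_value mu0 gamma p)%:E.
  apply/eqP; rewrite eq_le; apply/andP; split.
    by apply: ge_ereal_sup => _ [mu _ <-]; exact: LV.
  have [P Pw] := gibbs_exists mu0 (mf p) (fB p).
  by rewrite -(LG p P Pw); apply: ereal_sup_ubound; exists P.
have [ps Zs] : exists ps, forall p, Z ps <= Z p.
  apply: (minimizer p0 mC CB lim mu0 (phi := fun x => expR (gamma * x))).
  - by apply: measurableT_comp => //; exact: measurable_funM.
  - by move=> x y xy; rewrite ler_expR ler_pM2l.
  - exact: expRM_left.
  - exact: expRM_convex.
have Vs (p : policy M) : policy_value mu0 gamma ps <= policy_value mu0 gamma p.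
  have g0 : 0 < gamma^-1 by rewrite invr_gt0.
  rewrite (VE ps) (VE p) (ler_pM2l g0) (ler_ln (Z0 ps) (Z0 p)); exact: Zs.
have opt : optimal_value M mu0 gamma = (policy_value mu0 gamma ps)%:E.
  apply/eqP; rewrite eq_le; apply/andP; split.
    by apply: ereal_inf_lbound; exists ps.
  by apply: le_ereal_inf_tmp => _ [p _ <-]; rewrite lee_fin.
split; last by exists ps.
split.
  split; first by exists ps; rewrite supL opt.
  by move=> p; rewrite supL opt lee_fin.
(* The entropy does not depend on the policy, so it is enough to minimize the mean cost, even when
   the entropy is infinite. *)
have argmin mu : exists pm : policy M, forall p : policy M,
    (lagrangian mu0 gamma mu pm <= lagrangian mu0 gamma mu p)%E.
  have [pm le_pm] := minimizer p0 mC CB lim mu (phi := id) (@measurable_id _ _ _)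
    (fun x y => id) (fun x e e0 => ex_intro2 _ _ e e0 (lexx _))
    (fun n b k x _ => lexx _).
  by exists pm => p; apply: leeD2r; rewrite lee_fin; exact: le_pm.
pose pm mu := projT1 (cid (argmin mu)).
have pmP mu (p : policy M) : (lagrangian mu0 gamma mu (pm mu) <= lagrangian mu0 gamma mu p)%E.
  exact: (projT2 (cid (argmin mu)) p).
exists (fun mu => lagrangian mu0 gamma mu (pm mu)); split.
  by move=> mu; split; [exists (pm mu)|exact: pmP].
rewrite opt; apply/eqP; rewrite eq_le; apply/andP; split; last first.
  apply: ge_ereal_sup => _ [mu _ <-].
  exact: le_trans (pmP mu ps) (LV mu ps).
(* Against this measure [ps] attains the optimal value, and [saddle_point] with [q := pm P] shows
   that the minimizing policy does no better. *)
have [P Pw] := gibbs_exists mu0 (mf ps) (fB ps).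
apply: (@le_trans _ _ (lagrangian mu0 gamma P (pm P))); last first.
  by apply: ereal_sup_ubound; exists P.
rewrite -(LG ps P Pw); apply: leeD2r; rewrite lee_fin.
exact: (saddle_point mC CB lim B0 hgamma (pm P) Zs Pw).
Qed.
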